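(* Let $\eta>0$, let $f:\mathbb{R}^d\to\mathbb{R}$ be $\alpha_f$-strongly convex and $g:\mathbb{R}^d\to\mathbb{R}$ be $\alpha_g$-strongly convex ($\alpha_f,\alpha_g>0$), and let $$\pi^{XY}(x,y)\propto\exp\Big(-f(x)-g(y)-\frac{1}{2\eta}\|x-y\|_2^2\Big).$$ Consider the Gibbs sampler: draw $x^0\sim\mu_0^X$; for $k=0,1,2,\dots$, draw $y^k\sim\pi^{Y|X=x^k}\propto\exp(-g(y)-\frac{1}{2\eta}\|x^k-y\|_2^2)$ and then $x^{k+1}\sim\pi^{X|Y=y^k}\propto\exp(-f(x)-\frac{1}{2\eta}\|x-y^k\|_2^2)$. Let $\mu_k^{XY}$ be the law of $(x^k,y^k)$. Then for every $k\ge0$, $$D_{\mathrm{KL}}(\mu_k^{XY}\|\pi^{XY})\le\frac{D_{\mathrm{KL}}(\mu_0^X\|\pi^X)}{(1+\eta\alpha_f)^{2k}(1+\eta\alpha_g)^{2k}}.$$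
   Context: $\pi^X$ denotes the $X$-marginal of $\pi^{XY}$, and $\pi^{Y|X=x}$, $\pi^{X|Y=y}$ its conditionals. $D_{\mathrm{KL}}(\mu\|\nu)=\int\mu\log\frac{\mu}{\nu}$. A function $f$ is $\alpha$-strongly convex if $f(x)-f(y)\ge\nabla f(y)^T(x-y)+\frac{\alpha}{2}\|x-y\|_2^2$ for all $x,y$ (with $\nabla f$ a subgradient). *)

(* Defs.v *)
From HB Require Import structures.
From mathcomp Require Import all_boot all_order all_algebra.
From mathcomp Require Import all_classical all_reals all_analysis.
Set Implicit Arguments. Unset Strict Implicit. Unset Printing Implicit Defensive.
Import Order.TTheory GRing.Theory Num.Theory.
Import numFieldNormedType.Exports.
Local Open Scope classical_set_scope.
Local Open Scope ring_scope.

(* R^d is represented by d.-tuple R, which the library equips with the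
   product (= Borel) sigma-algebra generated by the coordinate maps. *)

Section euclid.
Context {R : realType} {d : nat}.

Definition sqdist (x y : d.-tuple R) : R :=
  \sum_(i < d) (tnth x i - tnth y i) ^+ 2.

Definition dotdiff (s x y : d.-tuple R) : R :=
  \sum_(i < d) tnth s i * (tnth x i - tnth y i).

Definition strongly_convex (alpha : R) (f : d.-tuple R -> R) : Prop :=
  forall y : d.-tuple R, exists s : d.-tuple R, forall x : d.-tuple R,
    dotdiff s x y + alpha / 2 * sqdist x y <= f x - f y.

Definition box (a b : d.-tuple R) : set (d.-tuple R) :=
  [set x | forall i : 'I_d, tnth a i <= tnth x i <= tnth b i].

(* lam is the Lebesgue measure on (the Borel sets of) R^d:
   it gives every closed box its volume (this determines it uniquely). *)
Definition is_lebesgue (lam : set (d.-tuple R) -> \bar R) : Prop :=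
  forall a b : d.-tuple R, (forall i : 'I_d, tnth a i <= tnth b i) ->
    lam (box a b) = (\prod_(i < d) (tnth b i - tnth a i))%:E.

End euclid.

Section KL.
Local Open Scope charge_scope.
Context {dT : measure_display} {T : measurableType dT} {R : realType}.

Definition KL (mu nu : probability T R) : \bar R :=
  if pselect (mu `<< nu) then
    (\int[mu]_x (ln (fine (('d (charge_of_finite_measure mu) '/d nu) x)))%:E)%E
  else +oo%E.

End KL.

(* Main.v *)
Require Import Defs.
From HB Require Import structures.
From mathcomp Require Import all_boot all_order all_algebra.
From mathcomp Require Import all_classical all_reals all_analysis.
From mathcomp Require Import measurable_realfun ring lra.
Import Order.TTheory GRing.Theory Num.Theory.
Import numFieldNormedType.Exports.
Local Open Scope classical_set_scope.
Local Open Scope ring_scope.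

(** Each half-step of the sampler contracts the relative entropy by
[rho2 = 1 / ((1 + eta alpha_f) (1 + eta alpha_g))], so a full step contracts it
by [rho2 ^ 2].

Let [h] be the density of the law of [x] w.r.t. [piX], let [k y] be the mean of
[h] under the conditional law [K y] of [x] given [y], and let [kappa y] be the
relative entropy w.r.t. [K y] of the law with density [h / k y].  The chain
rule reads [Ent h = Ent k + \int k kappa dpiY], so it suffices to bound [Ent k]
by [sigma / alphaY] times [\int k kappa dpiY], where [sigma = 1 / (eta (1 + eta alpha_f))]
is the subgaussian constant of [<x, delta> / eta] under [K y] and
[alphaY = alpha_g + alpha_f / (1 + eta alpha_f)] is the strong log-concavity
constant of [piY].  Both constants come from the Prekopa-Leindler inequality.
The Gibbs variational principle and subgaussianity give
[ln (k (y + delta)) - ln (k y) <= l kappa y + (sigma / (2 l) + L) |delta|^2]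
for every [l > 0].  Inserting this in the Prekopa-Leindler inequality for [piY]
applied to [k ^ (1 / (1 - s))], [1] and [k exp (l kappa)], with [l] proportional
to [s], and letting [s] tend to [0] yields the bound (as in the Bobkov-Ledoux
proof of the logarithmic Sobolev inequality) when [h] is bounded away from [0]
and infinity.  The general case follows by truncating [h] and Fatou's lemma. *)

(** * Prekopa-Leindler inequality *)

(** Nothing is differentiated: [f] and [g] come with subgradients only, so curvature enters through
    convex combinations of points and first-order terms through limits in a small parameter.

    The value of [rho2] comes from solving [alphaY * Ent k <= sigma * (Ent h - Ent k)] for [Ent k].
    The factor is [sigma / (alphaY + sigma)]; since [sigma] is [1 / eta] minus the part of [alphaY]
    due to the partition function, the denominator collapses to [alpha_g + 1 / eta]. The result is
    symmetric in [f] and [g], so both half-steps contract equally.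

    The constant [L] is a crude second-order remainder. It disappears in the limit [s -> 0], which
    leaves only the sharp constants, but it depends on the bounds of [h]; this is why bounded
    densities are treated separately.

    The laws of [(x^k, y^k)] and of the target share the conditional of [y] given [x]. The joint
    density therefore depends on [x] alone, and the joint entropy equals that of the law of [x^k],
    reached after exactly [2 k] half-steps. *)

Section brunn_minkowski.
Context {R : realType}.
Local Notation mu := (@lebesgue_measure R).

(** Uniqueness of Lebesgue measure: the pushforward of [mu] by the affine map, rescaled by [1 / t],
    has the right value on half-open intervals. *)
Lemma lebesgue_measure_affine (t c : R) (A : set R) : 0 < t -> measurable A ->
  mu ((fun x => (x - c) / t) @^-1` A) = (t%:E * mu A)%E.
Proof.
move=> t0 mA.
pose phi : measurableTypeR R -> measurableTypeR R := fun x => (x - c) / t.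
have mphi : measurable_fun setT phi.
  by apply: measurable_funM => //; exact: measurable_funB.
have ti0 : 0 <= t^-1 by rewrite invr_ge0 ltW.
pose m' : {measure set (measurableTypeR R) -> \bar R} :=
  mscale (NngNum ti0) (pushforward mu phi).
pose m := m' mphi.
have mE B : m B = (t^-1%:E * mu (phi @^-1` B))%E by [].
have : mu A = m A.
  apply: lebesgue_measure_unique => // _ [[a b] _ <-].
  rewrite mE /=.
  rewrite (_ : phi @^-1` `]a, b] = `]t * a + c, t * b + c]%classic); last first.
    apply/seteqP; split => x /=; rewrite !in_itv/= /phi.
      by rewrite ltr_pdivlMr// ler_pdivrMr//; lra.
    by rewrite ltr_pdivlMr// ler_pdivrMr//; lra.
  rewrite !lebesgue_measure_itv/= !lte_fin ltrD2r ltr_pM2l//.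
  case: ifPn => ab; last by rewrite mule0.
  rewrite -!EFinB -EFinM; congr (_%:E); field; exact: lt0r_neq0.
rewrite mE => ->; rewrite muleA -EFinM divff ?lt0r_neq0// mul1e.
by [].
Qed.

(** The sets [X = t A + (1 - t) b] and [Y = t a + (1 - t) B] both lie in [C]. With [a] within [e] of
    [sup A] and [b] within [e] of [inf B], [X] ends about where [Y] begins, and their overlap has
    measure at most [e]. *)
Lemma brunn_minkowski1_bounded (t n : R) (A B C : set R) : 0 < t < 1 ->
  measurable A -> measurable B -> measurable C ->
  A !=set0 -> B !=set0 -> A `<=` `[- n, n] -> B `<=` `[- n, n] ->
  (forall a b, A a -> B b -> C (t * a + (1 - t) * b)) ->
  (t%:E * mu A + (1 - t)%:E * mu B <= mu C)%E.
Proof.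
move=> /andP[t0 t1] mA mB mC A0 B0 An Bn ABC.
have s0 : 0 < 1 - t by rewrite subr_gt0.
have supA : has_sup A.
  by split => //; exists n => x /An /=; rewrite in_itv/= => /andP[].
have infB : has_inf B.
  by split => //; exists (- n) => x /Bn /=; rewrite in_itv/= => /andP[].
apply/lee_addgt0Pr => e e0.
have [a Aa asup] := sup_adherent e0 supA.
have [b Bb binf] := inf_adherent e0 infB.
pose X := (fun x => (x - (1 - t) * b) / t) @^-1` A.
pose Y := (fun x => (x - t * a) / (1 - t)) @^-1` B.
have mX : measurable X.
  rewrite /X -[X in measurable X]setTI.
  by apply: (_ : measurable_fun setT (fun x : R => (x - (1 - t) * b) / t)) => //;
    apply: measurable_funM => //; exact: measurable_funB.
have mY : measurable Y.
  rewrite /Y -[X in measurable X]setTI.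
  by apply: (_ : measurable_fun setT (fun x : R => (x - t * a) / (1 - t))) => //;
    apply: measurable_funM => //; exact: measurable_funB.
have muX : mu X = (t%:E * mu A)%E by exact: lebesgue_measure_affine.
have muY : mu Y = ((1 - t)%:E * mu B)%E by exact: lebesgue_measure_affine.
have XC : X `<=` C.
  move=> x Xx; have := ABC _ _ Xx Bb.
  by rewrite (_ : t * ((x - (1 - t) * b) / t) + (1 - t) * b = x)//; field; exact: lt0r_neq0.
have YC : Y `<=` C.
  move=> x Xx; have := ABC _ _ Aa Xx.
  by rewrite (_ : t * a + (1 - t) * ((x - t * a) / (1 - t)) = x)//; field; exact: lt0r_neq0.
have finA : (mu A < +oo)%E.
  apply: (@le_lt_trans _ _ (mu `[- n, n]%classic)).
    by apply: le_measure; rewrite ?inE.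
  by rewrite lebesgue_measure_itv/=; case: ifP => //; rewrite -EFinB ltry.
have finX : (mu X < +oo)%E.
  by rewrite muX; apply: lte_mul_pinfty => //; rewrite ?lee_fin ltW.
rewrite -muX -muY.
pose m := t * sup A + (1 - t) * inf B.
have XY : X `&` Y `<=` `[m - t * e, m + (1 - t) * e].
  move=> x [Xx Yx] /=; rewrite in_itv/=.
  have h1 : (x - (1 - t) * b) / t <= sup A by apply: ub_le_sup => //; exact: supA.2.
  have h2 : inf B <= (x - t * a) / (1 - t) by apply: ge_inf => //; exact: infB.2.
  move: h1 h2; rewrite ler_pdivrMr// ler_pdivlMr// => h1 h2.
  by apply/andP; split; rewrite /m; nra.
have muXY : (mu (X `&` Y) <= e%:E)%E.
  apply: (@le_trans _ _ (mu `[m - t * e, m + (1 - t) * e]%classic)).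
    by apply: le_measure; rewrite ?inE//; exact: measurableI.
  rewrite lebesgue_measure_itv/=; case: ifP => // _; last by rewrite lee_fin ltW.
  by rewrite -EFinB lee_fin; lra.
have : (mu X + mu Y - mu (X `&` Y) <= mu C)%E.
  rewrite -measureUfinl//; apply: le_measure; rewrite ?inE//.
    exact: measurableU.
  by rewrite subUset.
have finXY : mu (X `&` Y) \is a fin_num.
  by rewrite ge0_fin_numE//; exact: (le_lt_trans muXY (ltry _)).
rewrite leeBlDr// => /le_trans; apply.
exact: leeD2l.
Qed.

Lemma brunn_minkowski1 (t : R) (A B C : set R) : 0 < t < 1 ->
  measurable A -> measurable B -> measurable C -> A !=set0 -> B !=set0 ->
  (forall a b, A a -> B b -> C (t * a + (1 - t) * b)) ->
  (t%:E * mu A + (1 - t)%:E * mu B <= mu C)%E.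
Proof.
move=> t01 mA mB mC A0 B0 ABC; have /andP[t0 t1] := t01.
pose I n : set R := `[- n%:R, n%:R]%classic.
have mI n : measurable (I n) by exact: measurable_itv.
have ndI D : nondecreasing_seq (fun n => D `&` I n).
  apply/nondecreasing_seqP => n; apply/subsetPset => x [Dx]; rewrite /I/= !in_itv/= => /andP[h1 h2].
  by split => //; rewrite -natr1; apply/andP; split; lra.
have inI (x : R) : \forall n \near \oo, I n x.
  near=> n; rewrite /I/= in_itv/= -ler_norml.
  near: n; exact: nbhs_infty_ger.
have cupI D : \bigcup_n (D `&` I n) = D.
  apply/seteqP; split => [x [n _ []]//|x Dx].
  by have [n _ /(_ n (leqnn n)) Inx] := inI x; exists n.
have cvgI D : measurable D -> mu (D `&` I n) @[n --> \oo] --> mu D.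
  move=> mD; rewrite -[in X in _ --> X](cupI D).
  have mDI n : measurable (D `&` I n) by exact: measurableI.
  apply: nondecreasing_cvg_mu => //.
  exact: (bigcup_measurable (fun n _ => mDI n)).
have cv : (t%:E * mu (A `&` I n) + (1 - t)%:E * mu (B `&` I n) @[n --> \oo]
          --> t%:E * mu A + (1 - t)%:E * mu B)%E.
  apply: cvgeD.
  - by apply: ge0_adde_def; rewrite inE mule_ge0// lee_fin; lra.
  - by apply: cvgeZl => //; exact: cvgI.
  - by apply: cvgeZl => //; exact: cvgI.
rewrite -(cvg_lim _ cv)//; apply: lime_le; first by apply/cvg_ex; eexists; exact: cv.
case: A0 => a Aa; case: B0 => b Bb.
near=> n; apply: (@brunn_minkowski1_bounded t n%:R) => //.
- exact: measurableI.
- exact: measurableI.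
- by exists a; split => //; near: n; exact: inI.
- by exists b; split => //; near: n; exact: inI.
- by move=> x y [Ax _] [By _]; exact: ABC.
Unshelve. all: by end_near. Qed.

End brunn_minkowski.

(** * Layer-cake formula *)

Section layer_cake.
Context {d} {T : measurableType d} {R : realType}.
Variable mu : {sigma_finite_measure set T -> \bar R}.
Local Notation leb := (@lebesgue_measure R).

Lemma measurable_superlevel (f : T -> \bar R) : measurable_fun setT f ->
  measurable_fun setT (fun r : measurableTypeR R => mu [set x | (r%:E < f x)%E]).
Proof.
move=> mf.
pose D : set (T * measurableTypeR R) := [set z | (z.2%:E < f z.1)%E].
have mD : measurable D.
  rewrite -[X in measurable X]setTI.
  have : measurable_fun setT (fun z : T * measurableTypeR R => (z.2%:E < f z.1)%E).
    apply: measurable_fun_lte; last exact: measurableT_comp.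
    by apply/measurable_EFinP; exact: measurable_snd.
  by move=> /(_ measurableT [set true]); exact.
rewrite (_ : (fun _ => _) = mu \o ysection D); first exact: measurable_fun_ysection.
apply/funext => r /=; congr (mu _); apply/seteqP; split => x /=; rewrite /ysection/= ?inE//.
Qed.

(** Tonelli for the indicator of the region under the graph. The value [+oo] is allowed, as the
    majorant in the Prekopa-Leindler inequality may take it. *)
Lemma layer_cake (f : T -> \bar R) : measurable_fun setT f ->
  (forall x, 0 <= f x)%E ->
  (\int[mu]_x f x = \int[leb]_(r in `[0%R, +oo[) mu [set x | r%:E < f x])%E.
Proof.
move=> mf f0.
pose D : set (T * measurableTypeR R) := [set z | (0 <= z.2)%R /\ (z.2%:E < f z.1)%E].
have mD : measurable D.
  rewrite (_ : D = (setT `*` `[0%R, +oo[) `&` [set z | (z.2%:E < f z.1)%E]); last first.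
    by apply/seteqP; split => -[x r] /=; rewrite in_itv/= andbT => -[] => // -[].
  apply: measurableI; first exact: measurableX.
  rewrite -[X in measurable X]setTI.
  have : measurable_fun setT (fun z : T * measurableTypeR R => (z.2%:E < f z.1)%E).
    apply: measurable_fun_lte; last exact: measurableT_comp.
    by apply/measurable_EFinP; exact: measurable_snd.
  by move=> /(_ measurableT [set true]); exact.
have mI : measurable_fun setT (fun z : T * measurableTypeR R => (\1_D z)%:E : \bar R).
  by apply/measurable_EFinP; exact: measurable_indic.
have I0 z : (0 <= (\1_D z)%:E :> \bar R)%E by rewrite lee_fin.
have := fubini_tonelli (m1 := mu) (m2 := leb) _ mI I0.
have -> : (\int[mu]_x \int[leb]_y (\1_D (x, y))%:E = \int[mu]_x f x)%E.
  apply: eq_integral => x _.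
  rewrite (eq_integral (fun y : measurableTypeR R => (\1_([set r : measurableTypeR R | 0 <= r /\ (r%:E < f x)%E]) y)%:E)); last first.
    by move=> y _; rewrite !indicE; congr ((_ : bool)%:R%:E); apply/idP/idP; rewrite !inE.
  have [[r fr rge0]|fy] : (exists2 r, f x = r%:E & 0 <= r) \/ f x = +oo%E.
    by move: (f0 x); case: (f x) => [r|_|//]; [left; exists r|right].
  - rewrite (_ : [set _ | _] = `[0, r[%classic); last first.
      apply/seteqP; split => y /=; rewrite in_itv/= fr lte_fin.
        by move=> [-> ->].
      by move=> /andP[].
    rewrite integral_indic// setIT/= lebesgue_measure_itv/= lte_fin fr.
    case: ifPn; first by rewrite oppr0 adde0.
    by rewrite -leNgt => r0; congr (_%:E); apply/eqP; rewrite eq_le r0 rge0.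
  - rewrite (_ : [set _ | _] = `[0, +oo[%classic); last first.
      apply/seteqP; split => y /=; rewrite in_itv/= andbT fy.
        by move=> [].
      by move=> ?; split => //; rewrite ltry.
    by rewrite integral_indic// setIT/= lebesgue_measure_itv/= ltry fy.
move=> ->.
rewrite [RHS]integral_mkcond; apply: eq_integral => r _.
rewrite patchE; have [r0|r0] := leP 0 r.
  rewrite mem_set/= ?in_itv/= ?r0//.
  rewrite (eq_integral (fun x => (\1_([set x | (r%:E < f x)%E]) x)%:E)); last first.
    move=> y _; rewrite !indicE; congr ((_ : bool)%:R%:E); apply/idP/idP; rewrite !inE => //.
      by case.
  rewrite integral_indic ?setIT//.
  rewrite -[X in measurable X]setTI.
  by apply: emeasurable_fun_o_infty.
rewrite memNset/=; last by rewrite in_itv/= andbT leNgt r0.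
by rewrite integral0_eq// => x _; rewrite indicE memNset//= => -[]; rewrite leNgt r0.
Qed.

End layer_cake.

(** * Weighted geometric means of extended reals *)

Section powers.
Context {R : realType}.
Implicit Types t a b : R.

Lemma powR_amgm t a b : 0 < t < 1 -> 0 <= a -> 0 <= b ->
  a `^ t * b `^ (1 - t) <= t * a + (1 - t) * b.
Proof.
move=> /andP[t0 t1] a0 b0.
have s0 : 0 < 1 - t by rewrite subr_gt0.
have := @conjugate_powR R (a `^ t) (b `^ (1 - t)) t^-1 (1 - t)^-1
  (powR_ge0 _ _) (powR_ge0 _ _).
rewrite !invr_gt0 !invrK => /(_ t0 s0); rewrite subrKC => /(_ erefl).
by rewrite -!powRrM !divff ?lt0r_neq0// !powRr1// (mulrC a) (mulrC b).
Qed.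

Local Open Scope ereal_scope.

Lemma poweR_amgm t (a b : \bar R) : (0 < t < 1)%R -> 0 <= a -> 0 <= b ->
  a `^ t * b `^ (1 - t) <= t%:E * a + (1 - t)%:E * b.
Proof.
move=> t01; have /andP[t0 t1] := t01.
have s0 : (0 < 1 - t)%R by rewrite subr_gt0.
case: a => [a| |] // a0; case: b => [b| |] // b0.
- by rewrite !poweR_EFin -!EFinM -EFinD lee_fin; exact: powR_amgm.
- by rewrite [X in _ <= _ + X]gt0_muley ?lte_fin// addey ?leey// -EFinM.
- by rewrite [X in _ <= X + _]gt0_muley ?lte_fin// addye ?leey// -EFinM.
- by rewrite !gt0_muley ?lte_fin// leey.
Qed.

(* Continuity of [(a, b) |-> a `^ t * b `^ (1 - t)] from below. *)
Lemma poweR_mul_lub t (a b c : \bar R) : (0 < t < 1)%R -> 0 <= a -> 0 <= b -> 0 <= c ->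
  (forall x y : R, (0 <= x)%R -> (0 <= y)%R -> x%:E < a -> y%:E < b ->
     (x `^ t * y `^ (1 - t))%:E <= c) ->
  a `^ t * b `^ (1 - t) <= c.
Proof.
move=> t01 a0 b0 c0 H; have /andP[t0 t1] := t01.
have s0 : (0 < 1 - t)%R by rewrite subr_gt0.
have tn0 : t != 0%R by rewrite lt0r_neq0.
have sn0 : (1 - t)%R != 0%R by rewrite lt0r_neq0.
have [->|an0] := eqVneq a 0; first by rewrite poweR0r// mul0e.
have [->|bn0] := eqVneq b 0; first by rewrite poweR0r// mule0.
have a1 : 0 < a by rewrite lt0e an0.
have b1 : 0 < b by rewrite lt0e bn0.
case: c c0 H => [c| |//] c0 H; last by rewrite leey.
have scale (x y k : R) : (0 <= x)%R -> (0 <= y)%R -> (0 <= k)%R ->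
   ((k * x) `^ t * (k * y) `^ (1 - t) = k * (x `^ t * y `^ (1 - t)))%R.
  move=> x0 y0 k0; rewrite !powRM// mulrACA -powRD ?subrKC ?powRr1//.
  by rewrite oner_eq0.
have big (e : \bar R) : 0 < e -> exists2 x : R, (0 < x)%R & x%:E < e.
  case: e => [e|_|//]; last by exists 1%R => //; rewrite ltry.
  by rewrite lte_fin => e0; exists (e / 2)%R; rewrite ?lte_fin; lra.
move: a b a0 b0 H a1 b1 an0 bn0 => [a| |] [b| |] // a0 b0 H a1 b1 _ _.
- have {}a0 : (0 <= a)%R by rewrite -lee_fin.
  have {}a1 : (0 < a)%R by rewrite -lte_fin.
  have {}b0 : (0 <= b)%R by rewrite -lee_fin.
  have {}b1 : (0 < b)%R by rewrite -lte_fin.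
  rewrite !poweR_EFin -EFinM lee_fin; set p := (_ * _)%R.
  have p0 : (0 <= p)%R by rewrite mulr_ge0// powR_ge0.
  rewrite leNgt; apply/negP => cp.
  have pp : (0 < p)%R by apply: le_lt_trans cp; rewrite -lee_fin.
  (* If the product [p] exceeded [c], shrinking both factors by [k], halfway between [c / p] and
     [1], would by homogeneity of degree one still give a product above [c]. *)
  pose k := ((1 + c / p) / 2)%R.
  have cp1 : (c / p < 1)%R by rewrite ltr_pdivrMr// mul1r.
  have cp0 : (0 <= c / p)%R by rewrite divr_ge0// -lee_fin.
  have k1 : (k < 1)%R by rewrite /k; lra.
  have k0 : (0 < k)%R by rewrite /k; lra.
  have ka : (k * a < a)%R by rewrite gtr_pMl.
  have kb : (k * b < b)%R by rewrite gtr_pMl.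
  have := H (k * a)%R (k * b)%R (mulr_ge0 (ltW k0) a0) (mulr_ge0 (ltW k0) b0).
  rewrite !lte_fin => /(_ ka kb).
  rewrite scale// ?(ltW k0)// lee_fin -/p leNgt => /negP; apply.
  rewrite -ltr_pdivrMr// /k; lra.
- have {}a0 : (0 <= a)%R by rewrite -lee_fin.
  have {}a1 : (0 < a)%R by rewrite -lte_fin.
  have [x x0 xa] := big a%:E a1.
  (* With [b] infinite, the second point is chosen to make the product exactly [c + 1]. *)
  have := H x (((c + 1) / x `^ t) `^ (1 - t)^-1)%R (ltW x0) (powR_ge0 _ _) xa (ltry _).
  rewrite -powRrM mulVf// powRr1; last first.
    by rewrite divr_ge0 ?powR_ge0// addr_ge0// -lee_fin.
  by rewrite mulrC divfK ?lt0r_neq0 ?powR_gt0// lee_fin gerDl ler10.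
- have {}b0 : (0 <= b)%R by rewrite -lee_fin.
  have {}b1 : (0 < b)%R by rewrite -lte_fin.
  have [y y0 yb] := big b%:E b1.
  have := H (((c + 1) / y `^ (1 - t)) `^ t^-1)%R y (powR_ge0 _ _) (ltW y0) (ltry _) yb.
  rewrite -powRrM mulVf// powRr1; last first.
    by rewrite divr_ge0 ?powR_ge0// addr_ge0// -lee_fin.
  by rewrite divfK ?lt0r_neq0 ?powR_gt0// lee_fin gerDl ler10.
- have c10 : (0 <= c + 1)%R by rewrite addr_ge0// -lee_fin.
  have := H (c + 1)%R (c + 1)%R c10 c10 (ltry _) (ltry _).
  by rewrite -powRD ?subrKC ?powRr1 ?oner_eq0// lee_fin gerDl ler10.
Qed.

End powers.

(** An arbitrary operation [op] replaces the convex combination, so that the property can be carried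
    through products and pushforwards. The function [w] is any measurable majorant instead of the
    supremal convolution, which may fail to be measurable; values are extended because partial
    integrals may be infinite. *)
Definition prekopa_leindler {d} {T : measurableType d} {R : realType} (t : R)
    (mu : {measure set T -> \bar R}) (op : T -> T -> T) : Prop :=
  forall u v w : T -> \bar R,
    measurable_fun setT u -> measurable_fun setT v -> measurable_fun setT w ->
    (forall x, 0 <= u x)%E -> (forall x, 0 <= v x)%E -> (forall x, 0 <= w x)%E ->
    (forall x y, u x `^ t * v y `^ (1 - t) <= w (op x y))%E ->
  ((\int[mu]_x u x) `^ t * (\int[mu]_x v x) `^ (1 - t) <= \int[mu]_x w x)%E.

(** * Prekopa-Leindler inequality on the line *)

Section prekopa_leindler1.
Context {R : realType}.
Variable t : R.
Hypothesis t01 : 0 < t < 1.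
Local Notation mu := (@lebesgue_measure R).
Implicit Types u v w : measurableTypeR R -> \bar R.
Local Open Scope ereal_scope.

(** Both suprema are [1], so at every level [r < 1] the superlevel sets of [u] and [v] are nonempty,
    as Brunn-Minkowski requires, and their combination lies in that of [w]. Integrating over the
    levels gives an arithmetic mean on the left, which dominates the geometric one. *)
Lemma prekopa_leindler1_sup1 u v w :
  measurable_fun setT u -> measurable_fun setT v -> measurable_fun setT w ->
  (forall x, 0 <= u x <= 1) -> (forall x, 0 <= v x <= 1) -> (forall x, 0 <= w x) ->
  (forall r, (r < 1)%R -> exists x, r%:E < u x) ->
  (forall r, (r < 1)%R -> exists x, r%:E < v x) ->
  (forall x y, u x `^ t * v y `^ (1 - t) <= w (t * x + (1 - t) * y)%R) ->
  t%:E * \int[mu]_x u x + (1 - t)%:E * \int[mu]_x v x <= \int[mu]_x w x.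
Proof.
move=> mu_ mv mw u01 v01 w0 supu supv H; have /andP[t0 t1] := t01.
have s0 : (0 < 1 - t)%R by rewrite subr_gt0.
have u0 x : 0 <= u x by case/andP: (u01 x).
have v0 x : 0 <= v x by case/andP: (v01 x).
rewrite !(layer_cake mu)//.
have ms f : measurable_fun setT f ->
    measurable_fun (`[0%R, +oo[ : set (measurableTypeR R)) (fun r => mu [set x | r%:E < f x]).
  by move=> mf; apply: measurable_funTS; exact: measurable_superlevel.
have mset f r : measurable_fun setT f -> measurable [set x : R | r%:E < f x].
  by move=> mf; rewrite -[X in measurable X]setTI; exact: emeasurable_fun_o_infty.
rewrite -!ge0_integralZl//; do ?[exact: ms | by rewrite lee_fin ltW].
rewrite -ge0_integralD//; last 4 first.
- by move=> r _; rewrite mule_ge0// lee_fin ltW.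
- by apply: measurable_funeM; exact: ms.
- by move=> r _; rewrite mule_ge0// lee_fin ltW.
- by apply: measurable_funeM; exact: ms.
apply: ge0_le_integral => //.
- by move=> r _; rewrite adde_ge0// mule_ge0// lee_fin ltW.
- by apply: emeasurable_funD; apply: measurable_funeM; exact: ms.
- exact: ms.
move=> r /=; rewrite in_itv/= andbT => r0.
have [r1|r1] := ltP r 1%R; last first.
  rewrite (_ : [set x | r%:E < u x] = set0); last first.
    apply/seteqP; split => // x /=; case/andP: (u01 x) => _ h1 h2.
    by have := lt_le_trans h2 h1; rewrite lte_fin ltNge r1.
  rewrite (_ : [set x | r%:E < v x] = set0); last first.
    apply/seteqP; split => // x /=; case/andP: (v01 x) => _ h1 h2.
    by have := lt_le_trans h2 h1; rewrite lte_fin ltNge r1.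
  by rewrite !measure0 !mule0 adde0.
apply: brunn_minkowski1 => //; [exact: mset..|exact: supu|exact: supv|].
move=> x y /= rx ry; apply: lt_le_trans (H x y).
move: (u01 x) (v01 y) rx ry; case: (u x) => [a| |]; case: (v y) => [b| |];
  try by [move=> /andP[] | move=> _ /andP[]].
rewrite !lee_fin !lte_fin => /andP[a0 _] /andP[b0 _] ra rb.
have ap : (0 < a)%R by exact: le_lt_trans ra.
have bp : (0 < b)%R by exact: le_lt_trans rb.
have -> : r = (r `^ t * r `^ (1 - t))%R.
  by rewrite -powRD ?subrKC ?powRr1// oner_eq0.
apply: ltr_pM; rewrite ?powR_ge0//; apply: gt0_ltr_powR => //; rewrite nnegrE// ltW.
Qed.

(** Dividing [u] and [v] by their suprema reduces to suprema [1]; a vanishing supremum makes the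
    left side [0]. The arithmetic-geometric mean inequality is applied to the normalized integrals,
    and homogeneity removes the normalization. *)
Lemma prekopa_leindler1_bounded (N : R) u v w :
  measurable_fun setT u -> measurable_fun setT v -> measurable_fun setT w ->
  (forall x, 0 <= u x <= N%:E) -> (forall x, 0 <= v x <= N%:E) -> (forall x, 0 <= w x) ->
  (forall x y, u x `^ t * v y `^ (1 - t) <= w (t * x + (1 - t) * y)%R) ->
  (\int[mu]_x u x) `^ t * (\int[mu]_x v x) `^ (1 - t) <= \int[mu]_x w x.
Proof.
move=> mu_ mv mw u01 v01 w0 H; have /andP[t0 t1] := t01.
have s0 : (0 < 1 - t)%R by rewrite subr_gt0.
have u0 x : 0 <= u x by case/andP: (u01 x).
have v0 x : 0 <= v x by case/andP: (v01 x).
have supE f : (forall x, 0 <= f x <= N%:E) -> (\int[mu]_x f x = 0) \/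
    exists2 A : R, (0 < A)%R & (forall x, 0 <= A^-1%:E * f x <= 1) /\
      (forall r, (r < 1)%R -> exists x, r%:E < A^-1%:E * f x).
  move=> f01; have f0 x : 0 <= f x by case/andP: (f01 x).
  have := ereal_sup_ubound; pose S := ereal_sup (range f) => ub.
  have S0 : 0 <= S by apply: le_trans (f0 0%R) _; apply: ub; exists 0%R.
  have SN : S <= N%:E by apply: ge_ereal_sup => _ [x _ <-]; case/andP: (f01 x).
  have fS x : f x <= S by apply: ub; exists x.
  have [S00|Sn0] := eqVneq S 0.
    left; rewrite integral0_eq// => x _.
    by apply/eqP; rewrite eq_le f0 andbT -S00.
  right.
  have SE : S = (fine S)%:E by rewrite fineK// ge0_fin_numE//; exact: le_lt_trans SN (ltry _).
  have A0 : (0 < fine S)%R by rewrite -lte_fin -SE lt0e Sn0.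
  exists (fine S) => //; split => [x|r r1].
    rewrite mule_ge0 ?lee_fin ?invr_ge0 ?(ltW A0)//=.
    rewrite (_ : 1 = (fine S)^-1%:E * S); last first.
      by rewrite SE -EFinM mulVf ?lt0r_neq0.
    by apply: lee_wpmul2l => //; rewrite lee_fin invr_ge0 ltW.
  have : (r * fine S)%:E < S by rewrite SE lte_fin gtr_pMl.
  move/ereal_sup_gt => [_ [x _ <-] h]; exists x.
  by rewrite muleC lte_pdivlMr.
have [->|[A A0 [hA1 hA2]]] := supE u u01.
  by rewrite poweR0r ?lt0r_neq0// mul0e integral_ge0.
have [->|[B B0 [hB1 hB2]]] := supE v v01.
  by rewrite (poweR0r (_ : 1 - t != 0)%R) ?lt0r_neq0// mule0 integral_ge0.
pose C := (A `^ t * B `^ (1 - t))%R.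
have C0 : (0 < C)%R by rewrite mulr_gt0// powR_gt0.
have pow1 (a c : R) (x : \bar R) : (0 < a)%R -> 0 <= x ->
    (a^-1%:E * x) `^ c = (a `^ c)^-1%:E * x `^ c.
  move=> a0 x0; rewrite poweRM//; last by rewrite lee_fin invr_ge0 ltW.
  by rewrite poweR_EFin -powR_inv1 ?ltW// -powRrM mulN1r powRN.
have pow (a b : R) (x y : \bar R) : (0 < a)%R -> (0 < b)%R -> 0 <= x -> 0 <= y ->
    (a^-1%:E * x) `^ t * (b^-1%:E * y) `^ (1 - t) =
    (a `^ t * b `^ (1 - t))^-1%:E * (x `^ t * y `^ (1 - t)).
  by move=> a0 b0 x0 y0; rewrite !pow1// muleACA invfM EFinM.
have := @prekopa_leindler1_sup1 (fun x => A^-1%:E * u x) (fun x => B^-1%:E * v x)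
  (fun x => C^-1%:E * w x).
have mZ (a : R) (f : measurableTypeR R -> \bar R) : measurable_fun setT f -> measurable_fun setT (fun x : measurableTypeR R => a%:E * f x).
  by move=> mf; exact: measurable_funeM.
move=> /(_ (mZ _ _ mu_) (mZ _ _ mv) (mZ _ _ mw) hA1 hB1).
have Cw x : 0 <= C^-1%:E * w x by rewrite mule_ge0// lee_fin invr_ge0 ltW.
move=> /(_ Cw hA2 hB2).
have HH x y : (A^-1%:E * u x) `^ t * (B^-1%:E * v y) `^ (1 - t) <=
    C^-1%:E * w (t * x + (1 - t) * y)%R.
  by rewrite pow//; apply: lee_wpmul2l => //; rewrite lee_fin invr_ge0 ltW.
move=> /(_ HH).
rewrite !ge0_integralZl// ?lee_fin ?invr_ge0 ?(ltW A0) ?(ltW B0) ?(ltW C0)// => K.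
have I0 f : (forall x, 0 <= f x) -> 0 <= \int[mu]_x f x by move=> f0; exact: integral_ge0.
have IA : 0 <= A^-1%:E * \int[mu]_x u x by rewrite mule_ge0 ?I0// lee_fin invr_ge0 ltW.
have IB : 0 <= B^-1%:E * \int[mu]_x v x by rewrite mule_ge0 ?I0// lee_fin invr_ge0 ltW.
have := le_trans (poweR_amgm _ _ _ t01 IA IB) K.
rewrite pow ?I0// -/C.
by rewrite lee_pmul2l// lte_fin invr_gt0.
Qed.

(** Truncating [u] and [v] at height [n] reduces to bounded functions. Comparing only with reals
    strictly below the two integrals lets one [n] serve both and covers infinite integrals. *)
Lemma prekopa_leindler_lebesgue :
  prekopa_leindler t mu (fun x y : measurableTypeR R => t * x + (1 - t) * y)%R.
Proof.
move=> u v w mu_ mv mw u0 v0 w0 H.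
have I0 f : (forall x, 0 <= f x) -> 0 <= \int[mu]_x f x by move=> f0; exact: integral_ge0.
pose tr (f : measurableTypeR R -> \bar R) (n : nat) (x : measurableTypeR R) : \bar R := mine (f x) n%:R%:E.
have mtr f n : measurable_fun setT f -> measurable_fun setT (tr f n).
  by move=> mf; exact: measurable_mine.
have tr0 f n x : (forall x, 0 <= f x) -> 0 <= tr f n x <= n%:R%:E.
  by move=> f0; rewrite /tr le_min f0 lee_fin ler0n ge_min lexx orbT.
have trf f n x : tr f n x <= f x by rewrite /tr ge_min lexx.
have trcvg f (x : R) : measurable_fun setT f -> (forall x, 0 <= f x) ->
    x%:E < \int[mu]_y f y -> exists n, forall m, (n <= m)%N -> x%:E < \int[mu]_y tr f m y.
  move=> mf f0 xf.
  have ndtr y : {homo (fun n => tr f n y) : n m / (n <= m)%N >-> n <= m}.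
    by move=> n m nm; rewrite /tr le_min !ge_min lexx/= lee_fin ler_nat nm orbT.
  have nd n m : (n <= m)%N -> \int[mu]_y tr f n y <= \int[mu]_y tr f m y.
    move=> nm; apply: ge0_le_integral => //; [|exact: mtr|exact: mtr|] => y _; last exact: ndtr.
    by case/andP: (tr0 f n y f0).
  apply: contrapT => /forallNP hn.
  suff : \int[mu]_y f y <= x%:E by rewrite leNgt xf.
  have -> : \int[mu]_y f y = limn (fun n => \int[mu]_y tr f n y).
    rewrite -monotone_convergence//; last 2 first.
    - by move=> n; exact: mtr.
    - by move=> n y _; case/andP: (tr0 f n y f0).
    apply: eq_integral => y _; apply/esym/cvg_lim => //.
    have := f0 y; case E : (f y) => [r| |]// r0.
      apply: (@cvg_near_cst _ _ _ _ _ _) => //.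
      near=> n; rewrite /tr E; apply: min_l; rewrite lee_fin.
      by near: n; exact: nbhs_infty_ger.
    rewrite (_ : tr f ^~ y = fun n => n%:R%:E).
      by apply/cvgeryP; exact: cvgr_idn.
    by apply/funext => n; rewrite /tr E min_r// leey.
  apply: lime_le; first exact: ereal_nondecreasing_is_cvgn.
  near=> n; rewrite leNgt; apply/negP => h.
  by apply: (hn n) => m nm; exact: lt_le_trans h (nd _ _ nm).
apply: poweR_mul_lub; rewrite ?I0// => x y x0 y0 xu yv.
have [n1 h1] := trcvg u x mu_ u0 xu.
have [n2 h2] := trcvg v y mv v0 yv.
pose n := maxn n1 n2.
have := @prekopa_leindler1_bounded n%:R (tr u n) (tr v n) w (mtr u n mu_) (mtr v n mv) mw
  (fun x => tr0 u n x u0) (fun x => tr0 v n x v0) w0.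
have /andP[t0 t1] := t01.
have tge0 : (0 <= t)%R by exact: ltW.
have sge0 : (0 <= 1 - t)%R by rewrite subr_ge0 ltW.
have HH a b : tr u n a `^ t * tr v n b `^ (1 - t) <= w (t * a + (1 - t) * b)%R.
  apply: le_trans (H a b); apply: lee_pmul; rewrite ?poweR_ge0//; apply: gt0_ler_poweR => //.
  - by rewrite in_itv/= leey andbT; case/andP: (tr0 u n a u0).
  - by rewrite in_itv/= leey andbT.
  - by rewrite in_itv/= leey andbT; case/andP: (tr0 v n b v0).
  - by rewrite in_itv/= leey andbT.
move=> /(_ HH); apply: le_trans.
rewrite EFinM -!poweR_EFin; apply: lee_pmul; rewrite ?poweR_ge0//; apply: gt0_ler_poweR => //.
- by rewrite in_itv/= leey andbT lee_fin.
- by rewrite in_itv/= leey andbT I0// => z; case/andP: (tr0 u n z u0).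
- by apply/ltW/h1; exact: leq_maxl.
- by rewrite in_itv/= leey andbT lee_fin.
- by rewrite in_itv/= leey andbT I0// => z; case/andP: (tr0 v n z v0).
- by apply/ltW/h2; exact: leq_maxr.
Unshelve. all: by end_near. Qed.

End prekopa_leindler1.

(** * Stability under products and pushforwards *)

Section prekopa_leindler_closure.
Context {R : realType}.
Variable t : R.
Hypothesis t01 : 0 < t < 1.
Local Open Scope ereal_scope.

(** For fixed first coordinates, the inequality for [m2] says precisely that the partial integrals
    satisfy the hypothesis of the inequality for [m1]. *)
Lemma prekopa_leindler_prod {d1 d2} {T1 : measurableType d1} {T2 : measurableType d2}
    (m1 : {sigma_finite_measure set T1 -> \bar R})
    (m2 : {sigma_finite_measure set T2 -> \bar R}) op1 op2 :
  prekopa_leindler t m1 op1 -> prekopa_leindler t m2 op2 ->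
  prekopa_leindler t (m1 \x m2)%E (fun x y => (op1 x.1 y.1, op2 x.2 y.2)).
Proof.
move=> PL1 PL2 u v w mu mv mw u0 v0 w0 H.
rewrite !fubini_tonelli1//.
apply: PL1 => [||||||x1 y1].
- exact: measurable_fun_fubini_tonelli_F.
- exact: measurable_fun_fubini_tonelli_F.
- exact: measurable_fun_fubini_tonelli_F.
- by move=> x; exact: integral_ge0.
- by move=> x; exact: integral_ge0.
- by move=> x; exact: integral_ge0.
- apply: PL2 => //; do ?[exact: measurableT_comp].
Qed.

Lemma prekopa_leindler_pushforward {d1 d2} {T1 : measurableType d1} {T2 : measurableType d2}
    (m1 : {measure set T1 -> \bar R}) (m2 : {measure set T2 -> \bar R})
    (phi : T1 -> T2) op1 op2 :
  measurable_fun setT phi -> (forall A, measurable A -> m2 A = m1 (phi @^-1` A)) ->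
  (forall x y, phi (op1 x y) = op2 (phi x) (phi y)) ->
  prekopa_leindler t m1 op1 -> prekopa_leindler t m2 op2.
Proof.
move=> mphi m2E phiop PL1 u v w mu mv mw u0 v0 w0 H.
have E f : measurable_fun setT f -> (forall x, 0 <= f x) ->
    \int[m2]_x f x = \int[m1]_x f (phi x).
  move=> mf f0.
  transitivity (\int[pushforward m1 phi]_x f x).
    by apply: eq_measure_integral => A mA _; rewrite m2E.
  by rewrite ge0_integral_pushforward.
rewrite !E//; apply: PL1 => //; do ?[exact: measurableT_comp].
by move=> x y; rewrite phiop.
Qed.

End prekopa_leindler_closure.

(** * Lebesgue measure on [d.-tuple R] *)

Section lebesgue_tuple.
Context {R : realType}.

Definition tconv {d} (t : R) (x y : d.-tuple R) : d.-tuple R :=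
  [tuple t * tnth x i + (1 - t) * tnth y i | i < d].

Lemma measurable_box {d} (a b : d.-tuple R) : measurable (box a b).
Proof.
have -> : box a b = \bigcap_(i : 'I_d) ((@tnth d R)^~ i @^-1` `[tnth a i, tnth b i]).
  apply/seteqP; split => x /= h i; first by move=> _; rewrite /= in_itv/=; exact: h.
  by have := h i I; rewrite /= in_itv.
apply: fin_bigcap_measurable => // i _.
by rewrite -[X in measurable X]setTI; exact: (measurable_tnth _ measurableT).
Qed.

Definition boxes d : set (set (d.-tuple R)) := [set A | exists a b, A = box a b].

Lemma boxes_setI d : setI_closed (boxes d).
Proof.
move=> _ _ [a [b ->]] [a' [b' ->]].
exists [tuple Num.max (tnth a i) (tnth a' i) | i < d].
exists [tuple Num.min (tnth b i) (tnth b' i) | i < d].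
apply/seteqP; split => x /=.
  move=> [h1 h2] i; rewrite !tnth_mktuple ge_max le_min.
  by have /andP[-> ->] := h1 i; have /andP[-> ->] := h2 i.
move=> h; split=> i; have := h i; rewrite !tnth_mktuple ge_max le_min;
  by move=> /andP[/andP[? ?] /andP[? ?]]; apply/andP.
Qed.

(** Exhausting a half-space by boxes shows that boxes generate the sigma-algebra of the coordinate
    maps. *)
Lemma box_cover d (i : 'I_d) (r : R) : [set x : d.-tuple R | r <= tnth x i] =
  \bigcup_n box [tuple if j == i then r else - n%:R | j < d] [tuple n%:R | j < d].
Proof.
apply/seteqP; split => x /=.
  move=> rx; pose M := \big[Num.max/0]_(j < d) `|tnth x j|.
  have [n Mn] : exists n : nat, M <= n%:R.
    by exists (Num.truncn M).+1; exact/ltW/truncnS_gt.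
  exists n => // j; rewrite !tnth_mktuple.
  have : `|tnth x j| <= n%:R by apply: le_trans Mn; exact: (le_bigmax _ (fun j => `|tnth x j|)).
  rewrite ler_norml => /andP[h1 h2]; rewrite h2 andbT.
  by case: eqP => [->|].
by move=> [n _ /(_ i)]; rewrite !tnth_mktuple eqxx => /andP[].
Qed.

Lemma measurable_boxes d : @measurable _ (d.-tuple R) = <<s boxes d >>.
Proof.
apply/seteqP; split; last first.
  apply: smallest_sub; first exact: sigma_algebra_measurable.
  by move=> _ [a [b ->]]; exact: measurable_box.
pose T := g_sigma_algebraType (boxes d).
have : measurable_fun setT (id : T -> d.-tuple R).
  apply/measurable_fun_tnthP => i.
  apply: (measurability _ (RGenCInfty.measurableE R)).
  move=> _ [_ [r ->] <-]; rewrite setTI.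
  have -> : ((@tnth d R)^~ i \o id) @^-1` `[r, +oo[ = [set x | r <= tnth x i].
    by apply/seteqP; split => x /=; rewrite in_itv/= andbT.
  rewrite box_cover; apply: bigcupT_measurable => n.
  by apply: sub_sigma_algebra; eexists; eexists.
by move=> mid A mA; have := mid measurableT A mA; rewrite setTI.
Qed.

Definition cube d (n : nat) : set (d.-tuple R) :=
  box [tuple - n%:R | j < d] [tuple n%:R | j < d].

Lemma bigcup_cube d : \bigcup_n cube d n = setT.
Proof.
apply/seteqP; split => // x _.
pose M := \big[Num.max/0]_(j < d) `|tnth x j|.
have [n Mn] : exists n : nat, M <= n%:R.
  by exists (Num.truncn M).+1; exact/ltW/truncnS_gt.
exists n => // j; rewrite !tnth_mktuple -ler_norml.
by apply: le_trans Mn; exact: (le_bigmax _ (fun j => `|tnth x j|)).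
Qed.

Lemma is_lebesgue_cube_fin d (lam : set (d.-tuple R) -> \bar R) n :
  is_lebesgue lam -> (lam (cube d n) < +oo)%E.
Proof.
move=> h; rewrite h ?ltry// => i; rewrite !tnth_mktuple.
by rewrite (@le_trans _ _ 0)// oppr_le0.
Qed.

(** Boxes are stable under intersection, generate the sigma-algebra and exhaust the space. A box
    with some reversed bound is empty, hence null for both measures. *)
Lemma is_lebesgue_unique {d} (m1 m2 : {measure set (d.-tuple R) -> \bar R}) :
  is_lebesgue m1 -> is_lebesgue m2 -> forall A, measurable A -> m1 A = m2 A.
Proof.
move=> h1 h2 A mA.
apply: (measure_unique (boxes d) (cube d)) => //.
- exact: measurable_boxes.
- exact: boxes_setI.
- by move=> n; eexists; eexists.
- exact: bigcup_cube.
- move=> _ [a [b ->]].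
  have [ab|] := pselect (forall i, tnth a i <= tnth b i); first by rewrite h1// h2.
  move=> /existsNP[i /negP]; rewrite -ltNge => ba.
  rewrite (_ : box a b = set0) ?measure0//.
  apply/seteqP; split => // x /(_ i) /andP[ax xb].
  by have := lt_le_trans ba (le_trans ax xb); rewrite ltxx.
- by move=> n; exact: is_lebesgue_cube_fin.
Qed.

(** Induction on [d], prepending a coordinate by pushforward of a product measure; both properties
    are built together because the inequality is inherited from the product. The base case is the
    Dirac mass at the empty tuple, matching the empty product [1]. *)
Lemma exists_lebesgue_prekopa_leindler (t : R) d : 0 < t < 1 ->
  exists2 lam : {sigma_finite_measure set (d.-tuple R) -> \bar R},
    is_lebesgue lam & prekopa_leindler t lam (tconv t).
Proof.
move=> t01; elim: d => [|d [lam hlam PLlam]].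
  exists (\d_ [tuple] : {sigma_finite_measure set (0.-tuple R) -> \bar R}).
    move=> a b _; rewrite big_ord0 /= diracE mem_set// => -[].
    by case.
  move=> u v w mu mv mw u0 v0 w0 H.
  by rewrite !integral_dirac//= !diracT !mul1e (_ : w _ = w (tconv t [tuple] [tuple])) ?H// (tuple0 (tconv _ _ _)).
pose phi (z : measurableTypeR R * d.-tuple R) : d.+1.-tuple R := [tuple of z.1 :: z.2].
have mphi : measurable_fun setT phi by exact: measurable_cons.
pose m' : {measure set (d.+1.-tuple R) -> \bar R} :=
  pushforward (lebesgue_measure \x lam)%E phi.
pose m := m' mphi.
have hm : is_lebesgue m.
  have tb (a : d.+1.-tuple R) i : tnth [tuple of behead a] i = tnth a (lift ord0 i).
    by rewrite [in RHS](tuple_eta a) tnthS.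
  have phi0 z : tnth (phi z) ord0 = z.1 by rewrite /phi tnth0.
  have phiS z i : tnth (phi z) (lift ord0 i) = tnth z.2 i by rewrite /phi tnthS.
  move=> a b ab; rewrite /m/= /pushforward/=.
  have -> : phi @^-1` (box a b) = `[tnth a ord0, tnth b ord0] `*`
      box [tuple of behead a] [tuple of behead b].
    apply/seteqP; split => -[x y] /=.
      move=> h; split; first by rewrite in_itv/=; have := h ord0; rewrite phi0.
      by move=> i; have := h (lift ord0 i); rewrite phiS !tb.
    move=> [h1 h2] i; case: (unliftP ord0 i) => [j ->|->].
      by rewrite phiS -!tb; exact: h2.
    by rewrite phi0; move: h1; rewrite in_itv.
  rewrite product_measure1E//; last exact: measurable_box.
  rewrite hlam; last by move=> i; rewrite !tb.
  rewrite /= lebesgue_measure_itv/= lte_fin big_ord_recl EFinM; congr (_ * _)%E.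
    by case: ltP (ab ord0) => // h1 h2; rewrite (@le_anti _ _ (tnth a ord0) (tnth b ord0)) ?h2// subrr.
  by congr (_%:E); apply: eq_bigr => i _; rewrite !tb.
have sf : sigma_finite setT m.
  exists (cube d.+1); first by rewrite bigcup_cube.
  by move=> n; split; [exact: measurable_box|exact: is_lebesgue_cube_fin].
pose ms : {sigma_finite_measure set (d.+1.-tuple R) -> \bar R} :=
  HB.pack (m : set _ -> \bar R) (Measure.class m) (Measure_isSigmaFinite.Build _ _ _ m sf).
exists ms => //.
apply: (prekopa_leindler_pushforward t _ ms phi _ _ mphi _ _
  (prekopa_leindler_prod t _ _ _ _ (prekopa_leindler_lebesgue t t01) PLlam)) => //.
move=> [x1 x2] [y1 y2]; apply: eq_from_tnth => i.
rewrite /phi /tconv tnth_mktuple; case: (unliftP ord0 i) => [j ->|->].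
  by rewrite !tnthS tnth_mktuple.
by rewrite !tnth0.
Qed.

Lemma is_lebesgue_prekopa_leindler (t : R) d (lam : {measure set (d.-tuple R) -> \bar R}) :
  0 < t < 1 -> is_lebesgue lam -> prekopa_leindler t lam (tconv t).
Proof.
move=> t01 hlam; have [lam' hlam'] := exists_lebesgue_prekopa_leindler t d t01.
apply: (prekopa_leindler_pushforward t _ _ id) => //.
by move=> A mA; exact: is_lebesgue_unique.
Qed.

End lebesgue_tuple.

(** * Densities and relative entropy *)

Section density.
Context {d} {T : measurableType d} {R : realType}.
Local Open Scope ereal_scope.

Lemma density_dominates (nu mu : {measure set T -> \bar R}) (p : T -> \bar R) :
  measurable_fun setT p ->
  (forall A, measurable A -> nu A = \int[mu]_(x in A) p x) -> nu `<< mu.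
Proof.
move=> mp nuE; apply/null_content_dominatesP => A mA muA; rewrite nuE//.
by apply: null_set_integral => //; exact: measurable_funTS.
Qed.

(** Once [nu] is repackaged as a finite measure, [p] agrees almost everywhere with its Radon-Nikodym
    derivative, for which the change of variables holds. *)
Lemma ge0_integral_density (nu : {measure set T -> \bar R})
    (mu : {sigma_finite_measure set T -> \bar R}) (p : T -> R) (f : T -> \bar R) :
  nu setT < +oo -> measurable_fun setT p -> (forall x, 0 <= p x)%R ->
  (forall A, measurable A -> nu A = \int[mu]_(x in A) (p x)%:E) ->
  measurable_fun setT f -> (forall x, 0 <= f x) ->
  \int[nu]_x f x = \int[mu]_x (f x * (p x)%:E).
Proof.
move=> nufin mp p0 nuE mf f0.
have fin : fin_num_fun nu.
  apply: lty_fin_num_fun; exact: nufin.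
have sfin : sigma_finite setT nu.
  by apply: fin_num_fun_sigma_finite => //; rewrite measure0.
pose H1 := isFinite.Build _ _ _ _ fin.
pose H2 := isSFinite.Build _ _ _ _ (sfinite_measure_sigma_finite sfin).
pose H3 := isSigmaFinite.Build _ _ _ _ sfin.
pose nu' := HB.pack_for (FiniteMeasure.type T R) (Measure.sort nu) H1 H2 H3.
have mpE : measurable_fun setT (EFin \o p) by exact/measurable_EFinP.
have dom : nu' `<< mu by apply: (density_dominates _ mu (EFin \o p) mpE); exact: nuE.
rewrite -[LHS]/(\int[nu']_x f x).
rewrite -(Radon_Nikodym_SigmaFinite.change_of_variables dom)//.
have mRN := measurable_int _ (Radon_Nikodym_SigmaFinite.f_integrable dom).
apply: ge0_ae_eq_integral => //.
- exact: emeasurable_funM.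
- exact: emeasurable_funM.
- by move=> x _; rewrite mule_ge0// Radon_Nikodym_SigmaFinite.f_ge0.
- by move=> x _; rewrite mule_ge0// lee_fin.
apply: ae_eqe_mul2l; apply: integral_ae_eq => //.
  exact: Radon_Nikodym_SigmaFinite.f_integrable.
by move=> E _ mE; rewrite -nuE// -Radon_Nikodym_SigmaFinite.f_integral.
Qed.

Lemma dominates_density (mu nu : probability T R) : mu `<< nu ->
  exists h : T -> R, [/\ measurable_fun setT h, (forall x, 0 <= h x)%R &
    forall A, measurable A -> mu A = \int[nu]_(x in A) (h x)%:E].
Proof.
move=> dom; have [h [h0 hfin hint hE]] := radon_nikodym_sigma_finite dom.
exists (fine \o h); split => [|x|A mA].
- by apply: measurableT_comp => //; exact: measurable_int hint.
- by rewrite fine_ge0.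
- by rewrite hE//; apply: eq_integral => x _; rewrite /= fineK.
Qed.

(** Trades the logarithm integrated against [mu] for [h ln h] integrated against [nu], with any
    version [h] of the density. Positive and negative parts are separated because the integral may
    be infinite. *)
Lemma KL_density (mu nu : probability T R) (h : T -> R) :
  measurable_fun setT h -> (forall x, 0 <= h x)%R ->
  (forall A, measurable A -> mu A = \int[nu]_(x in A) (h x)%:E) ->
  KL mu nu = \int[nu]_x (h x * ln (h x))%:E.
Proof.
move=> mh h0 muE.
have mhE : measurable_fun setT (EFin \o h) by exact/measurable_EFinP.
have dom : mu `<< nu by exact: (density_dominates _ _ (EFin \o h)).
rewrite /KL; case: pselect => // dom'.
set D := Radon_Nikodym _ _.
have Dint : nu.-integrable setT D by exact: Radon_Nikodym_integrable.
have mD := measurable_int _ Dint.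
have DE : ae_eq nu setT D (EFin \o h).
  apply: integral_ae_eq => // A _ mA.
  by rewrite -muE// -Radon_Nikodym_integral.
have mln : measurable_fun setT (fun x => (ln (h x))%:E).
  by apply/measurable_EFinP; exact: measurableT_comp.
rewrite (ae_eq_integral (fun x => (ln (h x))%:E))//; last 2 first.
- by apply/measurable_EFinP; do 2 apply: measurableT_comp => //.
- apply: (null_dominates_ae_eq measurableT dom).
  by move: DE; apply: filterS => x /= H /H ->.
rewrite /=; have mufin : mu setT < +oo by rewrite probability_setT ltry.
rewrite integralE [in RHS]integralE; congr (_ - _).
- rewrite (ge0_integral_density mu nu h)//; last exact: measurable_funepos.
  apply: eq_integral => x _; rewrite !funeposE -!EFin_max -EFinM.
  by rewrite maxr_pMl// mul0r mulrC.
- rewrite (ge0_integral_density mu nu h)//; last exact: measurable_funeneg.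
  apply: eq_integral => x _; rewrite !funenegE -!EFinN -!EFin_max -EFinM.
  by rewrite maxr_pMl// mul0r mulNr mulrC.
Qed.

End density.

(** * Measurability of strongly convex functions *)

Section strongly_convex_measurable.
Context {R : realType} {d : nat}.
Implicit Types (x y : d.-tuple R) (f : d.-tuple R -> R).

(** Rounding down to the lattice of mesh [1 / (n + 1)] takes countably many values, so every
    function composed with it is measurable; a strongly convex [f] is then measurable as a pointwise
    limit. *)
Definition grid (n : nat) x : d.-tuple R :=
  [tuple (Num.floor (n.+1%:R * tnth x i))%:~R / n.+1%:R | i < d].

Lemma measurable_grid_comp n f : measurable_fun setT (f \o grid n).
Proof.
pose J x : d.-tuple int := [tuple Num.floor (n.+1%:R * tnth x i) | i < d].
pose G (z : d.-tuple int) : d.-tuple R := [tuple (tnth z i)%:~R / n.+1%:R | i < d].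
have gridE x : grid n x = G (J x).
  by apply: eq_from_tnth => i; rewrite !tnth_mktuple.
have mJ z : measurable (J @^-1` [set z]).
  have -> : J @^-1` [set z] = \bigcap_(i : 'I_d)
      [set x | (tnth z i)%:~R <= n.+1%:R * tnth x i < (tnth z i + 1)%:~R].
    apply/seteqP; split => x /=.
      by move=> <- i _ /=; rewrite tnth_mktuple floor_itv.
    move=> h; apply: eq_from_tnth => i; rewrite tnth_mktuple.
    by apply: floor_def; exact: h.
  apply: fin_bigcap_measurable => // i _.
  rewrite (_ : [set _ | _] = (fun x => n.+1%:R * tnth x i) @^-1` `[(tnth z i)%:~R, (tnth z i + 1)%:~R[).
    rewrite -[X in measurable X]setTI.
    apply: (_ : measurable_fun setT (fun x => n.+1%:R * tnth x i)) => //.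
    by apply: measurable_funM => //; exact: measurable_tnth.
  by apply/seteqP; split => x /=; rewrite in_itv.
move=> _ Y mY; rewrite setTI.
have -> : (f \o grid n) @^-1` Y = \bigcup_(z in [set z | Y (f (G z))]) (J @^-1` [set z]).
  apply/seteqP; split => x /=; first by rewrite gridE => h; exists (J x).
  by move=> [z /= h Jz]; rewrite gridE Jz.
rewrite bigcup_mkcond; apply: countable_bigcupT_measurable => // z.
by case: ifP => // _; exact: mJ.
Qed.

Lemma strongly_convex_subgradient alpha f : 0 < alpha -> strongly_convex alpha f ->
  forall y, exists s : d.-tuple R, forall x, dotdiff s x y <= f x - f y.
Proof.
move=> a0 hf y; have [s hs] := hf y; exists s => x; apply: le_trans (hs x).
rewrite lerDl; apply: mulr_ge0; first by rewrite divr_ge0 ?ltW.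
by apply: sumr_ge0 => i _; rewrite sqr_ge0.
Qed.

Definition decr x (i : 'I_d) : d.-tuple R :=
  [tuple tnth x j - (j == i)%:R | j < d].

(** The subgradient at [x] gives the lower bound. For the upper bound, once [d <= n.+1] the point
    [grid n x] is a convex combination of [x] and the points [decr x i], which do not depend on [n],
    and Jensen's inequality applies. *)
Lemma grid_cvg alpha f x : 0 < alpha -> strongly_convex alpha f ->
  f (grid n x) @[n --> \oo] --> f x.
Proof.
move=> a0 /(strongly_convex_subgradient _ _ a0) hf.
have [s hs] := hf x.
pose r n i := tnth x i - tnth (grid n x) i.
have r0 n i : 0 <= r n i <= n.+1%:R^-1.
  have n0 : 0 < n.+1%:R :> R by rewrite ltr0n.
  rewrite /r tnth_mktuple; have /andP[h1 h2] := floor_itv (n.+1%:R * tnth x i).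
  rewrite subr_ge0 ler_pdivrMr// (mulrC (tnth x i)) h1/=.
  rewrite lerBlDr -[X in _ <= X + _]mul1r -mulrDl ler_pdivlMr// mulrC ltW//.
  by move: h2; rewrite intrD addrC.
pose C := \sum_(i < d) `|tnth s i| + \sum_(i < d) `|f (decr x i) - f x|.
have cC : C / n.+1%:R @[n --> \oo] --> (0 : R).
  rewrite -[X in _ --> X](mulr0 C); apply: cvgM; first exact: cvg_cst.
  exact: cvg_harmonic.
have c1 : f x - C / n.+1%:R @[n --> \oo] --> f x.
  by rewrite -[X in _ --> X](subr0 (f x)); apply: cvgB => //; exact: cvg_cst.
have c2 : f x + C / n.+1%:R @[n --> \oo] --> f x.
  by rewrite -[X in _ --> X](addr0 (f x)); apply: cvgD => //; exact: cvg_cst.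
apply: (squeeze_cvgr _ c1 c2).
near=> n.
have n0 : 0 < n.+1%:R :> R by rewrite ltr0n.
have dn : d%:R / n.+1%:R <= 1 :> R.
  rewrite ler_pdivrMr// mul1r ler_nat.
  by near: n; exists d => // m /= dm; exact: leqW.
have sr : \sum_(i < d) r n i <= 1.
  apply: le_trans dn; rewrite mulrC mulr_natr -[X in _ *+ X]card_ord -sumr_const.
  by apply: ler_sum => i _; case/andP: (r0 n i).
have srC F (D : R) : \sum_(i < d) `|F i| <= D -> `|\sum_(i < d) F i * r n i| <= D / n.+1%:R.
  move=> FD; apply: le_trans (ler_norm_sum _ _ _) _.
  apply: le_trans (_ : (\sum_(i < d) `|F i|) / n.+1%:R <= _); last first.
    by rewrite ler_pM2r// invr_gt0.
  rewrite mulr_suml; apply: ler_sum => i _; rewrite normrM ler_wpM2l//.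
  by case/andP: (r0 n i) => h1 h2; rewrite ger0_norm.
have C1 : \sum_(i < d) `|tnth s i| <= C by rewrite lerDl sumr_ge0.
have C2 : \sum_(i < d) `|f (decr x i) - f x| <= C by rewrite lerDr sumr_ge0.
apply/andP; split.
  have := hs (grid n x).
  have -> : dotdiff s (grid n x) x = - \sum_(i < d) tnth s i * r n i.
    by rewrite /dotdiff -sumrN; apply: eq_bigr => i _; rewrite -mulrN opprB.
  have h1 : \sum_(i < d) tnth s i * r n i <= C / n.+1%:R.
    by have := srC _ _ C1; rewrite ler_norml => /andP[].
  by move: h1; move: (\sum_(i < d) _) (C / _) => S c h1 h2; lra.
have [s' hs'] := hf (grid n x).
(* [grid n x] has weight [q] on [x] and weight [r n i] on [decr x i]. Averaging the subgradient
   inequalities at [grid n x] with these weights cancels the linear terms. *)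
pose q := 1 - \sum_(i < d) r n i.
have q0 : 0 <= q by rewrite subr_ge0.
have : \sum_(i < d) r n i * dotdiff s' (decr x i) (grid n x) + q * dotdiff s' x (grid n x)
    <= \sum_(i < d) r n i * (f (decr x i) - f (grid n x)) + q * (f x - f (grid n x)).
  apply: lerD; last by rewrite ler_wpM2l.
  by apply: ler_sum => i _; rewrite ler_wpM2l//; case/andP: (r0 n i).
have dE i : dotdiff s' (decr x i) (grid n x) = dotdiff s' x (grid n x) - tnth s' i.
  rewrite /dotdiff (bigD1 i)//= [in RHS](bigD1 i)//= tnth_mktuple eqxx.
  rewrite (eq_bigr (fun j => tnth s' j * (tnth x j - tnth (grid n x) j))); last first.
    by move=> j ji; rewrite tnth_mktuple (negbTE ji) subr0.
  by rewrite (_ : true%:R = 1 :> R)//; ring.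
have -> : \sum_(i < d) r n i * dotdiff s' (decr x i) (grid n x) + q * dotdiff s' x (grid n x) = 0.
  under eq_bigr do rewrite dE mulrBr.
  rewrite sumrB -mulr_suml -addrAC -mulrDl /q subrKC mul1r.
  by apply/eqP; rewrite subr_eq0; apply/eqP; apply: eq_bigr => i _; rewrite mulrC.
have -> : \sum_(i < d) r n i * (f (decr x i) - f (grid n x)) + q * (f x - f (grid n x)) =
    \sum_(i < d) (f (decr x i) - f x) * r n i + (f x - f (grid n x)).
  rewrite (eq_bigr (fun i => (f (decr x i) - f x) * r n i + r n i * (f x - f (grid n x)))); last first.
    by move=> i _; ring.
  by rewrite big_split/= -mulr_suml -addrA -mulrDl /q subrKC mul1r.
have h1 : \sum_(i < d) (f (decr x i) - f x) * r n i <= C / n.+1%:R.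
  by have := srC _ _ C2; rewrite ler_norml => /andP[].
by move: h1; move: (\sum_(i < d) _) (C / _) => S c h1 h2; lra.
Unshelve. all: by end_near. Qed.

Lemma strongly_convex_measurable alpha f : 0 < alpha -> strongly_convex alpha f ->
  measurable_fun setT f.
Proof.
move=> a0 hf; apply: (@measurable_fun_cvg _ _ _ _ (fun n => f \o grid n)).
  by move=> n; exact: measurable_grid_comp.
by move=> x _; exact: (grid_cvg alpha).
Qed.

End strongly_convex_measurable.

(** * Elementary inequalities *)

Section tuple_algebra.
Context {R : realType} {d : nat}.
Implicit Types (x y z delta : d.-tuple R) (s t : R).

Definition tadd y delta : d.-tuple R := [tuple tnth y i + tnth delta i | i < d].
Definition tsub x y : d.-tuple R := [tuple tnth x i - tnth y i | i < d].
Definition tscale s delta : d.-tuple R := [tuple s * tnth delta i | i < d].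
Definition sqnorm delta : R := \sum_(i < d) tnth delta i ^+ 2.
(** The inner product of [x - y] with [delta]: the first-order change of [sqdist x y] as [y] moves
    by [delta], up to the factor [- 2]. Divided by [eta], it is the exponent of the tilt from [K y]
    to [K (tadd y delta)]. *)
Definition lin y delta x : R := \sum_(i < d) (tnth x i - tnth y i) * tnth delta i.

Lemma sqdistC x y : sqdist x y = sqdist y x.
Proof. by apply: eq_bigr => i _; rewrite -sqrrN opprB. Qed.

Lemma sqnorm_ge0 delta : 0 <= sqnorm delta.
Proof. by apply: sumr_ge0 => i _; rewrite sqr_ge0. Qed.

Lemma sqnorm_tsub x y : sqnorm (tsub x y) = sqdist x y.
Proof. by apply: eq_bigr => i _; rewrite tnth_mktuple. Qed.

Lemma sqnorm_tscale s delta : sqnorm (tscale s delta) = s ^+ 2 * sqnorm delta.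
Proof. by rewrite /sqnorm mulr_sumr; apply: eq_bigr => i _; rewrite tnth_mktuple exprMn. Qed.

Lemma lin_tscale y s delta x : lin y (tscale s delta) x = s * lin y delta x.
Proof. by rewrite /lin mulr_sumr; apply: eq_bigr => i _; rewrite tnth_mktuple; ring. Qed.

Lemma tscale1 delta : tscale 1 delta = delta.
Proof. by apply: eq_from_tnth => i; rewrite tnth_mktuple mul1r. Qed.

Lemma tscaleA s t delta : tscale s (tscale t delta) = tscale (s * t) delta.
Proof. by apply: eq_from_tnth => i; rewrite !tnth_mktuple mulrA. Qed.

Lemma sqnorm_eq0 delta s : sqnorm delta = 0 -> delta = tscale s delta.
Proof.
move=> /eqP; rewrite psumr_eq0 => [/allP h|i _]; last exact: sqr_ge0.
apply: eq_from_tnth => i; rewrite tnth_mktuple.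
by have := h i (mem_index_enum i); rewrite sqrf_eq0 => /eqP ->; rewrite mulr0.
Qed.

Lemma sqdist_tadd x y delta :
  sqdist x (tadd y delta) = sqdist x y - 2 * lin y delta x + sqnorm delta.
Proof.
rewrite /sqdist /lin /sqnorm mulr_sumr -sumrB -big_split/=.
by apply: eq_bigr => i _; rewrite tnth_mktuple; ring.
Qed.

Lemma tconv_tadd t y delta : tconv (1 - t) y (tadd y delta) = tadd y (tscale t delta).
Proof. by apply: eq_from_tnth => i; rewrite !tnth_mktuple; ring. Qed.

Lemma tconvK t x y : tadd (tconv t x y) (tscale (1 - t) (tsub x y)) = x.
Proof. by apply: eq_from_tnth => i; rewrite !tnth_mktuple; ring. Qed.

(** The convexity defect of the squared distance, jointly in both arguments. It vanishes when
    [x - x'] equals [y - y']; strong convexity of [f] makes up for this degeneracy. *)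
Lemma sqdist_tconv t x x' y y' :
  sqdist (tconv t x x') (tconv t y y') = t * sqdist x y + (1 - t) * sqdist x' y' -
    t * (1 - t) * sqdist (tsub x x') (tsub y y').
Proof.
rewrite /sqdist !mulr_sumr -big_split/= -sumrB.
by apply: eq_bigr => i _; rewrite !tnth_mktuple; ring.
Qed.

(* The infimum of [a |u|^2 + |u - v|^2 / e] over [u] is [a / (1 + e a) |v|^2]. *)
Lemma sqnorm_infconv (a e : R) u v : 0 < a -> 0 < e ->
  a / (1 + e * a) * sqnorm v <= a * sqnorm u + sqdist u v / e.
Proof.
move=> a0 e0; have ea : 0 < 1 + e * a by rewrite addr_gt0// mulr_gt0.
rewrite /sqnorm /sqdist mulr_suml !mulr_sumr -big_split/=; apply: ler_sum => i _.
set p := tnth u i; set q := tnth v i; rewrite -subr_ge0.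
rewrite (_ : _ - _ = (p * (1 + e * a) - q) ^+ 2 / (e * (1 + e * a))).
  by rewrite divr_ge0 ?sqr_ge0// mulr_ge0// ltW.
by field; rewrite !lt0r_neq0.
Qed.

(** Averaging the two subgradient inequalities at the intermediate point cancels the linear terms,
    and [t (1 - t)^2 + (1 - t) t^2 = t (1 - t)]. *)
Lemma strongly_convex_tconv alpha (f : d.-tuple R -> R) t x y : 0 <= t <= 1 ->
  strongly_convex alpha f ->
  f (tconv t x y) <= t * f x + (1 - t) * f y - alpha / 2 * (t * (1 - t)) * sqdist x y.
Proof.
move=> /andP[t0 t1] hf; have [s hs] := hf (tconv t x y).
have h1 := ler_wpM2l t0 (hs x).
have s0 : 0 <= 1 - t by rewrite subr_ge0.
have h2 := ler_wpM2l s0 (hs y).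
have e0 : t * dotdiff s x (tconv t x y) + (1 - t) * dotdiff s y (tconv t x y) = 0.
  rewrite /dotdiff !mulr_sumr -big_split/= big1// => i _.
  by rewrite tnth_mktuple; ring.
have e1 : sqdist x (tconv t x y) = (1 - t) ^+ 2 * sqdist x y.
  by rewrite /sqdist mulr_sumr; apply: eq_bigr => i _; rewrite tnth_mktuple; ring.
have e2 : sqdist y (tconv t x y) = t ^+ 2 * sqdist x y.
  by rewrite /sqdist mulr_sumr; apply: eq_bigr => i _; rewrite tnth_mktuple; ring.
rewrite e1 in h1; rewrite e2 in h2.
have e3 : alpha / 2 * (t * (1 - t)) * sqdist x y =
   t * (alpha / 2 * ((1 - t) ^+ 2 * sqdist x y)) +
   (1 - t) * (alpha / 2 * (t ^+ 2 * sqdist x y)) by ring.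
rewrite e3.
move: h1 h2 e0; rewrite !mulrDr.
move: (t * dotdiff _ _ _) ((1 - t) * dotdiff _ _ _) (t * (_ * _)) ((1 - t) * (_ * _)) => D1 D2 A B.
by rewrite !mulrN; move: (f (tconv t x y)) (f x) (f y) => z p q h1 h2 h3; lra.
Qed.

Lemma measurable_sqdist :
  measurable_fun setT (fun z : d.-tuple R * d.-tuple R => sqdist z.1 z.2).
Proof.
apply: measurable_sum => i; apply: measurable_funX; apply: measurable_funB.
  by apply: (measurableT_comp (measurable_tnth i)); exact: measurable_fst.
by apply: (measurableT_comp (measurable_tnth i)); exact: measurable_snd.
Qed.

Lemma measurable_lin y delta : measurable_fun setT (lin y delta).
Proof.
apply: measurable_sum => i; apply: measurable_funM => //; apply: measurable_funB => //.
exact: measurable_tnth.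
Qed.

End tuple_algebra.

(** * Exponential bounds *)

Section expR_bounds.
Context {R : realType}.
Implicit Types s x a b : R.

Lemma expR_sub1_le x : expR x - 1 <= x * expR x.
Proof.
have := expR_ge1Dx (- x); rewrite expRN => h.
have e0 := expR_gt0 x.
have : (1 - x) * expR x <= 1 by rewrite -ler_pdivlMr// mul1r.
lra.
Qed.

Lemma expR_quad x : expR x <= 1 + x + x ^+ 2 * expR `|x|.
Proof.
have h := expR_sub1_le x.
have [x0|x0] := leP 0 x.
  rewrite ger0_norm//.
  have : x * (expR x - 1) <= x * (x * expR x) by rewrite ler_wpM2l.
  by rewrite expr2 -mulrA; lra.
rewrite ltr0_norm//.
have h1 := expR_ge1Dx x.
have h2 : 1 <= expR (- x) by rewrite -expR0 ler_expR; lra.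
have : x * (expR x - 1) <= x ^+ 2 * 1 by nra.
have : x ^+ 2 * 1 <= x ^+ 2 * expR (- x) by rewrite ler_wpM2l ?sqr_ge0.
lra.
Qed.

Lemma sqr_le_expR x : x ^+ 2 <= 4 * expR `|x|.
Proof.
have h := expR_ge1Dx (`|x| / 2).
have n0 := normr_ge0 x.
have -> : expR `|x| = expR (`|x| / 2) ^+ 2 by rewrite expr2 -expRD; congr expR; lra.
rewrite -[x ^+ 2]real_normK ?num_real//; nra.
Qed.

(** A second-order expansion in [s] whose exponentials do not involve [s], so that the remainder
    integrates to a constant times [s ^ 2]. The square [x ^ 2] is absorbed by [4 exp |x|], whence
    the exponents [2 x] and [- 2 x]. *)
Lemma expR_scale_quad s x : 0 <= s <= 1 ->
  expR (s * x) <= 1 + s * x + 4 * s ^+ 2 * (expR (2 * x) + expR (- (2 * x))).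
Proof.
move=> /andP[s0 s1]; apply: le_trans (expR_quad _) _; rewrite lerD2l.
have n0 := normr_ge0 x.
have e1 : expR `|s * x| <= expR `|x| by rewrite ler_expR normrM ger0_norm// ler_piMl.
have e2 := sqr_le_expR x.
have e3 : expR `|x| * expR `|x| <= expR (2 * x) + expR (- (2 * x)).
  rewrite -expRD; have [x0|x0] := leP 0 x.
    rewrite ger0_norm// (_ : x + x = 2 * x); last by ring.
    by rewrite lerDl ltW// expR_gt0.
  rewrite ltr0_norm// (_ : - x + - x = - (2 * x)); last by ring.
  by rewrite lerDr ltW// expR_gt0.
have ep := expR_gt0 `|x|.
rewrite exprMn -[leLHS]mulrA (_ : 4 * s ^+ 2 * _ = s ^+ 2 * (4 * (expR (2 * x) + expR (- (2 * x))))).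
  rewrite ler_wpM2l ?sqr_ge0//.
  apply: (@le_trans _ _ (4 * expR `|x| * expR `|x|)).
    by apply: ler_pM; rewrite ?sqr_ge0// ltW// expR_gt0.
  by rewrite -mulrA ler_pM2l.
by ring.
Qed.

(** Legendre duality between [a ln a - a] and the exponential; the pointwise form of the Gibbs
    variational principle. *)
Lemma young_ln a b : 0 < a -> a * b <= a * ln a - a + expR b.
Proof.
move=> a0; have := expR_ge1Dx (b - ln a); rewrite expRB lnK ?posrE// => h.
have : a * (1 + (b - ln a)) <= expR b by rewrite mulrC -ler_pdivlMr.
lra.
Qed.

End expR_bounds.

(** * Integrable real-valued functions *)

Section rintegrable.
Context {d} {T : measurableType d} {R : realType}.
Variable mu : {measure set T -> \bar R}.
Implicit Types (f g : T -> R) (c : R).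

Definition rintegrable f := mu.-integrable setT (EFin \o f).

Lemma rintegrableD f g : rintegrable f -> rintegrable g ->
  rintegrable (fun x => f x + g x).
Proof. by move=> hf hg; exact: (integrableD measurableT hf hg). Qed.

Lemma rintegrableZ c f : rintegrable f -> rintegrable (fun x => c * f x).
Proof. by move=> hf; exact: (integrableZl measurableT c hf). Qed.

Lemma rintegrableB f g : rintegrable f -> rintegrable g ->
  rintegrable (fun x => f x - g x).
Proof. by move=> hf hg; exact: (integrableB measurableT hf hg). Qed.

Lemma le_rintegrable f g : measurable_fun setT f -> (forall x, `|f x| <= g x) ->
  rintegrable g -> rintegrable f.
Proof.
move=> mf fg; apply: le_integrable => //; first exact/measurable_EFinP.
by move=> x _; rewrite /= lee_fin (le_trans (fg x))// ler_norm.
Qed.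

Lemma rintegrable_bounded f c : (mu setT < +oo)%E -> measurable_fun setT f ->
  (forall x, `|f x| <= c) -> rintegrable f.
Proof.
move=> fin mf fc; apply/integrableP; split; first exact/measurable_EFinP.
apply: (@le_lt_trans _ _ (\int[mu]_x (cst c%:E x))%E).
  apply: ge0_le_integral => //.
  - by apply: measurableT_comp => //; exact/measurable_EFinP.
  - by move=> x _; rewrite /= lee_fin.
have c0 : 0 <= `|c| by [].
rewrite integral_cst//; apply: le_lt_trans (_ : `|c|%:E * mu setT < +oo)%E.
  by rewrite lee_wpmul2r// lee_fin ler_norm.
exact: lte_mul_pinfty.
Qed.

Lemma rintegrable_ge0 f : measurable_fun setT f -> (forall x, 0 <= f x) ->
  (\int[mu]_x (f x)%:E < +oo)%E -> rintegrable f.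
Proof.
move=> mf f0 h; apply/integrableP; split; first exact/measurable_EFinP.
by apply: le_lt_trans h; rewrite le_eqVlt; apply/orP; left; apply/eqP;
  apply: eq_integral => x _; rewrite /= ger0_norm.
Qed.

Lemma measurable_rintegrable f : rintegrable f -> measurable_fun setT f.
Proof. by move=> /measurable_int/measurable_EFinP. Qed.

Lemma EFin_Rintegral f : rintegrable f -> (\int[mu]_x f x)%:E = (\int[mu]_x (f x)%:E)%E.
Proof. by move=> hf; rewrite /Rintegral fineK//; exact: integrable_fin_num. Qed.

End rintegrable.

(** * Gibbs kernels *)

Section gibbs_kernel.
Context {R : realType} {d : nat}.
Variable lam : {sigma_finite_measure set (d.-tuple R) -> \bar R}.
Hypothesis hlam : is_lebesgue lam.
Variables (eta alpha : R) (f : d.-tuple R -> R).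
Hypotheses (eta0 : 0 < eta) (alpha0 : 0 < alpha) (hf : strongly_convex alpha f).
Implicit Types (x y delta : d.-tuple R) (s t : R).

Definition gibbs_weight y x : R := expR (- f x - sqdist x y / (2 * eta)).
Local Notation wt := gibbs_weight.

Definition partition_fun y : R := fine (\int[lam]_x (wt y x)%:E)%E.
Local Notation Z := partition_fun.

Variable K : R.-pker (d.-tuple R) ~> (d.-tuple R).
Hypothesis hK : forall y, exists c : R, 0 < c /\ forall B, measurable B ->
  K y B = (c%:E * \int[lam]_(x in B) (expR (- f x - sqdist x y / (2 * eta)))%:E)%E.

Let mf : measurable_fun setT f := strongly_convex_measurable alpha f alpha0 hf.

Lemma measurable_gibbs_weight : measurable_fun setT (fun z : _ * _ => wt z.2 z.1).
Proof.
apply: measurableT_comp => //; apply: measurable_funB; last first.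
  by apply: measurable_funM => //; exact: measurable_sqdist.
by apply: measurableT_comp => //; exact: (measurableT_comp mf).
Qed.

Lemma measurable_gibbs_weight1 y : measurable_fun setT (wt y).
Proof. exact: (measurableT_comp measurable_gibbs_weight (pair2_measurable y)). Qed.

Lemma gibbs_weight_gt0 y x : 0 < wt y x. Proof. exact: expR_gt0. Qed.

(** Finiteness and positivity of the partition function are read off the total mass [1] of [K y],
    which forces the constant to be [1 / Z y]. *)
Lemma partition_funP y : [/\ 0 < Z y, (\int[lam]_x (wt y x)%:E = (Z y)%:E)%E &
  forall B, measurable B -> K y B = (\int[lam]_(x in B) ((Z y)^-1 * wt y x)%:E)%E].
Proof.
have [c [c0 KE]] := hK y.
have := KE _ measurableT; rewrite prob_kernel => h.
have IE : (\int[lam]_x (wt y x)%:E = (c^-1)%:E)%E.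
  by rewrite -[RHS]mule1 h muleA -EFinM mulVf ?lt0r_neq0// mul1e.
have ZE : Z y = c^-1 by rewrite /partition_fun IE.
split; rewrite ?ZE ?invr_gt0// => B mB.
rewrite KE// -ge0_integralZl//.
- by apply: eq_integral => x _; rewrite invrK.
- by apply/measurable_EFinP; apply: measurable_funTS; exact: measurable_gibbs_weight1.
- by rewrite lee_fin ltW.
Qed.

Lemma partition_fun_gt0 y : 0 < Z y. Proof. by have [] := partition_funP y. Qed.

Lemma ge0_integral_gibbs y (phi : d.-tuple R -> \bar R) :
  measurable_fun setT phi -> (forall x, 0 <= phi x)%E ->
  (\int[K y]_x phi x = (Z y)^-1%:E * \int[lam]_x (phi x * (wt y x)%:E))%E.
Proof.
move=> mphi phi0; have [Z0 _ KE] := partition_funP y.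
have w0 x : 0 <= (Z y)^-1 * wt y x.
  by rewrite mulr_ge0 ?invr_ge0 ?ltW// gibbs_weight_gt0.
have mw : measurable_fun setT (fun x => (Z y)^-1 * wt y x).
  by apply: measurable_funM => //; exact: measurable_gibbs_weight1.
rewrite (ge0_integral_density _ lam (fun x => (Z y)^-1 * wt y x))//; last first.
  by rewrite prob_kernel ltry.
rewrite -ge0_integralZl//.
- by apply: eq_integral => x _; rewrite EFinM muleCA.
- apply: emeasurable_funM => //; apply/measurable_EFinP; exact: measurable_gibbs_weight1.
- by move=> x _; rewrite mule_ge0// lee_fin ltW// gibbs_weight_gt0.
- by rewrite lee_fin invr_ge0 ltW.
Qed.

(** [1 / gamma = 1 / alpha + eta]: the constant of the infimal convolution of quadratic forms with
    constants [alpha] and [1 / eta], hence the strong concavity constant of [ln Z]. *)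
Definition gamma : R := alpha / (1 + eta * alpha).
Definition sigma : R := (eta * (1 + eta * alpha))^-1.

Lemma gamma_sigma : eta^-1 - gamma = sigma.
Proof.
by rewrite /gamma /sigma; field; rewrite !lt0r_neq0// addr_gt0// mulr_gt0.
Qed.

Lemma sigma_gt0 : 0 < sigma.
Proof. by rewrite invr_gt0 mulr_gt0// addr_gt0// mulr_gt0. Qed.

(** Prekopa-Leindler for the weights at [y] and [y']. Strong convexity of [f] gains
    [alpha |x - x'|^2] and the Gaussian factor gains [|(x - x') - (y - y')|^2 / eta]; minimizing the
    sum over [x - x'] leaves [gamma |y - y'|^2]. *)
Lemma partition_fun_log_concave t y y' : 0 < t < 1 ->
  Z y `^ t * Z y' `^ (1 - t) * expR (gamma / 2 * (t * (1 - t)) * sqdist y y') <=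
  Z (tconv t y y').
Proof.
move=> t01; have /andP[t0 t1] := t01.
set e := gamma / 2 * (t * (1 - t)) * sqdist y y'; set z := tconv t y y'.
have [Zy ZyE _] := partition_funP y.
have [Zy' Zy'E _] := partition_funP y'.
have [Zz ZzE _] := partition_funP z.
have wtE y0 : measurable_fun setT (fun x => (wt y0 x)%:E).
  by apply/measurable_EFinP; exact: measurable_gibbs_weight1.
have wt0 y0 x : (0 <= (wt y0 x)%:E)%E by rewrite lee_fin ltW// gibbs_weight_gt0.
have h0 x : (0 <= (expR (- e))%:E * (wt z x)%:E)%E.
  by rewrite mule_ge0// lee_fin ltW// expR_gt0.
have h x x' : ((wt y x)%:E `^ t * (wt y' x')%:E `^ (1 - t) <=
    (expR (- e))%:E * (wt z (tconv t x x'))%:E)%E.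
  rewrite !poweR_EFin -!EFinM lee_fin -!expRM -!expRD ler_expR.
  have c1 := @strongly_convex_tconv _ _ alpha f t x x' (introT andP (conj (ltW t0) (ltW t1))) hf.
  have c2 := sqdist_tconv t x x' y y'.
  have c3 := @sqnorm_infconv _ _ alpha eta (tsub x x') (tsub y y') alpha0 eta0.
  rewrite !sqnorm_tsub -/gamma in c3.
  have ts : 0 <= t * (1 - t) / 2 by rewrite divr_ge0// mulr_ge0 ?subr_ge0 ?ltW.
  have := ler_wpM2l ts c3.
  rewrite -/z c2 /e.
  have -> : (2 * eta)^-1 = eta^-1 / 2 by rewrite invfM mulrC.
  move: c1; move: (sqdist x y) (sqdist x' y') (sqdist (tsub _ _) _) (sqdist x x') (sqdist y y')
    (f x) (f x') (f (tconv t x x')) (eta^-1) => A B C D E fx fx' fz ie c1 c4.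
  by clear -c1 c4; lra.
have := is_lebesgue_prekopa_leindler t d lam t01 hlam (fun x => (wt y x)%:E)
  (fun x => (wt y' x)%:E) (fun x => ((expR (- e))%:E * (wt z x)%:E)%E)
  (wtE y) (wtE y') (measurable_funeM _ (wtE z)) (wt0 y) (wt0 y') h0 h.
have e0 : (0 <= (expR (- e))%:E)%E by rewrite lee_fin ltW// expR_gt0.
rewrite (ge0_integralZl lam measurableT (wtE z) (fun x _ => wt0 z x) e0).
move: ZyE Zy'E ZzE => -> -> ->; move: (Z y) (Z y') (Z z) => a b c.
rewrite !poweR_EFin -!EFinM lee_fin expRN mulrC => h1.
by rewrite -ler_pdivlMr ?expR_gt0// [leRHS]mulrC.
Qed.

Lemma gibbs_weight_tadd y delta x : wt (tadd y delta) x =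
  wt y x * expR (lin y delta x / eta) / expR (sqnorm delta / (2 * eta)).
Proof.
rewrite /gibbs_weight -expRN -!expRD sqdist_tadd; congr expR.
by field; exact: lt0r_neq0.
Qed.

Lemma measurable_exp_lin y delta : measurable_fun setT (fun x => expR (lin y delta x / eta)).
Proof.
by apply: measurableT_comp => //; apply: measurable_funM => //; exact: measurable_lin.
Qed.

(** Moving the base point from [y] to [tadd y delta] is an exponential tilt of [K y], so averages
    under both conditional laws become integrals against [K y]. *)
Lemma ge0_integral_tilt y delta (phi : d.-tuple R -> R) :
  measurable_fun setT phi -> (forall x, 0 <= phi x) ->
  (\int[K y]_x (phi x * expR (lin y delta x / eta))%:E =
   (Z (tadd y delta) / Z y * expR (sqnorm delta / (2 * eta)))%:E *
   \int[K (tadd y delta)]_x (phi x)%:E)%E.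
Proof.
move=> mphi phi0.
have Z1 := partition_fun_gt0 y; have Z2 := partition_fun_gt0 (tadd y delta).
have mw := measurable_gibbs_weight1.
have mphiE : measurable_fun setT (EFin \o phi) by exact/measurable_EFinP.
rewrite !ge0_integral_gibbs//; last 2 first.
- by apply/measurable_EFinP; apply: measurable_funM => //; exact: measurable_exp_lin.
- by move=> x; rewrite lee_fin mulr_ge0// ltW// expR_gt0.
rewrite muleA -EFinM.
rewrite (_ : _ * expR (sqnorm delta / (2 * eta)) * _ =
   (Z y)^-1 * expR (sqnorm delta / (2 * eta))); last first.
  move: (Z y) (Z (tadd y delta)) (expR _) Z1 Z2 => a b c a0 b0.
  by field; rewrite !lt0r_neq0.
rewrite EFinM -muleA; congr (_ * _)%E.
rewrite -ge0_integralZl//.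
- apply: eq_integral => x _; rewrite -!EFinM gibbs_weight_tadd; congr (_%:E).
  by field; rewrite lt0r_neq0// expR_gt0.
- by apply: emeasurable_funM => //; apply/measurable_EFinP.
- by move=> x _; rewrite mule_ge0// lee_fin// ltW// gibbs_weight_gt0.
Qed.

Lemma integral_exp_lin y delta : (\int[K y]_x (expR (lin y delta x / eta))%:E =
   (Z (tadd y delta) / Z y * expR (sqnorm delta / (2 * eta)))%:E)%E.
Proof.
have := ge0_integral_tilt y delta (cst 1) (measurable_cst _) (fun _ => ler01).
rewrite /= integral_cst// mul1e prob_kernel mule1 => <-.
by apply: eq_integral => x _; rewrite mul1r.
Qed.

Definition mean y delta : R := \int[K y]_x (lin y delta x / eta).

Let Kfin y : (K y setT < +oo)%E. Proof. by rewrite prob_kernel ltry. Qed.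

Lemma rintegrable_exp_lin y delta c :
  rintegrable (K y) (fun x => expR (c * (lin y delta x / eta))).
Proof.
have -> : (fun x => expR (c * (lin y delta x / eta))) =
    (fun x => expR (lin y (tscale c delta) x / eta)).
  by apply/funext => x; rewrite lin_tscale mulrA.
apply: rintegrable_ge0; first exact: measurable_exp_lin.
  by move=> x; rewrite ltW// expR_gt0.
by rewrite integral_exp_lin ltry.
Qed.

Lemma measurable_lin_eta y delta : measurable_fun setT (fun x => lin y delta x / eta).
Proof. by apply: measurable_funM => //; exact: measurable_lin. Qed.

Lemma rintegrable_lin y delta : rintegrable (K y) (fun x => lin y delta x / eta).
Proof.
apply: (le_rintegrable _ _ (fun x => expR (1 * (lin y delta x / eta)) +
    expR (-1 * (lin y delta x / eta)))); first exact: measurable_lin_eta.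
  move=> x; rewrite mul1r mulN1r; move: (lin y delta x / eta) => a.
  have h1 := expR_ge1Dx a; have h2 := expR_ge1Dx (- a).
  have h3 := expR_gt0 a; have h4 := expR_gt0 (- a).
  by rewrite ler_norml; apply/andP; split; lra.
by apply: rintegrableD; exact: rintegrable_exp_lin.
Qed.

Lemma mean_tscale y c delta : mean y (tscale c delta) = c * mean y delta.
Proof.
rewrite /mean -RintegralZl//; last exact: rintegrable_lin.
by apply: eq_Rintegral => x _; rewrite lin_tscale mulrA.
Qed.

Lemma Rintegral_cst1 y (c : R) : \int[K y]_x c = c.
Proof. by rewrite Rintegral_cst// prob_kernel mulr1. Qed.

Lemma rintegrable_cst y c : rintegrable (K y) (fun=> c).
Proof. exact: (rintegrable_bounded _ _ `|c|). Qed.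

Definition mgf y delta : R := \int[K y]_x expR (lin y delta x / eta).

Lemma mgfE y delta :
  mgf y delta = Z (tadd y delta) / Z y * expR (sqnorm delta / (2 * eta)).
Proof. by rewrite /mgf /Rintegral integral_exp_lin. Qed.

Lemma mgf_gt0 y delta : 0 < mgf y delta.
Proof. by rewrite mgfE mulr_gt0 ?expR_gt0// divr_gt0// partition_fun_gt0. Qed.

Lemma mgf_tscale y c delta :
  mgf y (tscale c delta) = \int[K y]_x expR (c * (lin y delta x / eta)).
Proof. by apply: eq_Rintegral => x _; rewrite lin_tscale mulrA. Qed.

(** Log-concavity of [Z] between [y] and [y + delta], rewritten with [ln mgf = ln Z (y + delta) - ln
    Z y + |delta|^2 / (2 eta)]. The Gaussian term contributes [1 / eta], concavity takes back
    [gamma], and [sigma] is what remains. *)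
Lemma mgf_tscale_ge y s delta : 0 < s < 1 ->
  s * ln (mgf y delta) - s * (1 - s) * sigma / 2 * sqnorm delta <=
  ln (mgf y (tscale s delta)).
Proof.
move=> /andP[s0 s1].
have s01 : 0 < 1 - s < 1 by apply/andP; split; lra.
have := partition_fun_log_concave (1 - s) y (tadd y delta) s01.
rewrite tconv_tadd.
have -> : sqdist y (tadd y delta) = sqnorm delta.
  rewrite sqdist_tadd (_ : sqdist y y = 0); last first.
    by rewrite /sqdist big1// => i _; rewrite subrr expr0n.
  rewrite (_ : lin y delta y = 0) ?mulr0 ?subrr ?add0r//.
  by rewrite /lin big1// => i _; rewrite subrr mul0r.
rewrite !mgfE.
have Z1 := partition_fun_gt0 y; have Z2 := partition_fun_gt0 (tadd y delta).
have Z3 := partition_fun_gt0 (tadd y (tscale s delta)).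
move: (Z y) (Z (tadd y delta)) (Z (tadd y (tscale s delta))) Z1 Z2 Z3 => zy zd zs Z1 Z2 Z3.
rewrite -ler_ln ?posrE ?mulr_gt0 ?powR_gt0 ?expR_gt0//.
rewrite !lnM ?lnV ?posrE ?mulr_gt0 ?powR_gt0 ?invr_gt0 ?expR_gt0// !ln_powR !expRK sqnorm_tscale.
rewrite -gamma_sigma (_ : (2 * eta)^-1 = eta^-1 / 2); last by rewrite invfM mulrC.
move: (ln zy) (ln zd) (ln zs) (sqnorm delta) gamma eta^-1 => a b c n g e h.
by lra.
Qed.

Lemma mgf_tscale_le y s delta : 0 <= s <= 1 ->
  ln (mgf y (tscale s delta)) <=
  s * mean y delta + s ^+ 2 * (4 * (mgf y (tscale 2 delta) + mgf y (tscale (- 2) delta))).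
Proof.
move=> s01; set C := 4 * _.
have hexp c := rintegrable_exp_lin y delta c.
have hl := rintegrable_lin y delta.
suff : mgf y (tscale s delta) <= 1 + (s * mean y delta + s ^+ 2 * C).
  move=> h; rewrite -ler_expR lnK ?posrE ?mgf_gt0//.
  exact: le_trans h (expR_ge1Dx _).
rewrite mgf_tscale.
have -> : 1 + (s * mean y delta + s ^+ 2 * C) = \int[K y]_x (1 + s * (lin y delta x / eta) +
    4 * s ^+ 2 * (expR (2 * (lin y delta x / eta)) + expR (- 2 * (lin y delta x / eta)))).
  have i1 := rintegrableZ _ s _ hl.
  have i2 := rintegrableD _ _ _ (hexp 2) (hexp (- 2)).
  rewrite RintegralD//; last 2 first.
  - by apply: rintegrableD => //; exact: rintegrable_cst.
  - exact: (rintegrableZ _ _ _ i2).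
  rewrite RintegralD//; last exact: rintegrable_cst.
  rewrite Rintegral_cst1 (RintegralZl s measurableT hl) (RintegralZl _ measurableT i2).
  rewrite (RintegralD measurableT (hexp 2) (hexp (- 2))) -!mgf_tscale /C -/(mean y delta).
  move: (mean _ _) (mgf _ _) (mgf _ _) => a b c.
  by ring.
apply: le_Rintegral => //.
- exact: hexp.
- apply: rintegrableD; first apply: rintegrableD; first exact: rintegrable_cst.
    exact: rintegrableZ.
  by apply: rintegrableZ; exact: rintegrableD.
- by move=> x _; rewrite mulNr; exact: expR_scale_quad.
Qed.

(** The lower and upper bounds on [ln (mgf y (tscale s delta))] are compared, divided by [s], and
    [s] is made small: the mean survives as the first-order term. *)
Lemma mgf_subgaussian y delta :
  mgf y delta <= expR (mean y delta + sigma / 2 * sqnorm delta).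
Proof.
rewrite -[leLHS]lnK ?posrE ?mgf_gt0// ler_expR.
apply/ler_addgt0Pr => e e0.
set C := 4 * (mgf y (tscale 2 delta) + mgf y (tscale (- 2) delta)).
have C0 : 0 < C by rewrite mulr_gt0// addr_gt0// mgf_gt0.
(* This [s] lies strictly between [0] and [1] and makes the remainder [s * C] at most [e]. *)
pose s := e / (e + C).
have eC : 0 < e + C by exact: addr_gt0.
have s0 : 0 < s by rewrite divr_gt0.
have s1 : s < 1 by rewrite ltr_pdivrMr// mul1r ltrDl.
have s01 : 0 < s < 1 by rewrite s0.
have s01' : 0 <= s <= 1 by rewrite !ltW.
have := le_trans (mgf_tscale_ge y s delta s01) (mgf_tscale_le y s delta s01').
rewrite -/C => h.
have sC : s * C <= e.
  by rewrite /s mulrAC ler_pdivrMr// ler_pM2l//; lra.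
have sg : 0 <= sigma / 2 * sqnorm delta.
  by rewrite mulr_ge0 ?sqnorm_ge0// divr_ge0// ltW// sigma_gt0.
have : s * ln (mgf y delta) <=
    s * (mean y delta + (1 - s) * (sigma / 2 * sqnorm delta) + s * C).
  move: h; move: (ln _) (mean _ _) sigma (sqnorm _) => a b g n; rewrite expr2; lra.
rewrite ler_pM2l// => /le_trans; apply.
by rewrite -!addrA lerD2l; apply: lerD => //; nra.
Qed.

Lemma mgf_ge_mean y delta : expR (mean y delta) <= mgf y delta.
Proof.
rewrite -[leLHS]mul1r -ler_pdivlMr ?expR_gt0//.
have hexp := rintegrable_exp_lin y delta 1.
have hl := rintegrable_lin y delta.
have i1 : rintegrable (K y) (fun x => 1 - mean y delta + lin y delta x / eta).
  by apply: rintegrableD => //; exact: rintegrable_cst.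
have : \int[K y]_x (1 - mean y delta + lin y delta x / eta) <=
   \int[K y]_x ((expR (mean y delta))^-1 * expR (1 * (lin y delta x / eta))).
  apply: le_Rintegral => //; first exact: rintegrableZ.
  move=> x _; rewrite mul1r -expRN -expRD.
  by apply: le_trans (expR_ge1Dx _); rewrite addrA.
rewrite RintegralD//; last exact: rintegrable_cst.
rewrite Rintegral_cst1 subrK RintegralZl// mulrC.
by under eq_Rintegral do rewrite mul1r.
Qed.

(** * Conditional averages of a bounded density *)

Section bounded_density.
Variables (h : d.-tuple R -> R) (eps M : R).
Hypotheses (mh : measurable_fun setT h) (eps0 : 0 < eps)
  (hbd : forall x, eps <= h x <= M).

Let h_gt0 x : 0 < h x. Proof. by case/andP: (hbd x) => + _; exact: lt_le_trans. Qed.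
Let h_leM x : h x <= M. Proof. by case/andP: (hbd x). Qed.
Let M_gt0 : 0 < M.
Proof. exact: lt_le_trans (h_gt0 [tuple 0 | i < d]) (h_leM _). Qed.

Lemma rintegrable_density y : rintegrable (K y) h.
Proof. by apply: (rintegrable_bounded _ _ M) => // x; rewrite gtr0_norm. Qed.

Lemma rintegrable_densityM y (phi : d.-tuple R -> R) : rintegrable (K y) phi ->
  rintegrable (K y) (fun x => h x * phi x).
Proof.
move=> hphi; have mphi := measurable_rintegrable _ _ hphi.
apply: (le_rintegrable _ _ (fun x => M * `|phi x|)); first exact: measurable_funM.
  by move=> x; rewrite normrM gtr0_norm// ler_wpM2r.
by apply: rintegrableZ; exact: (integrable_abse hphi).
Qed.

Lemma abs_ln_density x : `|ln (h x)| <= `|ln eps| + `|ln M|.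
Proof.
have h1 : ln eps <= ln (h x) by rewrite ler_ln ?posrE//; case/andP: (hbd x).
have h2 : ln (h x) <= ln M by rewrite ler_ln ?posrE//; case/andP: (hbd x).
have h3 := ler_norm (ln M).
have : - ln eps <= `|ln eps| by rewrite -normrN ler_norm.
have h4 := normr_ge0 (ln M); have h5 := normr_ge0 (ln eps).
by rewrite ler_norml => h6; apply/andP; split; lra.
Qed.

Lemma rintegrable_density_ln y : rintegrable (K y) (fun x => h x * ln (h x)).
Proof.
apply: rintegrable_densityM; apply: (rintegrable_bounded _ _ (`|ln eps| + `|ln M|)) => //.
  exact: measurableT_comp.
exact: abs_ln_density.
Qed.

Definition kden y : R := \int[K y]_x h x.
Definition kent y : R := \int[K y]_x (h x * ln (h x)).

(* Relative entropy of the conditional law with density [h / kden y] w.r.t. [K y]. *)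
Definition kappa y : R := kent y / kden y - ln (kden y).

Lemma kden_bounds y : eps <= kden y <= M.
Proof.
apply/andP; split.
  rewrite -[leLHS](Rintegral_cst1 y); apply: le_Rintegral => //.
  - exact: rintegrable_cst.
  - exact: rintegrable_density.
  - by move=> x _; case/andP: (hbd x).
rewrite -[leRHS](Rintegral_cst1 y); apply: le_Rintegral => //.
- exact: rintegrable_density.
- exact: rintegrable_cst.
Qed.

Lemma kden_gt0 y : 0 < kden y.
Proof. by case/andP: (kden_bounds y) => + _; exact: lt_le_trans. Qed.

(** Integrates [young_ln] at [a = h x / kden y] and [b = phi x - ln m]; subtracting [ln m] gives the
    exponential mean [1]. *)
Lemma gibbs_variational y (phi : d.-tuple R -> R) : rintegrable (K y) phi ->
  rintegrable (K y) (expR \o phi) ->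
  \int[K y]_x (h x * phi x) <= kden y * (kappa y + ln (\int[K y]_x expR (phi x))).
Proof.
move=> iphi iexp; have k0 := kden_gt0 y.
set m := \int[K y]_x expR (phi x).
(* Jensen's inequality, through the tangent line of the exponential at the mean of [phi]. *)
have m0 : 0 < m.
  apply: (@lt_le_trans _ _ (expR (\int[K y]_x phi x))); first exact: expR_gt0.
  rewrite -[leLHS]mul1r -ler_pdivlMr ?expR_gt0//.
  have : \int[K y]_x (1 - (\int[K y]_x phi x) + phi x) <=
     \int[K y]_x ((expR (\int[K y]_x phi x))^-1 * expR (phi x)).
    apply: le_Rintegral => //.
    - by apply: rintegrableD => //; exact: rintegrable_cst.
    - exact: (rintegrableZ _ _ _ iexp).
    - move=> x _; rewrite -expRN -expRD.
      by apply: le_trans (expR_ge1Dx _); rewrite addrA.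
  rewrite (RintegralD measurableT (rintegrable_cst y _) iphi) Rintegral_cst1 subrK.
  by rewrite (RintegralZl _ measurableT iexp) mulrC.
have ih := rintegrable_density y.
have ihphi := rintegrable_densityM y phi iphi.
have ihln := rintegrable_density_ln y.
have : \int[K y]_x (h x * phi x - ln m * h x) <=
  \int[K y]_x (h x * ln (h x) - (ln (kden y) + 1) * h x + kden y / m * expR (phi x)).
  apply: le_Rintegral => //.
  - by apply: rintegrableB => //; exact: rintegrableZ.
  - apply: rintegrableD; first by apply: rintegrableB => //; exact: rintegrableZ.
    exact: (rintegrableZ _ _ _ iexp).
  - move=> x _.
    have := @young_ln _ (h x / kden y) (phi x - ln m) (divr_gt0 (h_gt0 x) k0).
    rewrite ln_div ?posrE// expRB lnK ?posrE// => H.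
    have := ler_wpM2l (ltW k0) H.
    have e1 : kden y * (h x / kden y * (phi x - ln m)) = h x * phi x - ln m * h x.
      by field; exact: lt0r_neq0.
    have e2 : kden y * (h x / kden y * (ln (h x) - ln (kden y)) - h x / kden y + expR (phi x) / m) =
       h x * ln (h x) - (ln (kden y) + 1) * h x + kden y / m * expR (phi x).
      by field; rewrite !lt0r_neq0.
    by rewrite e1 e2.
rewrite (RintegralB measurableT ihphi (rintegrableZ _ (ln m) _ ih)).
rewrite (RintegralD measurableT (rintegrableB _ _ _ ihln (rintegrableZ _ (ln (kden y) + 1) _ ih))
  (rintegrableZ _ (kden y / m) _ iexp)).
rewrite (RintegralB measurableT ihln (rintegrableZ _ (ln (kden y) + 1) _ ih)).
rewrite !(RintegralZl _ measurableT ih) (RintegralZl _ measurableT iexp) -/m.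
rewrite -/(kden y) -/(kent y) divfK ?lt0r_neq0//.
have -> : kden y * (kappa y + ln m) = kent y - kden y * ln (kden y) + kden y * ln m.
  rewrite /kappa; move: (kent y) (kden y) k0 (ln m) => a b b0 c.
  by field; exact: lt0r_neq0.
move: (kent y) (kden y) (ln _) (ln _) (Rintegral _ _ _) => a b c e g; lra.
Qed.

Lemma kappa_ge0 y : 0 <= kappa y.
Proof.
have i0 : rintegrable (K y) (fun=> 0) by exact: rintegrable_cst.
have i1 : rintegrable (K y) (expR \o (fun=> 0)).
  rewrite (_ : expR \o _ = fun=> 1); first exact: rintegrable_cst.
  by apply/funext => x; rewrite /= expR0.
have := gibbs_variational y (fun=> 0) i0 i1.
under eq_Rintegral do rewrite mulr0.
rewrite Rintegral_cst1.
under eq_Rintegral do rewrite expR0.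
by rewrite Rintegral_cst1 ln1 addr0 pmulr_rge0// kden_gt0.
Qed.

Lemma kappa_le y : kappa y <= ln (M / eps).
Proof.
have k0 := kden_gt0 y.
rewrite ln_div ?posrE// /kappa; apply: lerB; last first.
  by rewrite ler_ln ?posrE//; case/andP: (kden_bounds y).
rewrite ler_pdivrMr// /kent /kden -RintegralZl//; last exact: rintegrable_density.
apply: le_Rintegral => //.
- exact: rintegrable_density_ln.
- by apply: rintegrableZ; exact: rintegrable_density.
- by move=> x _; rewrite mulrC ler_wpM2r ?(ltW (h_gt0 x))// ler_ln ?posrE.
Qed.

(** The factor [8] is twice the [4] of [expR_scale_quad], one for each exponential; [M / eps] bounds
    [M / kden y]; [expR (2 * sigma)] is the subgaussian bound at [2] and [- 2] for a vector of norm
    at most [1]. *)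
Let L := 8 * (M / eps) * expR (2 * sigma).

Let L_ge0 : 0 <= L.
Proof.
rewrite /L; apply: mulr_ge0; last exact: ltW (expR_gt0 _).
by apply: mulr_ge0 => //; apply: divr_ge0; exact: ltW.
Qed.

(** [kden (tadd y delta)] averages [h] under a tilt of [K y], whose normalization is at least the
    exponential of the mean, so the exponent may be centred. A second-order expansion leaves a
    linear term, controlled by the variational principle, and a remainder absorbed in [L]. The
    parameter [l] trades the weight of [kappa] against that of [|delta|^2]. *)
Lemma kden_tadd_le y delta l : 0 < l ->
  kden (tadd y delta) <=
  kden y * expR (l * kappa y + (sigma / (2 * l) + L) * sqnorm delta).
Proof.
move=> l0; have k0 := kden_gt0 y; have sg0 := sigma_gt0.
have [s [delta1 [s0 dE s2 d1]]] : exists s delta1, [/\ 0 <= s, delta = tscale s delta1,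
    s ^+ 2 = sqnorm delta & sqnorm delta1 <= 1].
  have [n0|nn0] := eqVneq (sqnorm delta) 0.
    exists 0, delta; split => //; first exact: sqnorm_eq0.
      by rewrite expr0n n0.
    by rewrite n0.
  have np : 0 < sqnorm delta by rewrite lt0r nn0 sqnorm_ge0.
  exists (Num.sqrt (sqnorm delta)), (tscale (Num.sqrt (sqnorm delta))^-1 delta).
  rewrite sqrtr_ge0 tscaleA divff ?tscale1 ?sqr_sqrtr ?sqnorm_ge0//; last first.
    by rewrite lt0r_neq0// sqrtr_gt0.
  by split => //; rewrite sqnorm_tscale exprVn sqr_sqrtr ?sqnorm_ge0// mulVf.
rewrite -s2.
(* Shifts longer than [1] are handled without expansion: [kden] varies by a factor at most
   [M / eps], which is below [1 + L * s ^ 2]. *)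
have [s1|s1] := leP s 1; last first.
  apply: (@le_trans _ _ (kden y * (M / eps))).
    case/andP: (kden_bounds (tadd y delta)) => _ /le_trans; apply.
    by rewrite mulrCA ler_peMr ?(ltW M_gt0)// ler_pdivlMr// mul1r; case/andP: (kden_bounds y).
  rewrite ler_pM2l//; apply: (@le_trans _ _ (1 + L)).
    rewrite /L; have : 1 <= expR (2 * sigma) by rewrite -expR0 ler_expR mulr_ge0// ltW.
    have : 0 < M / eps by rewrite divr_gt0.
    by move: (M / eps) (expR _) => a b a0 b1; nra.
  apply: le_trans (expR_ge1Dx _); rewrite lerD2l.
  have c1 := mulr_ge0 (ltW l0) (kappa_ge0 y).
  have c2 : 0 <= sigma / (2 * l) * s ^+ 2.
    by rewrite mulr_ge0 ?sqr_ge0// divr_ge0 ?ltW// mulr_gt0.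
  have c3 : L <= L * s ^+ 2 by rewrite ler_peMr// expr_ge1// ltW.
  by rewrite mulrDl; lra.
pose th x := lin y delta1 x / eta; pose e := mean y delta1.
have ith : rintegrable (K y) th by exact: rintegrable_lin.
have ithe : rintegrable (K y) (fun x => th x - e).
  by apply: rintegrableB => //; exact: rintegrable_cst.
have expthe (c : R) : (fun x => expR (c * (th x - e))) = (fun x => expR (- (c * e)) * expR (c * th x)).
  by apply/funext => x; rewrite -expRD; congr expR; ring.
have iexp (c : R) : rintegrable (K y) (fun x => expR (c * (th x - e))).
  by rewrite expthe; apply: rintegrableZ; exact: rintegrable_exp_lin.
have sub (c : R) : \int[K y]_x expR (c * (th x - e)) <= expR (sigma / 2 * c ^+ 2).
  rewrite expthe (RintegralZl _ measurableT (rintegrable_exp_lin y delta1 c)).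
  rewrite -mgf_tscale mulrC expRN ler_pdivrMr ?expR_gt0// -expRD.
  apply: le_trans (mgf_subgaussian _ _) _.
  rewrite ler_expR mean_tscale addrC lerD2r sqnorm_tscale mulrA ler_piMr//.
  by rewrite mulr_ge0 ?sqr_ge0// divr_ge0// ltW.
have ih := rintegrable_density y.
have step1 : kden (tadd y delta) <= \int[K y]_x (h x * expR (s * (th x - e))).
  have E : mgf y delta * kden (tadd y delta) = \int[K y]_x (h x * expR (lin y delta x / eta)).
    rewrite /Rintegral (ge0_integral_tilt y delta h mh) => [|x]; last exact: ltW.
    rewrite fineM//; last exact: (integrable_fin_num measurableT (rintegrable_density _)).
    by rewrite -mgfE.
  have Ee : \int[K y]_x (h x * expR (s * (th x - e))) =
      expR (- mean y delta) * \int[K y]_x (h x * expR (lin y delta x / eta)).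
    rewrite -RintegralZl//; last first.
      apply: rintegrable_densityM; have := rintegrable_exp_lin y delta 1.
      by under [X in rintegrable _ X]eq_fun do rewrite mul1r.
    apply: eq_Rintegral => x _; rewrite mulrCA -expRD dE mean_tscale lin_tscale.
    by congr (_ * expR _); rewrite /th /e; ring.
  rewrite Ee -E mulrA ler_peMl ?(ltW (kden_gt0 _))//.
  by rewrite expRN mulrC ler_pdivlMr ?expR_gt0// mul1r mgf_ge_mean.
apply: (le_trans step1).
have i2 := rintegrableD _ _ _ (iexp 2) (iexp (- 2)).
have s01 : 0 <= s <= 1 by rewrite s0.
have step2 : \int[K y]_x (h x * expR (s * (th x - e))) <=
   \int[K y]_x (h x + h x * (s * (th x - e)) + M * (4 * s ^+ 2) *
      (expR (2 * (th x - e)) + expR (- 2 * (th x - e)))).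
  apply: le_Rintegral => //.
  - exact: rintegrable_densityM.
  - apply: rintegrableD; last exact: rintegrableZ.
    by apply: rintegrableD => //; apply: rintegrable_densityM; exact: rintegrableZ.
  - move=> x _; have := expR_scale_quad s (th x - e) s01; rewrite -mulNr.
    have : 0 <= expR (2 * (th x - e)) + expR (- 2 * (th x - e)).
      by rewrite addr_ge0// ltW// expR_gt0.
    move: (th x - e) (expR (2 * _) + _) (expR (s * _)) => v E u E0 q.
    apply: le_trans (ler_wpM2l (ltW (h_gt0 x)) q) _.
    have : h x * (4 * s ^+ 2 * E) <= M * (4 * s ^+ 2 * E).
      by rewrite ler_wpM2r// !mulr_ge0// sqr_ge0.
    by move: (h x) => a; lra.
apply: (le_trans step2).
have i3 : rintegrable (K y) (fun x => h x * (s * (th x - e))).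
  by apply: rintegrable_densityM; exact: rintegrableZ.
rewrite (RintegralD measurableT (rintegrableD _ _ _ ih i3) (rintegrableZ _ _ _ i2)).
rewrite (RintegralD measurableT ih i3) -/(kden y).
rewrite (RintegralZl _ measurableT i2) (RintegralD measurableT (iexp 2) (iexp (- 2))).
(* The variational principle is applied to [s / l] times the centred form and multiplied by [l]; the
   subgaussian cost [(s / l)^2] becomes [s^2 / l]. *)
have step3 : \int[K y]_x (h x * (s * (th x - e))) <= kden y * (l * kappa y + sigma / (2 * l) * s ^+ 2).
  have i4 : rintegrable (K y) (fun x => s / l * (th x - e)) by exact: rintegrableZ.
  have := gibbs_variational y _ i4 (iexp (s / l)).
  have -> : \int[K y]_x (h x * (s / l * (th x - e))) = l^-1 * \int[K y]_x (h x * (s * (th x - e))).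
    by rewrite -RintegralZl//; apply: eq_Rintegral => x _; ring.
  rewrite mulrC ler_pdivrMr// => /le_trans; apply.
  rewrite -[leLHS]mulrA ler_pM2l// [leLHS]mulrC mulrDr lerD2l.
  apply: (@le_trans _ _ (l * (sigma / 2 * (s / l) ^+ 2))).
    rewrite ler_pM2l// -ler_expR lnK; last first.
      rewrite posrE; have := mgf_gt0 y (tscale (s / l) delta1).
      rewrite mgf_tscale /= expthe (RintegralZl _ measurableT (rintegrable_exp_lin y delta1 (s / l))).
      by move=> ?; rewrite mulr_gt0// expR_gt0.
    exact: sub.
  by rewrite le_eqVlt; apply/orP; left; apply/eqP; field; exact: lt0r_neq0.
have step4 : M * (4 * s ^+ 2) * (\int[K y]_x expR (2 * (th x - e)) + \int[K y]_x expR (- 2 * (th x - e)))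
    <= kden y * (L * s ^+ 2).
  apply: (@le_trans _ _ (M * (4 * s ^+ 2) * (expR (2 * sigma) + expR (2 * sigma)))).
    rewrite ler_wpM2l ?mulr_ge0 ?sqr_ge0 ?(ltW M_gt0)//.
    apply: lerD; apply: le_trans (sub _) _; rewrite ler_expR le_eqVlt; apply/orP; left;
      by apply/eqP; field.
  rewrite /L (_ : _ * _ * (_ + _) = 8 * M * expR (2 * sigma) * s ^+ 2); last by ring.
  have -> : kden y * (8 * (M / eps) * expR (2 * sigma) * s ^+ 2) =
     (kden y / eps) * (8 * M * expR (2 * sigma) * s ^+ 2).
    by field; exact: lt0r_neq0.
  rewrite ler_peMl// ?ler_pdivlMr// ?mul1r.
    by rewrite !mulr_ge0 ?sqr_ge0 ?(ltW M_gt0)// ltW// expR_gt0.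
  by case/andP: (kden_bounds y).
apply: (@le_trans _ _ (kden y * (1 + (l * kappa y + (sigma / (2 * l) + L) * s ^+ 2)))).
  move: step3 step4; move: (Rintegral _ _ _) (M * _ * _) (kden y) (kappa y) (sigma / _) => a b c g n h1 h2.
  have -> : c * (1 + (l * g + (n + L) * s ^+ 2)) = c + c * (l * g + n * s ^+ 2) + c * (L * s ^+ 2).
    by ring.
  by apply: lerD => //; apply: lerD.
by rewrite ler_pM2l// expR_ge1Dx.
Qed.

End bounded_density.

End gibbs_kernel.

(** * Entropy contraction *)

Lemma le_poweRM_EFin {R : realType} (a b c p q : R) :
  a `^ p * b `^ q <= c -> (a%:E `^ p * b%:E `^ q <= c%:E)%E.
Proof. by rewrite !poweR_EFin -EFinM lee_fin. Qed.

(** The constraint makes [s / l] tend to [a / sg]; dividing the inequality by [l] then gives the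
    claim in the limit. *)
Lemma small_parameter_limit {R : realType} (a sg L H I C : R) :
  0 < a -> 0 < sg -> 0 <= L -> 0 <= C ->
  (forall s l, 0 < s < 1 -> 0 < l <= 1 -> l * (a * (1 - s) - 2 * L * s) = sg * s ->
     s * H <= l * I + l ^+ 2 * C) ->
  a * H <= sg * I.
Proof.
move=> a0 sg0 L0 C0 hyp; apply/ler_addgt0Pr => e e0.
(* [B] collects the coefficients of the errors of order [l], and [l] is chosen so that [l * B <= e].
   The absolute value covers either sign of [I]. *)
pose B := `|I| * (a + 2 * L) + C * (sg + (a + 2 * L)).
have B0 : 0 <= B by rewrite addr_ge0// mulr_ge0//; lra.
pose l := e / (e + B).
have eB : 0 < e + B by rewrite ltr_wpDr.
have l0 : 0 < l by rewrite divr_gt0.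
have l1 : l <= 1 by rewrite ler_pdivrMr// mul1r lerDl.
have lB : l * B <= e.
  by rewrite /l mulrAC ler_pdivrMr// ler_pM2l//; lra.
(* Solving the constraint for [s] at given [l] yields [l * a / q]. *)
pose q := sg + l * (a + 2 * L).
have aL : 0 < a + 2 * L by lra.
have laL : 0 < l * (a + 2 * L) by exact: mulr_gt0.
have q0 : 0 < q by rewrite /q; lra.
pose s := l * a / q.
have s0 : 0 < s by rewrite divr_gt0// mulr_gt0.
have s1 : s < 1.
  rewrite ltr_pdivrMr// mul1r /q.
  have : 0 <= l * (2 * L) by apply: mulr_ge0; [exact: ltW|exact: mulr_ge0].
  by rewrite mulrDr; lra.
have s01 : 0 < s < 1 by rewrite s0.
have l01 : 0 < l <= 1 by rewrite l0.
have eqn : l * (a * (1 - s) - 2 * L * s) = sg * s.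
  by rewrite /s /q; field; rewrite -/q lt0r_neq0.
have := hyp s l s01 l01 eqn.
rewrite /s mulrAC ler_pdivrMr// => h.
have : l * (a * H) <= l * ((I + l * C) * q).
  by move: h; rewrite expr2; lra.
rewrite ler_pM2l// => /le_trans; apply.
have h1 : I * (a + 2 * L) <= `|I| * (a + 2 * L) by rewrite ler_wpM2r ?(ltW aL)// ler_norm.
have h2 : l * (I * (a + 2 * L)) <= l * (`|I| * (a + 2 * L)) by rewrite ler_pM2l.
have h3 : C * q <= C * (sg + (a + 2 * L)).
  by rewrite ler_wpM2l// /q lerD2l ler_piMl// ltW.
have h4 : l * (C * q) <= l * (C * (sg + (a + 2 * L))) by rewrite ler_pM2l.
apply: le_trans (_ : sg * I + l * B <= _); last by rewrite lerD2l.
have -> : (I + l * C) * q = sg * I + (l * (I * (a + 2 * L)) + l * (C * q)) by rewrite /q; ring.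
by rewrite lerD2l /B mulrDr; lra.
Qed.

(** * Entropy inequality for the averages of a bounded density *)

Section contraction_bounded.
Context {R : realType} {d : nat}.
Variable lam : {sigma_finite_measure set (d.-tuple R) -> \bar R}.
Hypothesis hlam : is_lebesgue lam.
Variables (eta alpha_f alpha_g : R) (f g : d.-tuple R -> R).
Hypotheses (eta0 : 0 < eta) (alpha_f0 : 0 < alpha_f) (alpha_g0 : 0 < alpha_g).
Hypotheses (hf : strongly_convex alpha_f f) (hg : strongly_convex alpha_g g).
Variable K : R.-pker (d.-tuple R) ~> (d.-tuple R).
Hypothesis hK : forall y, exists c : R, 0 < c /\ forall B, measurable B ->
  K y B = (c%:E * \int[lam]_(x in B) (expR (- f x - sqdist x y / (2 * eta)))%:E)%E.
Variable piY : probability (d.-tuple R) R.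
Hypothesis hpiY : exists c : R, 0 < c /\ forall B, measurable B ->
  piY B = (c%:E * \int[lam]_(y in B) (expR (- g y) * partition_fun lam eta f y)%:E)%E.

Local Notation Z := (partition_fun lam eta f).
Local Notation sigma := (sigma eta alpha_f).
Definition alphaY : R := alpha_g + gamma eta alpha_f.

Let mg : measurable_fun setT g := strongly_convex_measurable alpha_g g alpha_g0 hg.
Let Z_gt0 y : 0 < Z y.
Proof. exact: (partition_fun_gt0 lam eta alpha_f f alpha_f0 hf K hK). Qed.

Lemma measurable_partition_fun : measurable_fun setT Z.
Proof.
have mw := measurable_gibbs_weight eta alpha_f f alpha_f0 hf.
apply: measurableT_comp => //.
apply: (measurable_fun_fubini_tonelli_G (m1 := lam)
  (fun z : d.-tuple R * d.-tuple R => (gibbs_weight eta f z.2 z.1)%:E)).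
  exact/measurable_EFinP.
by move=> z; rewrite lee_fin ltW// gibbs_weight_gt0.
Qed.

Lemma piY_density : exists2 c : R, 0 < c & forall B, measurable B ->
  piY B = (\int[lam]_(y in B) (c * (expR (- g y) * Z y))%:E)%E.
Proof.
have [c [c0 h]] := hpiY; exists c => // B mB; rewrite h// -ge0_integralZl//.
- apply/measurable_EFinP/measurable_funTS/measurable_funM.
    by apply: measurableT_comp => //; exact: measurableT_comp.
  exact: measurable_partition_fun.
- by move=> y _; rewrite lee_fin mulr_ge0 ?ltW ?expR_gt0.
- by rewrite lee_fin ltW.
Qed.

Lemma marginal_log_concave t y y' : 0 < t < 1 ->
  (expR (- g y) * Z y) `^ t * (expR (- g y') * Z y') `^ (1 - t) *
    expR (alphaY / 2 * (t * (1 - t)) * sqdist y y') <=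
  expR (- g (tconv t y y')) * Z (tconv t y y').
Proof.
move=> t01; have /andP[t0 t1] := t01.
have h1 := partition_fun_log_concave lam hlam eta alpha_f f eta0 alpha_f0 hf K hK t y y' t01.
have t01' : 0 <= t <= 1 by rewrite !ltW.
have h2 := strongly_convex_tconv alpha_g g t y y' t01' hg.
move: (Z y) (Z y') (Z (tconv t y y')) (Z_gt0 y) (Z_gt0 y') h1 => a b c a0 b0 h1.
rewrite (powRM _ (ltW (expR_gt0 _)) (ltW a0)) (powRM _ (ltW (expR_gt0 _)) (ltW b0)) -!expRM.
have -> : alphaY / 2 * (t * (1 - t)) * sqdist y y' =
    alpha_g / 2 * (t * (1 - t)) * sqdist y y' +
    gamma eta alpha_f / 2 * (t * (1 - t)) * sqdist y y' by rewrite /alphaY; ring.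
rewrite expRD (_ : _ * (_ * _) = expR (- g y * t) * expR (- g y' * (1 - t)) *
   expR (alpha_g / 2 * (t * (1 - t)) * sqdist y y') * (a `^ t * b `^ (1 - t) *
   expR (gamma eta alpha_f / 2 * (t * (1 - t)) * sqdist y y'))); last first.
  move: (expR (- g y * t)) (expR (- g y' * _)) (expR (alpha_g / _ * _ * _)) (expR (gamma _ _ / _ * _ * _)).
  by move: (a `^ _) (b `^ _) => *; ring.
apply: ler_pM => //.
- by rewrite !mulr_ge0 ?powR_ge0 ?expR_ge0.
rewrite -!expRD ler_expR; lra.
Qed.

Variables (h : d.-tuple R -> R) (eps M : R).
Hypotheses (mh : measurable_fun setT h) (eps0 : 0 < eps)
  (hbd : forall x, eps <= h x <= M).
Local Notation k := (kden K h).
Local Notation kappa := (kappa K h).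
Local Notation kent := (kent K h).

Let h_gt0 x : 0 < h x. Proof. by case/andP: (hbd x) => + _; exact: lt_le_trans. Qed.
Let M_gt0 : 0 < M.
Proof. by case/andP: (hbd [tuple 0 | i < d]) => a b; exact: lt_le_trans eps0 (le_trans a b). Qed.

Let mK (phi : d.-tuple R -> R) : measurable_fun setT phi -> (forall x, 0 <= phi x) ->
  measurable_fun setT (fun y => \int[K y]_x phi x).
Proof.
move=> mphi phi0; apply: measurableT_comp => //.
apply: measurable_fun_integral_kernel.
- exact: measurable_kernel.
- by move=> x; rewrite lee_fin.
- exact/measurable_EFinP.
Qed.

Lemma measurable_kden : measurable_fun setT k.
Proof. by apply: mK => // x; exact: ltW. Qed.

Lemma measurable_kent : measurable_fun setT kent.
Proof.
(* Adding [C] makes the integrand nonnegative, the case in which [mK] gives measurability. *)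
pose C := M * (`|ln eps| + `|ln M|).
have hC x : 0 <= h x * ln (h x) + C.
  have := abs_ln_density h eps M eps0 hbd x => H.
  have : `|h x * ln (h x)| <= C.
    rewrite normrM ger0_norm ?(ltW (h_gt0 x))//.
    by apply: ler_pM => //; [exact: ltW|case/andP: (hbd x)].
  by rewrite ler_norml => /andP[h1 _]; lra.
have mhC : measurable_fun setT (fun x => h x * ln (h x) + C).
  by apply: measurable_funD => //; apply: measurable_funM => //; exact: measurableT_comp.
have -> : kent = (fun y => \int[K y]_x (h x * ln (h x) + C) - C).
  apply/funext => y; rewrite RintegralD//.
  - by rewrite Rintegral_cst1 addrK.
  - exact: (rintegrable_density_ln K h eps M mh eps0 hbd).
  - exact: rintegrable_cst.
by apply: measurable_funB => //; exact: mK.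
Qed.

Lemma measurable_kappa : measurable_fun setT kappa.
Proof.
apply: measurable_funB; last by apply: measurableT_comp => //; exact: measurable_kden.
apply: measurable_funM; first exact: measurable_kent.
have -> : (fun y => (k y)^-1) = (fun y => expR (- ln (k y))).
  apply/funext => y; rewrite expRN lnK// posrE.
  exact: (kden_gt0 K h eps M mh eps0 hbd).
apply: measurableT_comp => //; apply: measurableT_comp => //.
by apply: measurableT_comp => //; exact: measurable_kden.
Qed.

Let k_gt0 y : 0 < k y. Proof. exact: (kden_gt0 K h eps M mh eps0 hbd). Qed.
Let k_le y : k y <= M. Proof. by case/andP: (kden_bounds K h eps M mh eps0 hbd y). Qed.
Let k_ge y : eps <= k y. Proof. by case/andP: (kden_bounds K h eps M mh eps0 hbd y). Qed.
Let kap0 y : 0 <= kappa y. Proof. exact: (kappa_ge0 K h eps M mh eps0 hbd). Qed.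
Let D := ln (M / eps).
Let kapD y : kappa y <= D. Proof. exact: (kappa_le K h eps M mh eps0 hbd). Qed.
Let L := 8 * (M / eps) * expR (2 * sigma).
Let piYfin : (piY setT < +oo)%E. Proof. by rewrite probability_setT ltry. Qed.
Let D_ge0 : 0 <= D. Proof. exact: le_trans (kap0 [tuple 0 | i < d]) (kapD _). Qed.

(** The relation between [s] and [l] is exactly the one for which the cost
    [(sigma / (2 l) + L) s^2 |y - y'|^2] of shifting [k] equals the gain
    [alphaY / 2 * s (1 - s) |y - y'|^2] from log-concavity. The middle function integrates to [1],
    so its factor drops out. *)
Lemma marginal_prekopa_leindler s l : 0 < s < 1 -> 0 < l ->
  l * (alphaY * (1 - s) - 2 * L * s) = sigma * s ->
  ((\int[piY]_y (k y `^ (1 - s)^-1)%:E) `^ (1 - s) <=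
   \int[piY]_y (k y * expR (l * kappa y))%:E)%E.
Proof.
move=> /andP[s0 s1] l0 ls.
have t01 : 0 < 1 - s < 1 by apply/andP; split; lra.
have /andP[t0 t1] := t01.
have [c c0 pE] := piY_density.
pose r y := expR (- g y) * Z y.
have r0 y : 0 < r y by rewrite mulr_gt0// expR_gt0.
pose rho y := c * r y.
have rho0 y : 0 < rho y by rewrite mulr_gt0.
have mrho : measurable_fun setT rho.
  apply: measurable_funM => //; apply: measurable_funM; last exact: measurable_partition_fun.
  by apply: measurableT_comp => //; exact: measurableT_comp.
have mk := measurable_kden.
have mkp : measurable_fun setT (fun y => k y `^ (1 - s)^-1).
  exact: (measurableT_comp (measurable_powR (1 - s)^-1) mk).
have mke : measurable_fun setT (fun y => k y * expR (l * kappa y)).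
  apply: measurable_funM => //; apply: measurableT_comp => //.
  by apply: measurable_funM => //; exact: measurable_kappa.
have mE (phi : d.-tuple R -> R) : measurable_fun setT phi -> measurable_fun setT (EFin \o phi).
  by move=> ?; exact/measurable_EFinP.
have dens (phi : d.-tuple R -> R) : measurable_fun setT phi -> (forall y, 0 <= phi y) ->
    (\int[piY]_y (phi y)%:E = \int[lam]_y (phi y * rho y)%:E)%E.
  move=> mphi phi0.
  rewrite (ge0_integral_density piY lam rho)//.
  - by move=> y; exact: ltW.
  - exact: mE.
have PL := is_lebesgue_prekopa_leindler (1 - s) d lam t01 hlam
  (fun y => (k y `^ (1 - s)^-1 * rho y)%:E) (fun y => (1 * rho y)%:E)
  (fun y => (k y * expR (l * kappa y) * rho y)%:E).
have one : (\int[lam]_y (1 * rho y)%:E = 1)%E.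
  rewrite -(dens (cst 1))// (eq_integral (cst 1%E))// integral_cst// mul1e.
  exact: probability_setT.
have := PL (mE _ (measurable_funM mkp mrho)) (mE _ (measurable_funM (measurable_cst _) mrho))
  (mE _ (measurable_funM mke mrho)).
rewrite one poweR1r mule1 -!dens//; last 2 first.
- by move=> y; rewrite mulr_ge0 ?ltW// expR_gt0.
- by move=> y; exact: powR_ge0.
apply.
- by move=> y; rewrite lee_fin mulr_ge0 ?powR_ge0// ltW.
- by move=> y; rewrite lee_fin mul1r ltW.
- by move=> y; rewrite lee_fin !mulr_ge0 ?ltW// expR_gt0.
move=> y y'; apply: le_poweRM_EFin; rewrite mul1r subKr.
rewrite powRM ?powR_ge0 ?(ltW (rho0 _))// -powRrM mulVf ?lt0r_neq0// powRr1 ?(ltW (k_gt0 _))//.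
set z := tconv (1 - s) y y'.
(* [y] is the intermediate point [z] shifted by [s (y - y')]. Expanding around [z] places [kappa] at
   [z], where the majorant is evaluated. *)
have key := kden_tadd_le lam hlam eta alpha_f f eta0 alpha_f0 hf K hK h eps M mh eps0 hbd
  z (tscale (1 - (1 - s)) (tsub y y')) l l0.
rewrite tconvK sqnorm_tscale sqnorm_tsub subKr -/L in key.
have lc := marginal_log_concave (1 - s) y y' t01.
rewrite subKr -/z -/(r y) -/(r y') -/(r z) in lc.
have rhoc : rho y `^ (1 - s) * rho y' `^ s *
    expR (alphaY / 2 * ((1 - s) * s) * sqdist y y') <= rho z.
  rewrite /rho; move: (r y) (r y') (r z) (r0 y) (r0 y') lc => a b e a0 b0 lc.
  rewrite (powRM _ (ltW c0) (ltW a0)) (powRM _ (ltW c0) (ltW b0)).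
  have cc : c `^ (1 - s) * c `^ s = c.
    by rewrite -powRD ?subrK ?powRr1 ?(ltW c0)// oner_eq0.
  by rewrite mulrACA cc -[leLHS]mulrA ler_pM2l.
have eE : alphaY / 2 * ((1 - s) * s) * sqdist y y' =
    (sigma / (2 * l) + L) * (s ^+ 2 * sqdist y y').
  have -> : sigma = l * (alphaY * (1 - s) - 2 * L * s) / s.
    by rewrite ls mulfK// lt0r_neq0.
  by field; rewrite !lt0r_neq0.
rewrite eE in rhoc; move: key rhoc; rewrite expRD.
move: (expR (_ * kappa z)) (expR_gt0 (l * kappa z)) (expR _)
  (expR_gt0 ((sigma / (2 * l) + L) * (s ^+ 2 * sqdist y y'))) => a a0 b b0 key rhoc.
have P0 : 0 <= rho y `^ (1 - s) * rho y' `^ s by rewrite mulr_ge0 ?powR_ge0.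
rewrite -mulrA; apply: le_trans (ler_wpM2r P0 key) _.
rewrite [leLHS](_ : _ = (k z * a) * ((rho y `^ (1 - s) * rho y' `^ s) * b)); last first.
  by move: (rho y `^ _ * _) (k z) => p q; ring.
by rewrite ler_wpM2l// mulr_ge0// ltW.
Qed.

Let aY0 : 0 < alphaY.
Proof.
rewrite addr_gt0//; apply: divr_gt0 => //.
by rewrite addr_gt0// mulr_gt0.
Qed.

Let ibd (phi : d.-tuple R -> R) B : measurable_fun setT phi -> (forall y, `|phi y| <= B) ->
  rintegrable piY phi.
Proof. by move=> mphi; exact: rintegrable_bounded. Qed.

Let ik : rintegrable piY k.
Proof.
by apply: (ibd _ M); [exact: measurable_kden|move=> y; rewrite gtr0_norm].
Qed.

Let ikM (phi : d.-tuple R -> R) B : measurable_fun setT phi -> (forall y, `|phi y| <= B) ->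
  rintegrable piY (fun y => k y * phi y).
Proof.
move=> mphi hB; apply: (ibd _ (M * B)).
  by apply: measurable_funM => //; exact: measurable_kden.
by move=> y; rewrite normrM gtr0_norm//; apply: ler_pM => //; exact: ltW.
Qed.

Lemma rintegrable_kden_ln : rintegrable piY (fun y => k y * ln (k y)).
Proof.
apply: (ikM _ (`|ln eps| + `|ln M|)).
  by apply: measurableT_comp => //; exact: measurable_kden.
by apply: (abs_ln_density k eps M eps0) => y; rewrite k_ge k_le.
Qed.

Lemma rintegrable_kden_kappa : rintegrable piY (fun y => k y * kappa y).
Proof.
by apply: (ikM _ D); [exact: measurable_kappa|move=> y; rewrite ger0_norm].
Qed.

Hypothesis k1 : \int[piY]_y k y = 1.

(** Both sides of [marginal_prekopa_leindler] equal [1] at [s = l = 0]. Bounding the left below by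
    [1 + s H] and the right above by [1 + l I + l^2 C] lets the first-order terms be compared in the
    limit. *)
Lemma marginal_log_sobolev :
  alphaY * \int[piY]_y (k y * ln (k y)) <= sigma * \int[piY]_y (k y * kappa y).
Proof.
have sg0 : 0 < sigma by exact: sigma_gt0.
have L0 : 0 <= L.
  rewrite /L !mulr_ge0 ?expR_ge0// ?invr_ge0; exact: ltW.
pose C := D ^+ 2 * expR D.
have C0 : 0 <= C by rewrite mulr_ge0 ?sqr_ge0 ?expR_ge0.
apply: (@small_parameter_limit _ _ _ L _ _ C) => // s l s01 /andP[l0 l1] ls.
have /andP[s0 s1] := s01.
have t0 : 0 < 1 - s by rewrite subr_gt0.
set H := \int[piY]_y (k y * ln (k y)); set I := \int[piY]_y (k y * kappa y).
have mk := measurable_kden; have mkap := measurable_kappa.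
pose p := (1 - s)^-1.
have ikp : rintegrable piY (fun y => k y `^ p).
  apply: (ibd _ (M `^ p)); first exact: (measurableT_comp (measurable_powR p) mk).
  move=> y; rewrite ger0_norm ?powR_ge0//.
  by apply: ge0_ler_powR => //; rewrite ?nnegrE ?invr_ge0 ltW.
have ike : rintegrable piY (fun y => k y * expR (l * kappa y)).
  apply: (ikM _ (expR D)).
    by apply: measurableT_comp => //; exact: measurable_funM.
  move=> y; rewrite ger0_norm ?expR_ge0// ler_expR.
  by apply: le_trans (kapD y); rewrite ler_piMl.
have := marginal_prekopa_leindler s l s01 l0 ls.
rewrite -(EFin_Rintegral _ _ ikp) -(EFin_Rintegral _ _ ike) poweR_EFin lee_fin => PL.
(* Jensen's inequality under the probability with density [k]: the mean of [exp ((p - 1) ln k)] is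
   at least [exp ((p - 1) H)], and [(p - 1) (1 - s) = s]. *)
have lower : expR (s * H) <= (\int[piY]_y (k y `^ p)) `^ (1 - s).
  have -> : s * H = ((p - 1) * H) * (1 - s).
    by rewrite /p; field; exact: lt0r_neq0.
  rewrite expRM; apply: ge0_ler_powR; rewrite ?nnegrE ?expR_ge0 ?(ltW t0)//.
    by apply: Rintegral_ge0 => y _; exact: powR_ge0.
  set m := (p - 1) * H.
  have -> : expR m = \int[piY]_y (expR m * (1 - m) * k y + expR m * (p - 1) * (k y * ln (k y))).
    have ikl := rintegrable_kden_ln.
    rewrite (RintegralD measurableT (rintegrableZ _ _ _ ik) (rintegrableZ _ _ _ ikl)).
    rewrite (RintegralZl _ measurableT ik) (RintegralZl _ measurableT ikl) k1 -/H /m.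
    by ring.
  apply: le_Rintegral => //.
    apply: rintegrableD; apply: rintegrableZ => //; exact: rintegrable_kden_ln.
  move=> y _.
  have -> : k y `^ p = k y * (expR m * expR ((p - 1) * ln (k y) - m)).
    rewrite -[k y]lnK ?posrE// expRK; move: (ln (k y)) => u.
    by rewrite -expRM -!expRD; congr expR; ring.
  have w0 : 0 <= k y * expR m by rewrite mulr_ge0 ?expR_ge0// ltW.
  have := ler_wpM2l w0 (expR_ge1Dx ((p - 1) * ln (k y) - m)).
  by move: (k y) (ln _) (expR _) (expR m) => a b c e; lra.
have upper : \int[piY]_y (k y * expR (l * kappa y)) <= 1 + (l * I + l ^+ 2 * C).
  have -> : 1 + (l * I + l ^+ 2 * C) =
     \int[piY]_y ((1 + l ^+ 2 * C) * k y + l * (k y * kappa y)).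
    have ikk := rintegrable_kden_kappa.
    rewrite (RintegralD measurableT (rintegrableZ _ _ _ ik) (rintegrableZ _ _ _ ikk)).
    rewrite (RintegralZl _ measurableT ik) (RintegralZl _ measurableT ikk) k1 -/I.
    by ring.
  apply: le_Rintegral => //.
    apply: rintegrableD; apply: rintegrableZ => //; exact: rintegrable_kden_kappa.
  move=> y _; have := expR_quad (l * kappa y).
  have lk0 : 0 <= l * kappa y by rewrite mulr_ge0// ltW.
  rewrite ger0_norm// => q.
  have q2 : (l * kappa y) ^+ 2 * expR (l * kappa y) <= l ^+ 2 * C.
    rewrite exprMn -mulrA ler_wpM2l ?sqr_ge0// /C; apply: ler_pM; rewrite ?sqr_ge0 ?expR_ge0//.
      by rewrite ler_sqr ?nnegrE.
    by rewrite ler_expR; apply: le_trans (kapD y); rewrite ler_piMl.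
  have := ler_wpM2l (ltW (k_gt0 y)) (le_trans q (lerD (lexx _) q2)).
  by move: (k y) (kappa y) (expR _) => a b c; lra.
have := le_trans (expR_ge1Dx (s * H)) (le_trans lower (le_trans PL upper)).
by rewrite lerD2l.
Qed.

End contraction_bounded.

Lemma Rintegral_prob_cst {d} {T : measurableType d} {R : realType} (P : probability T R) (c : R) :
  \int[P]_x c = c.
Proof.
rewrite /Rintegral (eq_integral (cst c%:E))// integral_cst//.
by rewrite [X in (_ * X)%E]probability_setT mule1.
Qed.

(** * The function [z ln z] *)

Section xlnx.
Context {R : realType}.
Implicit Types z a b u : R.

Lemma xlnx_tangent z b : 0 <= z -> 0 < b -> z * ln b + z - b <= z * ln z.
Proof.
rewrite le_eqVlt => /predU1P[<-|z0] b0; first by rewrite !mul0r; lra.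
by have := young_ln z (ln b) z0; rewrite lnK ?posrE//; lra.
Qed.

Lemma xlnx_ge z : 0 <= z -> - 1 <= z * ln z.
Proof. by move=> z0; have := xlnx_tangent z 1 z0 ltr01; rewrite ln1; lra. Qed.

(** Jensen's inequality between [u] and [1], where [z ln z] vanishes, through the tangent line at
    the mixture. *)
Lemma xlnx_mix (dl : R) u : 0 < dl <= 1 -> 0 <= u ->
  ((1 - dl) * u + dl) * ln ((1 - dl) * u + dl) <= (1 - dl) * (u * ln u).
Proof.
move=> /andP[d0 d1] u0.
have d1' : 0 <= 1 - dl by rewrite subr_ge0.
set z := (1 - dl) * u + dl; have z0 : 0 < z by rewrite ltr_wpDl// mulr_ge0.
have h1 := ler_wpM2l d1' (xlnx_tangent u z u0 z0).
have h2 := ler_wpM2l (ltW d0) (xlnx_tangent 1 z ler01 z0).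
rewrite ln1 in h2.
have e : (1 - dl) * u = z - dl by rewrite /z addrK.
have e1 : z * ln z = (1 - dl) * (u * ln z) + dl * ln z by rewrite mulrA e; ring.
rewrite e1; move: h1 h2 e; move: (ln z) (ln u) => a b; lra.
Qed.

Lemma xlnx_min u a : 1 <= a -> 0 <= u -> Num.min u a * ln (Num.min u a) <= u * ln u.
Proof.
move=> a1 u0; have [ua|au] := leP u a; first by [].
have a0 : 0 < a by exact: lt_le_trans a1.
apply: ler_pM; rewrite ?(ltW a0) ?(ltW au) ?ln_ge0// ler_ln ?posrE ?(ltW au)//.
exact: lt_trans au.
Qed.

End xlnx.

(** * Contraction for general densities *)

Section contraction.
Context {R : realType} {d : nat}.
Variable lam : {sigma_finite_measure set (d.-tuple R) -> \bar R}.
Hypothesis hlam : is_lebesgue lam.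
Variables (eta alpha_f alpha_g : R) (f g : d.-tuple R -> R).
Hypotheses (eta0 : 0 < eta) (alpha_f0 : 0 < alpha_f) (alpha_g0 : 0 < alpha_g).
Hypotheses (hf : strongly_convex alpha_f f) (hg : strongly_convex alpha_g g).
Variable K : R.-pker (d.-tuple R) ~> (d.-tuple R).
Hypothesis hK : forall y, exists c : R, 0 < c /\ forall B, measurable B ->
  K y B = (c%:E * \int[lam]_(x in B) (expR (- f x - sqdist x y / (2 * eta)))%:E)%E.
Variables piX piY : probability (d.-tuple R) R.
Hypothesis hpiY : exists c : R, 0 < c /\ forall B, measurable B ->
  piY B = (c%:E * \int[lam]_(y in B) (expR (- g y) * partition_fun lam eta f y)%:E)%E.
Hypothesis disint : forall psi : d.-tuple R -> \bar R, measurable_fun setT psi ->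
  (forall x, 0 <= psi x)%E -> (\int[piX]_x psi x = \int[piY]_y \int[K y]_x psi x)%E.

Definition rho2 : R := ((1 + eta * alpha_f) * (1 + eta * alpha_g))^-1.

Let piXfin : (piX setT < +oo)%E. Proof. by rewrite probability_setT ltry. Qed.
Let piYfin : (piY setT < +oo)%E. Proof. by rewrite probability_setT ltry. Qed.
Let Kfin y : (K y setT < +oo)%E. Proof. by rewrite prob_kernel ltry. Qed.

Let rhoE : rho2 = sigma eta alpha_f / (alphaY eta alpha_f alpha_g + sigma eta alpha_f).
Proof.
rewrite /alphaY -(gamma_sigma eta alpha_f eta0 alpha_f0) -addrA subrKC.
rewrite (gamma_sigma eta alpha_f eta0 alpha_f0) /rho2 /sigma.
have h1 : 0 < 1 + eta * alpha_f by rewrite addr_gt0// mulr_gt0.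
have h2 : 0 < 1 + eta * alpha_g by rewrite addr_gt0// mulr_gt0.
have -> : alpha_g + eta^-1 = (1 + eta * alpha_g) / eta.
  by field; exact: lt0r_neq0.
by field; rewrite !lt0r_neq0.
Qed.

Lemma rho2_ge0 : 0 <= rho2.
Proof.
rewrite invr_ge0; apply: mulr_ge0; apply: addr_ge0 => //; apply: mulr_ge0; exact: ltW.
Qed.

Lemma rho2_le1 : rho2 <= 1.
Proof.
have h1 : 0 < eta * alpha_f by exact: mulr_gt0.
have h2 : 0 < eta * alpha_g by exact: mulr_gt0.
rewrite invf_le1; first by nra.
by nra.
Qed.

Lemma disint_bounded (phi : d.-tuple R -> R) B : measurable_fun setT phi ->
  (forall x, `|phi x| <= B) -> \int[piX]_x phi x = \int[piY]_y \int[K y]_x phi x.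
Proof.
move=> mphi hB.
have p0 x : 0 <= phi x + B by have := hB x; rewrite ler_norml => /andP[h _]; lra.
have mp : measurable_fun setT (fun x => phi x + B) by exact: measurable_funD.
have mE : measurable_fun setT (fun x => (phi x + B)%:E) by exact/measurable_EFinP.
have iX : rintegrable piX phi by exact: (rintegrable_bounded _ _ B).
have iK y : rintegrable (K y) phi by exact: (rintegrable_bounded _ _ B).
have cX (c : R) : rintegrable piX (cst c) by exact: (rintegrable_bounded _ _ `|c|).
have cY (c : R) : rintegrable piY (cst c) by exact: (rintegrable_bounded _ _ `|c|).
have IX : \int[piX]_x (phi x + B) = \int[piX]_x phi x + B.
  by rewrite (RintegralD measurableT iX (cX B)) Rintegral_prob_cst.
have IK y : \int[K y]_x (phi x + B) = \int[K y]_x phi x + B.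
  by rewrite (RintegralD measurableT (iK y) (rintegrable_cst K y B)) Rintegral_cst1.
have mK : measurable_fun setT (fun y => \int[K y]_x (phi x + B)).
  apply: measurableT_comp => //; apply: measurable_fun_integral_kernel => //.
  exact: measurable_kernel.
have iKB : rintegrable piY (fun y => \int[K y]_x (phi x + B)).
  apply: (rintegrable_bounded _ _ (B + B)) => // y.
  rewrite ger0_norm; last by apply: Rintegral_ge0 => x _.
  rewrite -(Rintegral_cst1 K y (B + B)); apply: le_Rintegral => //.
  - by apply: rintegrableD => //; exact: rintegrable_cst.
  - exact: rintegrable_cst.
  - by move=> x _; have := hB x; rewrite ler_norml => /andP[_ h]; lra.
have iKphi : rintegrable piY (fun y => \int[K y]_x phi x).
  have -> : (fun y => \int[K y]_x phi x) = (fun y => \int[K y]_x (phi x + B) - B).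
    by apply/funext => y; rewrite IK addrK.
  exact: (rintegrableB _ _ _ iKB (cY B)).
have : \int[piX]_x (phi x + B) = \int[piY]_y \int[K y]_x (phi x + B).
  rewrite {1}/Rintegral disint//.
  congr fine; apply: eq_integral => y _.
  by rewrite (EFin_Rintegral (K y)) //; apply: rintegrableD => //; exact: rintegrable_cst.
rewrite IX (_ : \int[piY]_y _ = \int[piY]_y (\int[K y]_x phi x + B)); last first.
  by apply: eq_Rintegral => y _; exact: IK.
rewrite (RintegralD measurableT iKphi (cY B)) Rintegral_prob_cst.
exact: addIr.
Qed.

Lemma contraction_normalized (h : d.-tuple R -> R) (eps M : R) :
  measurable_fun setT h -> 0 < eps -> (forall x, eps <= h x <= M) ->
  \int[piX]_x h x = 1 ->
  \int[piY]_y (kden K h y * ln (kden K h y)) <= rho2 * \int[piX]_x (h x * ln (h x)).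
Proof.
move=> mh eps0 hbd h1.
have hM x : `|h x| <= M.
  case/andP: (hbd x) => a b; rewrite ger0_norm//; exact: le_trans (ltW eps0) a.
have k1 : \int[piY]_y kden K h y = 1 by rewrite -h1 (disint_bounded h M mh hM).
have := marginal_log_sobolev lam hlam eta alpha_f alpha_g f g eta0 alpha_f0 alpha_g0 hf hg
  K hK piY hpiY h eps M mh eps0 hbd k1.
set H := \int[piY]_y _; set I := \int[piY]_y _; set E := \int[piX]_x _.
have mhl : measurable_fun setT (fun x => h x * ln (h x)).
  by apply: measurable_funM => //; exact: measurableT_comp.
have hl x : `|h x * ln (h x)| <= M * (`|ln eps| + `|ln M|).
  rewrite normrM; apply: ler_pM => //; exact: (abs_ln_density h eps M eps0 hbd).
have EE : E = \int[piY]_y kent K h y by rewrite /E (disint_bounded _ _ mhl hl).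
have k0 y : 0 < kden K h y by exact: (kden_gt0 K h eps M mh eps0 hbd).
have IE : I = E - H.
  have i1 := rintegrable_kden_kappa K piY h eps M mh eps0 hbd.
  have i2 := rintegrable_kden_ln K piY h eps M mh eps0 hbd.
  rewrite EE -[LHS](addrK H); congr (_ - _).
  rewrite /I /H -(RintegralD measurableT i1 i2); apply: eq_Rintegral => y _.
  rewrite /kappa; move: (kent K h y) (kden K h y) (k0 y) => a b b0.
  by field; exact: lt0r_neq0.
rewrite IE rhoE => hh.
have s0 := sigma_gt0 eta alpha_f eta0 alpha_f0.
have aY0 : 0 < alphaY eta alpha_f alpha_g.
  apply: addr_gt0 => //; apply: divr_gt0 => //.
  by apply: addr_gt0 => //; exact: mulr_gt0.
rewrite mulrAC (ler_pdivlMr _ _ (addr_gt0 aY0 s0)).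
by move: hh; move: (alphaY _ _ _) (sigma _ _) => a b; lra.
Qed.

(** Truncated densities may have mass [m < 1]. Rescaling by [1 / m] adds [- ln m] to both entropies,
    but the one on the right is multiplied by [rho2]; as [rho2 <= 1] and [ln m <= 0], the mismatch
    has the favourable sign. *)
Lemma contraction_homogeneous (h : d.-tuple R -> R) (eps M : R) :
  measurable_fun setT h -> 0 < eps -> (forall x, eps <= h x <= M) ->
  \int[piX]_x h x <= 1 ->
  \int[piY]_y (kden K h y * ln (kden K h y)) <= rho2 * \int[piX]_x (h x * ln (h x)).
Proof.
move=> mh eps0 hbd; set m := \int[piX]_x h x => m1.
have hM x : `|h x| <= M.
  case/andP: (hbd x) => a b; rewrite ger0_norm//; exact: le_trans (ltW eps0) a.
have h0 x : 0 < h x by case/andP: (hbd x) => a _; exact: lt_le_trans a.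
have ih : rintegrable piX h by exact: (rintegrable_bounded _ _ M).
have m0 : 0 < m.
  apply: (lt_le_trans eps0); rewrite (_ : eps = \int[piX]_x eps); last first.
    by rewrite Rintegral_prob_cst.
  apply: le_Rintegral => //; first exact: (rintegrable_bounded _ _ `|eps|).
  by move=> x _; case/andP: (hbd x).
have mhl : measurable_fun setT (fun x => h x * ln (h x)).
  by apply: measurable_funM => //; exact: measurableT_comp.
have hl x : `|h x * ln (h x)| <= M * (`|ln eps| + `|ln M|).
  rewrite normrM; apply: ler_pM => //; exact: (abs_ln_density h eps M eps0 hbd).
have ihl : rintegrable piX (fun x => h x * ln (h x)) by exact: (rintegrable_bounded _ _ _ piXfin mhl hl).
have k0 y : 0 < kden K h y by exact: (kden_gt0 K h eps M mh eps0 hbd).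
have iK y : rintegrable (K y) h by exact: (rintegrable_density K h eps M mh eps0 hbd).
have ikl := rintegrable_kden_ln K piY h eps M mh eps0 hbd.
have ik : rintegrable piY (kden K h).
  apply: (rintegrable_bounded _ _ M) => //; first exact: (measurable_kden K h eps M mh eps0 hbd).
  by move=> y; rewrite gtr0_norm//; case/andP: (kden_bounds K h eps M mh eps0 hbd y).
pose h' x := m^-1 * h x.
have mi : 0 < m^-1 by rewrite invr_gt0.
have h'bd x : m^-1 * eps <= h' x <= m^-1 * M by rewrite /h' !ler_pM2l.
have h'1 : \int[piX]_x h' x = 1.
  by rewrite (RintegralZl _ measurableT ih) -/m mulVf// lt0r_neq0.
have mh' : measurable_fun setT h' by exact: measurable_funM.
have kE y : kden K h' y = m^-1 * kden K h y by exact: (RintegralZl _ measurableT (iK y)).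
have := contraction_normalized h' (m^-1 * eps) (m^-1 * M) mh' (mulr_gt0 mi eps0) h'bd h'1.
have xl z : 0 < z -> m^-1 * z * ln (m^-1 * z) = m^-1 * (z * ln z) + m^-1 * - ln m * z.
  by move=> z0; rewrite lnM ?posrE// lnV ?posrE//; ring.
have -> : \int[piX]_x (h' x * ln (h' x)) = m^-1 * \int[piX]_x (h x * ln (h x)) - ln m.
  transitivity (\int[piX]_x (m^-1 * (h x * ln (h x)) + m^-1 * - ln m * h x)).
    by apply: eq_Rintegral => x _; rewrite /h' xl.
  rewrite (RintegralD measurableT (rintegrableZ _ _ _ ihl) (rintegrableZ _ _ _ ih)).
  rewrite (RintegralZl _ measurableT ihl) (RintegralZl _ measurableT ih) -/m.
  by rewrite mulrAC mulVf ?lt0r_neq0// mul1r.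
have -> : \int[piY]_y (kden K h' y * ln (kden K h' y)) =
    m^-1 * \int[piY]_y (kden K h y * ln (kden K h y)) - ln m.
  transitivity (\int[piY]_y (m^-1 * (kden K h y * ln (kden K h y)) + m^-1 * - ln m * kden K h y)).
    by apply: eq_Rintegral => y _; rewrite kE xl.
  rewrite (RintegralD measurableT (rintegrableZ _ _ _ ikl) (rintegrableZ _ _ _ ik)).
  rewrite (RintegralZl _ measurableT ikl) (RintegralZl _ measurableT ik).
  rewrite (_ : \int[piY]_y kden K h y = m); last by rewrite /m (disint_bounded h M mh hM).
  by rewrite mulrAC mulVf ?lt0r_neq0// mul1r.
move: (\int[piY]_y _) (\int[piX]_x _) => A B hh.
have lm : ln m <= 0 by exact: ln_le0.
have r1 := rho2_le1.
have : m^-1 * A <= m^-1 * (rho2 * B).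
  have : (1 - rho2) * ln m <= 0 by rewrite mulr_ge0_le0// subr_ge0.
  by move: hh; move: (m^-1 * A); rewrite mulrCA; move: (m^-1 * B) => p q; lra.
by rewrite ler_pM2l.
Qed.

(** * Truncation *)

Section truncation.
Variable h : d.-tuple R -> R.
Hypotheses (mh : measurable_fun setT h) (h0 : forall x, 0 <= h x).

Let a (n : nat) : R := n.+1%:R.
(** The inverse square of the truncation level: [dl n * ln (dl n)] is then at most [2 / a n] in
    absolute value. *)
Let dl (n : nat) : R := (a n)^-1 * (a n)^-1.
Let tr (n : nat) x : R := Num.min (h x) (a n).
(** Mixing with the constant [1], instead of taking a maximum with [dl n], keeps the mass at most
    [1] and controls the entropy by Jensen's inequality. *)
Let hn (n : nat) x : R := (1 - dl n) * tr n x + dl n.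

Let a_ge1 n : 1 <= a n. Proof. by rewrite /a ler1n. Qed.
Let a_gt0 n : 0 < a n. Proof. exact: lt_le_trans (a_ge1 n). Qed.
Let dl_gt0 n : 0 < dl n. Proof. by rewrite mulr_gt0 ?invr_gt0. Qed.
Let dl_le1 n : dl n <= 1.
Proof. by rewrite mulr_ile1// ?invr_ge0 ?(ltW (a_gt0 n))// invf_le1. Qed.
Let dl_cvg : dl n @[n --> \oo] --> (0 : R).
Proof.
rewrite -[X in _ --> X](mulr0 (0 : R)).
by apply: cvgM; exact: cvg_harmonic.
Qed.

Let tr_ge0 n x : 0 <= tr n x. Proof. by rewrite /tr le_min h0 ltW. Qed.
Let tr_le n x : tr n x <= a n. Proof. by rewrite /tr ge_min lexx orbT. Qed.
Let tr_leh n x : tr n x <= h x. Proof. by rewrite /tr ge_min lexx. Qed.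
Let mtr n : measurable_fun setT (tr n). Proof. exact: measurable_minr. Qed.
Let itr (mu : {measure set (d.-tuple R) -> \bar R}) n : (mu setT < +oo)%E -> rintegrable mu (tr n).
Proof. by move=> fin; apply: (rintegrable_bounded _ _ (a n)) => // x; rewrite ger0_norm. Qed.
Let mhn n : measurable_fun setT (hn n).
Proof. by apply: measurable_funD => //; apply: measurable_funM. Qed.
Let hn_bd n x : dl n <= hn n x <= a n + 1.
Proof.
have h1 : 0 <= (1 - dl n) * tr n x by rewrite mulr_ge0// subr_ge0.
have h2 : (1 - dl n) * tr n x <= a n.
  apply: le_trans (tr_le n x); rewrite ler_piMl// gerBl; exact: ltW.
by have := dl_le1 n; rewrite /hn => h3; apply/andP; split; lra.
Qed.

Lemma kden_truncation n y : kden K (hn n) y = (1 - dl n) * \int[K y]_x tr n x + dl n.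
Proof.
have i1 := itr (K y) n (Kfin y).
rewrite /kden /hn (RintegralD measurableT (rintegrableZ _ _ _ i1) (rintegrable_cst K y (dl n))).
by rewrite (RintegralZl _ measurableT i1) Rintegral_cst1.
Qed.

(** The average may be infinite on a [piY]-null set, since [h] is only [piX]-integrable; [kk] is its
    real-valued version. *)
Let kinf y : \bar R := (\int[K y]_x (h x)%:E)%E.
Let kk y : R := fine (kinf y).

Let mhE : measurable_fun setT (EFin \o h). Proof. exact/measurable_EFinP. Qed.
Let kinf_ge0 y : (0 <= kinf y)%E.
Proof. by apply: integral_ge0 => x _; rewrite lee_fin. Qed.
Let mkinf : measurable_fun setT kinf.
Proof.
apply: measurable_fun_integral_kernel => //; first exact: measurable_kernel.
Qed.

Lemma truncation_cvg y : kinf y \is a fin_num ->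
  \int[K y]_x tr n x @[n --> \oo] --> kk y.
Proof.
move=> fin.
have mE n : measurable_fun setT (EFin \o tr n) by exact/measurable_EFinP.
have nd x : {homo (fun n => (tr n x)%:E) : n m / (n <= m)%N >-> (n <= m)%E}.
  move=> n m nm; rewrite lee_fin /tr le_min !ge_min lexx/=; apply/orP; right.
  by rewrite /a ler_nat ltnS.
have lim x : limn (fun n => (tr n x)%:E) = (h x)%:E.
  apply/cvg_lim => //; apply: (@cvg_near_cst _ _ _ _ _ _).
  near=> n; congr (_%:E); rewrite /tr min_l//.
  have : h x <= n%:R by near: n; exact: nbhs_infty_ger.
  by move=> /le_trans; apply; rewrite /a ler_nat.
have := @cvg_monotone_convergence _ _ _ (K y) setT measurableT (fun n x => (tr n x)%:E) mE
  (fun n x _ => tr_ge0 n x) (fun x _ => nd x).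
under eq_integral do rewrite lim.
have -> : (\int[K y]_x (h x)%:E)%E = (kk y)%:E by rewrite fineK.
under eq_cvg do rewrite -(EFin_Rintegral (K y) _ (itr (K y) _ (Kfin y))).
by move/fine_cvg.
Unshelve. all: by end_near. Qed.

Lemma truncation_xlnx_cvg y : kinf y \is a fin_num ->
  kden K (hn n) y * ln (kden K (hn n) y) @[n --> \oo] --> kk y * ln (kk y).
Proof.
move=> fin; have U := truncation_cvg y fin.
have kk0 : 0 <= kk y by rewrite fine_ge0.
have [kk00|kkn0] := eqVneq (kk y) 0.
  have U0 n : \int[K y]_x tr n x = 0.
    apply/eqP; rewrite eq_le; apply/andP; split; last by apply: Rintegral_ge0 => x _.
    rewrite -kk00 /kk /kinf; apply: fine_le => //.
      exact: (integrable_fin_num measurableT (itr (K y) n (Kfin y))).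
    apply: ge0_le_integral => //.
    - by move=> x _; rewrite lee_fin.
    - exact/measurable_EFinP.
    - by move=> x _; rewrite lee_fin.
  rewrite kk00 mul0r.
  under eq_cvg do rewrite kden_truncation U0 mulr0 add0r.
  have c1 : - 2 * (a n)^-1 @[n --> \oo] --> (0 : R).
    rewrite -[X in _ --> X](mulr0 (- 2 : R)); apply: cvgM; first exact: cvg_cst.
    exact: cvg_harmonic.
  have c2 : (0 : R) @[n --> \oo] --> (0 : R) by exact: cvg_cst.
  apply: (squeeze_cvgr _ c1 c2); near=> n; apply/andP; split; last first.
    by rewrite mulr_ge0_le0 ?(ltW (dl_gt0 n))// ln_le0.
  rewrite {2}/dl lnM ?posrE ?invr_gt0// lnV ?posrE//.
  have h1 : ln (a n) <= a n by exact/ltW/ln_sublinear.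
  have h2 : dl n * ln (a n) <= (a n)^-1.
    have := ler_wpM2l (ltW (dl_gt0 n)) h1 => /le_trans; apply.
    by rewrite /dl mulfVK ?lt0r_neq0.
  by move: h2; move: (dl n) (ln _) (a n)^-1 => *; lra.
have kkp : 0 < kk y by rewrite lt0r kkn0.
have c : kden K (hn n) y @[n --> \oo] --> kk y.
  rewrite (_ : (fun n => kden K (hn n) y) =
    (fun n => (1 - dl n) * \int[K y]_x tr n x + dl n)); last first.
    by apply/funext => n; exact: kden_truncation.
  rewrite -[X in _ --> X]addr0; apply: cvgD; last exact: dl_cvg.
  rewrite -[X in _ --> X]mul1r; apply: cvgM => //.
  rewrite -[X in _ --> X](subr0 (1 : R)); apply: cvgB; [exact: cvg_cst|exact: dl_cvg].
apply: cvgM => //.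
exact: (continuous_cvg _ (continuous_ln kkp) c).
Unshelve. all: by end_near. Qed.

Hypothesis h1 : (\int[piX]_x (h x)%:E = 1)%E.
Hypothesis ihl : rintegrable piX (fun x => h x * ln (h x)).

Let kinf_ae : {ae piY, forall y, kinf y \is a fin_num}.
Proof.
have : piY.-integrable setT kinf.
  apply/integrableP; split => //.
  rewrite (eq_integral kinf); last by move=> y _; rewrite gee0_abs.
  by rewrite -disint// ?h1 ?ltry// => x; rewrite lee_fin.
by move/(integrable_ae measurableT); apply: filterS => y; exact.
Qed.

(** Truncation at a level at least [1] does not increase [z ln z], and mixing multiplies its bound
    by [1 - dl n]. As [z ln z >= - 1], dropping this factor costs at most [dl n]. *)
Lemma truncation_entropy n :
  \int[piY]_y (kden K (hn n) y * ln (kden K (hn n) y)) <=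
  rho2 * \int[piX]_x (h x * ln (h x)) + dl n.
Proof.
have ih : rintegrable piX h by apply: rintegrable_ge0 => //; rewrite h1 ltry.
have cX (c : R) : rintegrable piX (cst c) by exact: (rintegrable_bounded _ _ `|c|).
have Ih : \int[piX]_x h x = 1 by rewrite /Rintegral h1.
have d1' : 0 <= 1 - dl n by rewrite subr_ge0.
have ihn : rintegrable piX (hn n).
  apply: rintegrableD; last exact: cX.
  by apply: rintegrableZ; exact: itr.
have hn1 : \int[piX]_x hn n x <= 1.
  have -> : 1 = \int[piX]_x ((1 - dl n) * h x + dl n).
    rewrite (RintegralD measurableT (rintegrableZ _ _ _ ih) (cX _)) Rintegral_prob_cst.
    by rewrite (RintegralZl _ measurableT ih) Ih mulr1 subrK.
  apply: le_Rintegral => //; first by apply: rintegrableD; [exact: rintegrableZ|exact: cX].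
  by move=> x _; rewrite lerD2r ler_wpM2l.
apply: le_trans (contraction_homogeneous (hn n) (dl n) (a n + 1) (mhn n) (dl_gt0 n) (hn_bd n) hn1) _.
apply: (@le_trans _ _ (rho2 * (\int[piX]_x (h x * ln (h x)) + dl n))); last first.
  by rewrite mulrDr lerD2l ler_piMl ?(ltW (dl_gt0 n))// rho2_le1.
rewrite ler_wpM2l ?rho2_ge0//.
have -> : \int[piX]_x (h x * ln (h x)) + dl n = \int[piX]_x (h x * ln (h x) + dl n).
  by rewrite (RintegralD measurableT ihl (cX _)) Rintegral_prob_cst.
apply: le_Rintegral => //.
- have hn0 x : 0 <= hn n x by case/andP: (hn_bd n x) => + _; exact: le_trans (ltW (dl_gt0 n)).
  apply: (rintegrable_bounded _ _ ((a n + 1) * (`|ln (dl n)| + `|ln (a n + 1)|))) => //.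
    by apply: measurable_funM => //; exact: measurableT_comp.
  move=> x; rewrite normrM; apply: ler_pM => //.
    by rewrite ger0_norm//; case/andP: (hn_bd n x).
  exact: (abs_ln_density (hn n) (dl n) (a n + 1) (dl_gt0 n) (hn_bd n)).
- by apply: rintegrableD => //; exact: cX.
move=> x _.
have d01 : 0 < dl n <= 1 by rewrite dl_gt0 dl_le1.
have q1 := xlnx_mix (dl n) (tr n x) d01 (tr_ge0 n x).
have q2 := ler_wpM2l d1' (xlnx_min (h x) (a n) (a_ge1 n) (h0 x)).
apply: (le_trans q1); apply: (le_trans q2).
have := ler_wpM2l (ltW (dl_gt0 n)) (xlnx_ge (h x) (h0 x)).
by move: (h x * _) (dl n) => *; lra.
Qed.

Lemma contraction_density : [/\ measurable_fun setT kk, (forall y, 0 <= kk y),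
  (forall B, measurable B -> \int[piY]_(y in B) (kk y)%:E = \int[piY]_(y in B) kinf y)%E,
  rintegrable piY (fun y => kk y * ln (kk y)) &
  \int[piY]_y (kk y * ln (kk y)) <= rho2 * \int[piX]_x (h x * ln (h x))].
Proof.
have mkk : measurable_fun setT kk by exact: measurableT_comp.
have kk0 y : 0 <= kk y by rewrite fine_ge0.
have mkkl : measurable_fun setT (fun y => kk y * ln (kk y)).
  by apply: measurable_funM => //; exact: measurableT_comp.
set E := rho2 * \int[piX]_x (h x * ln (h x)).
(* Since [z ln z >= - 1], adding [1] makes the integrands nonnegative, as Fatou's lemma requires. *)
have bound : (\int[piY]_y (kk y * ln (kk y) + 1)%:E <= (E + 1)%:E)%E.
  have [N [mN N0 subN]] := kinf_ae.
  have finN y : (~` N) y -> kinf y \is a fin_num by move=> Ny; apply: contrapT => hy; apply: Ny; exact: subN.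
  have kn0 n y : 0 <= kden K (hn n) y by apply/ltW/(kden_gt0 K (hn n) (dl n) (a n + 1)).
  pose F n y : \bar R := (kden K (hn n) y * ln (kden K (hn n) y) + 1)%:E.
  have F0 n y : (0 <= F n y)%E by rewrite lee_fin; have := xlnx_ge _ (kn0 n y); lra.
  have mF n : measurable_fun setT (F n).
    have mk := measurable_kden K (hn n) (dl n) (a n + 1) (mhn n) (dl_gt0 n) (hn_bd n).
    apply/measurable_EFinP; apply: measurable_funD => //; apply: measurable_funM => //.
    exact: measurableT_comp.
  have ikl n := rintegrable_kden_ln K piY (hn n) (dl n) (a n + 1) (mhn n) (dl_gt0 n) (hn_bd n).
  have IF n : (\int[piY]_y F n y <= (E + 1 + dl n)%:E)%E.
    have i1 : rintegrable piY (cst 1) by exact: (rintegrable_bounded _ _ `|1|).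
    have := rintegrableD _ _ _ (ikl n) i1 => i2.
    rewrite -[leLHS](EFin_Rintegral _ _ i2) lee_fin.
    rewrite (RintegralD measurableT (ikl n) i1) Rintegral_prob_cst.
    by have := truncation_entropy n; rewrite -/E; lra.
  rewrite (ge0_negligible_integral mN measurableT _ _ N0)//; last 2 first.
  - by apply/measurable_EFinP; exact: measurable_funD.
  - by move=> y _; rewrite lee_fin; have := xlnx_ge _ (kk0 y); lra.
  rewrite setTD.
  have mCN : measurable (~` N) by exact: measurableC.
  have := fatou piY mCN (fun n => measurable_funTS (mF n)) (fun n y _ => F0 n y).
  have -> : (\int[piY]_(y in ~` N) limn_einf (F^~ y) =
      \int[piY]_(y in ~` N) (kk y * ln (kk y) + 1)%:E)%E.
    apply: eq_integral => y; rewrite inE => Ny.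
    have c : (F n y @[n --> \oo] --> (kk y * ln (kk y) + 1)%:E)%E.
      apply: cvg_EFin; first by near=> n.
      apply: cvgD; last exact: cvg_cst.
      exact: truncation_xlnx_cvg (finN y Ny).
    by rewrite (cvg_limn_einf_sup c).1.
  move=> /le_trans; apply.
  have c : ((E + 1 + dl n)%:E @[n --> \oo] --> (E + 1)%:E)%E.
    apply: cvg_EFin; first by near=> n.
    rewrite -[X in _ --> X](addr0 (E + 1)); apply: cvgD; [exact: cvg_cst|exact: dl_cvg].
  rewrite -(cvg_limn_einf_sup c).1 !limn_einf_lim.
  apply: lee_lim; [exact: is_cvg_einfs|exact: is_cvg_einfs|].
  near=> n; apply: le_ereal_inf_tmp => _ [m /= nm <-].
  apply: (@le_trans _ _ (\int[piY]_(y in ~` N) F m y)%E).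
    by apply: ereal_inf_lbound; exists m.
  apply: le_trans (IF m); apply: ge0_subset_integral => //.
have ikl1 : rintegrable piY (fun y => kk y * ln (kk y) + 1).
  apply: rintegrable_ge0; first exact: measurable_funD.
    by move=> y; have := xlnx_ge _ (kk0 y); lra.
  exact: le_lt_trans bound (ltry _).
have i1 : rintegrable piY (cst 1) by exact: (rintegrable_bounded _ _ `|1|).
have ikl : rintegrable piY (fun y => kk y * ln (kk y)).
  have := rintegrableB _ _ _ ikl1 i1.
  by rewrite (_ : (fun x => _ - _) = (fun y => kk y * ln (kk y)))//; apply/funext => y /=; rewrite addrK.
split => //.
- move=> B mB; apply: ae_eq_integral => //.
  + by apply/measurable_EFinP; exact: measurable_funTS.
  + exact: measurable_funTS.
  + by move: kinf_ae; apply: filterS => y fin _; rewrite fineK.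
- move: bound; rewrite -(EFin_Rintegral _ _ ikl1) lee_fin.
  by rewrite (RintegralD measurableT ikl i1) Rintegral_prob_cst lerD2r.
Unshelve. all: by end_near. Qed.

End truncation.

End contraction.

(** * Gibbs sampler *)

(** A finite bound carried together with a density and the integrability of [h ln h], so that
    iterating the half-steps involves real numbers only. *)
Definition entropy_le {d} {T : measurableType d} {R : realType}
    (mu pi : probability T R) (e : R) : Prop :=
  exists h : T -> R, [/\ measurable_fun setT h, (forall x, 0 <= h x),
    (forall A, measurable A -> mu A = (\int[pi]_(x in A) (h x)%:E)%E),
    rintegrable pi (fun x => h x * ln (h x)) &
    \int[pi]_x (h x * ln (h x)) <= e].

(** The negative part of [h ln h] has integral at most [1], so the entropy is either finite with an
    integrable [h ln h], or [+oo]. *)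
Lemma KL_entropy_le {d} {T : measurableType d} {R : realType} (mu pi : probability T R) :
  (KL mu pi = +oo)%E \/ exists2 e : R, KL mu pi = e%:E & entropy_le mu pi e.
Proof.
have [dom|ndom] := pselect (null_dominates pi mu); last first.
  by left; rewrite /KL; case: pselect.
have [h [mh h0 hE]] := dominates_density mu pi dom.
have KLE := KL_density mu pi h mh h0 hE.
have mhl : measurable_fun setT (fun x => h x * ln (h x)).
  by apply: measurable_funM => //; exact: measurableT_comp.
have mphi : measurable_fun setT (fun x => (h x * ln (h x))%:E) by exact/measurable_EFinP.
set phi := (fun x => (h x * ln (h x))%:E) in mphi KLE.
have mp := measurable_funepos mphi; have mn := measurable_funeneg mphi.
have neg1 : (\int[pi]_x phi^\- x <= 1)%E.
  apply: (@le_trans _ _ (\int[pi]_x (cst 1%E x))%E).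
    apply: ge0_le_integral => // x _.
    rewrite funenegE ge_max lee01 andbT -EFinN lee_fin.
    by have := xlnx_ge (h x) (h0 x); lra.
  by rewrite integral_cst// mul1e; exact: probability_le1.
have negfin : (\int[pi]_x phi^\- x < +oo)%E by exact: le_lt_trans neg1 (ltry _).
have [posy|posfin] := eqVneq (\int[pi]_x phi^\+ x)%E +oo%E.
  left; rewrite KLE integralE posy addye//.
  by rewrite eqe_oppLR/= -ltey.
right.
have pos0 : (0 <= \int[pi]_x phi^\+ x)%E by exact: integral_ge0.
have neg0 : (0 <= \int[pi]_x phi^\- x)%E by exact: integral_ge0.
have ip : pi.-integrable setT (phi^\+)%E.
  apply/integrableP; split => //.
  by under eq_integral do rewrite gee0_abs//; rewrite ltey.
have iN : pi.-integrable setT (phi^\-)%E.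
  apply/integrableP; split => //.
  by under eq_integral do rewrite gee0_abs//.
have iphi : rintegrable pi (fun x => h x * ln (h x)).
  rewrite /rintegrable -/phi (_ : _ \o _ = phi)// (funeposneg phi).
  exact: (integrableB measurableT ip iN).
exists (\int[pi]_x (h x * ln (h x))); first by rewrite KLE EFin_Rintegral.
by exists h; split.
Qed.

(** Products of the exhausting sets exhaust the product. This allows densities with respect to
    [lam \x lam] to be handled by [ge0_integral_density]. *)
Lemma product_sigma_finite {d1 d2} {T1 : measurableType d1} {T2 : measurableType d2}
    {R : realType} (m1 : {sigma_finite_measure set T1 -> \bar R})
    (m2 : {sigma_finite_measure set T2 -> \bar R}) :
  exists m : {sigma_finite_measure set (T1 * T2)%type -> \bar R},
    forall A, m A = (m1 \x m2)%E A.
Proof.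
have sf : sigma_finite setT (m1 \x m2)%E.
  have /sigma_finiteP[F [FT ndF mF]] := sigma_finiteT m1.
  have /sigma_finiteP[G [GT ndG mG]] := sigma_finiteT m2.
  exists (fun n => F n `*` G n).
    apply/seteqP; split => // -[x y] _.
    have : setT x by []. rewrite FT => -[n _ Fx].
    have : setT y by []. rewrite GT => -[m _ Gy].
    exists (maxn n m) => //; split => /=.
      by move/subsetPset: (ndF _ _ (leq_maxl n m)); exact.
    by move/subsetPset: (ndG _ _ (leq_maxr n m)); exact.
  move=> n; have [mFn fFn] := mF n; have [mGn fGn] := mG n.
  split; first exact: measurableX.
  by rewrite product_measure1E// lte_mul_pinfty// ge0_fin_numE.
pose H2 := isSFinite.Build _ _ _ _ (sfinite_measure_sigma_finite sf).
pose H3 := isSigmaFinite.Build _ _ _ _ sf.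
by exists (HB.pack_for (SigmaFiniteMeasure.type (T1 * T2)%type R) (m1 \x m2)%E H2 H3).
Qed.

(** * Disintegration of the target *)

Section disintegration.
Context {R : realType} {d : nat}.
Variable lam : {sigma_finite_measure set (d.-tuple R) -> \bar R}.
Variables (eta alpha_f alpha_g : R) (f g : d.-tuple R -> R).
Hypotheses (alpha_f0 : 0 < alpha_f) (alpha_g0 : 0 < alpha_g).
Hypotheses (hf : strongly_convex alpha_f f) (hg : strongly_convex alpha_g g).
Variable K : R.-pker (d.-tuple R) ~> (d.-tuple R).
Hypothesis hK : forall x, exists c : R, 0 < c /\ forall B, measurable B ->
  K x B = (c%:E * \int[lam]_(y in B) (expR (- g y - sqdist y x / (2 * eta)))%:E)%E.
Local Notation Z := (partition_fun lam eta g).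

Lemma integral_marginal B : measurable B ->
  (\int[lam]_x \int[lam]_y
     ((\1_B x)%:E * (expR (- f x - g y - sqdist x y / (2 * eta)))%:E) =
   \int[lam]_(x in B) (expR (- f x) * Z x)%:E)%E.
Proof.
move=> mB; rewrite [RHS]integral_mkcond; apply: eq_integral => x _.
have [Z0 ZE _] := partition_funP lam eta alpha_g g alpha_g0 hg K hK x.
have mw := measurable_gibbs_weight1 eta alpha_g g alpha_g0 hg x.
transitivity (\int[lam]_y ((\1_B x * expR (- f x))%:E * (gibbs_weight eta g x y)%:E))%E.
  apply: eq_integral => y _; rewrite -!EFinM -mulrA -expRD (sqdistC y x).
  by congr (_ * expR _)%:E; ring.
rewrite ge0_integralZl//.
- rewrite ZE -EFinM patchE indicE; case: ifP => _; first by rewrite mul1r.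
  by rewrite !mul0r.
- exact/measurable_EFinP.
- by move=> y _; rewrite lee_fin expR_ge0.
Qed.

Variables (c : R) (c0 : 0 < c) (pi : probability (d.-tuple R) R).
Hypothesis hpi : forall B, measurable B ->
  pi B = (c%:E * \int[lam]_(x in B) (expR (- f x) * partition_fun lam eta g x)%:E)%E.

(** The factor [Z x] in the marginal density cancels the normalization of [K x] and leaves the joint
    weight. Exchanging [f] and [g] gives the disintegration along the other coordinate. *)
Lemma integral_disintegration (psi : d.-tuple R * d.-tuple R -> \bar R) :
  measurable_fun setT psi -> (forall z, 0 <= psi z)%E ->
  (\int[pi]_x \int[K x]_y psi (x, y) = c%:E * \int[lam]_x \int[lam]_y
     (psi (x, y) * (expR (- f x - g y - sqdist x y / (2 * eta)))%:E))%E.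
Proof.
move=> mpsi psi0.
have mZ := measurable_partition_fun lam eta alpha_g g alpha_g0 hg.
have Z0 x : 0 < Z x := partition_fun_gt0 lam eta alpha_g g alpha_g0 hg K hK x.
have mf := strongly_convex_measurable alpha_f f alpha_f0 hf.
have mpsi2 x : measurable_fun setT (fun y => psi (x, y)).
  exact: (measurableT_comp mpsi (pair1_measurable x)).
have mKpsi : measurable_fun setT (fun x => \int[K x]_y psi (x, y))%E.
  exact: (measurable_fun_integral_finite_kernel psi K).
have Kpsi0 x : (0 <= \int[K x]_y psi (x, y))%E by exact: integral_ge0.
pose rho x := c * (expR (- f x) * Z x).
have rho0 x : 0 <= rho x by rewrite !mulr_ge0 ?expR_ge0// ltW.
have mefZ : measurable_fun setT (fun x => expR (- f x) * Z x).
  by apply: measurable_funM => //; apply: measurableT_comp => //; exact: measurableT_comp.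
have mrho : measurable_fun setT rho by exact: measurable_funM.
rewrite (ge0_integral_density pi lam rho)//; last 2 first.
- exact: (le_lt_trans (probability_le1 pi measurableT) (ltry _)).
- move=> A mA; transitivity (c%:E * \int[lam]_(x in A) (expR (- f x) * Z x)%:E)%E.
    exact: hpi.
  rewrite -ge0_integralZl//.
  + by apply/measurable_EFinP; exact: measurable_funTS.
  + by move=> x _; rewrite lee_fin mulr_ge0 ?expR_ge0// ltW.
  + by rewrite lee_fin ltW.
have mw := measurable_gibbs_weight1 eta alpha_g g alpha_g0 hg.
rewrite (eq_integral (fun x => c%:E * \int[lam]_y
     (psi (x, y) * (expR (- f x - g y - sqdist x y / (2 * eta)))%:E))%E).
  apply: ge0_integralZl => //.
  - apply: (measurable_fun_fubini_tonelli_F (m2 := lam) (fun z : d.-tuple R * d.-tuple R =>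
      psi z * (expR (- f z.1 - g z.2 - sqdist z.1 z.2 / (2 * eta)))%:E)%E).
      apply: emeasurable_funM => //; apply/measurable_EFinP.
      apply: measurableT_comp => //; apply: measurable_funB.
        apply: measurable_funB.
          by apply: measurableT_comp => //; exact: (measurableT_comp mf measurable_fst).
        exact: (measurableT_comp (strongly_convex_measurable alpha_g g alpha_g0 hg) measurable_snd).
      by apply: measurable_funM => //; exact: measurable_sqdist.
    by move=> z; rewrite mule_ge0// lee_fin expR_ge0.
  - by move=> x _; apply: integral_ge0 => y _; rewrite mule_ge0// lee_fin expR_ge0.
  - by rewrite lee_fin ltW.
move=> x _.
rewrite (ge0_integral_gibbs lam eta alpha_g g alpha_g0 hg K hK)//.
rewrite muleAC -EFinM /rho (_ : (Z x)^-1 * _ = c * expR (- f x)); last first.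
  by move: (Z x) (Z0 x) => z z0; field; exact: lt0r_neq0.
rewrite EFinM -muleA; congr (_ * _)%E.
rewrite -ge0_integralZl//.
- apply: eq_integral => y _; rewrite muleCA; congr (_ * _)%E.
  rewrite -EFinM -expRD /= (sqdistC y x); congr (expR _)%:E.
  by ring.
- by apply: emeasurable_funM => //; exact/measurable_EFinP.
- by move=> y _; rewrite mule_ge0// lee_fin expR_ge0.
Qed.

End disintegration.

(** * One half-step of the sampler *)

Section half_step.
Context {R : realType} {d : nat}.
Variable lam : {sigma_finite_measure set (d.-tuple R) -> \bar R}.
Hypothesis hlam : is_lebesgue lam.
Variables (eta alpha_f alpha_g : R) (f g : d.-tuple R -> R).
Hypotheses (eta0 : 0 < eta) (alpha_f0 : 0 < alpha_f) (alpha_g0 : 0 < alpha_g).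
Hypotheses (hf : strongly_convex alpha_f f) (hg : strongly_convex alpha_g g).
Variables K K' : R.-pker (d.-tuple R) ~> (d.-tuple R).
Hypothesis hK : forall y, exists c : R, 0 < c /\ forall B, measurable B ->
  K y B = (c%:E * \int[lam]_(x in B) (expR (- f x - sqdist x y / (2 * eta)))%:E)%E.
Variables piX piY : probability (d.-tuple R) R.
Hypothesis hpiY : exists c : R, 0 < c /\ forall B, measurable B ->
  piY B = (c%:E * \int[lam]_(y in B) (expR (- g y) * partition_fun lam eta f y)%:E)%E.
Hypothesis reversible : forall psi : d.-tuple R * d.-tuple R -> \bar R,
  measurable_fun setT psi -> (forall z, 0 <= psi z)%E ->
  (\int[piX]_x \int[K' x]_y psi (x, y) = \int[piY]_y \int[K y]_x psi (x, y))%E.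

(** By reversibility, the density of the new law with respect to [piY] is the average of [h] under
    the backward kernel [K], to which the contraction of conditional averages applies. *)
Lemma entropy_half_step (mu nu : probability (d.-tuple R) R) e :
  (forall B, measurable B -> nu B = \int[mu]_x K' x B)%E ->
  entropy_le mu piX e -> entropy_le nu piY (rho2 eta alpha_f alpha_g * e).
Proof.
move=> hnu [h [mh h0 hE ihl he]].
have mhE : measurable_fun setT (EFin \o h) by exact/measurable_EFinP.
have disint psi : measurable_fun setT psi -> (forall x, 0 <= psi x)%E ->
    (\int[piX]_x psi x = \int[piY]_y \int[K y]_x psi x)%E.
  move=> mpsi psi0.
  have := reversible (psi \o fst) (measurableT_comp mpsi measurable_fst) (fun z => psi0 z.1).
  move=> /= <-; apply: eq_integral => x _.
  by rewrite (eq_integral (cst (psi x)))// integral_cst// prob_kernel mule1.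
have h1 : (\int[piX]_x (h x)%:E = 1)%E by rewrite -hE// probability_setT.
have [mkk kk0 kkE ikl kkle] := contraction_density lam hlam eta alpha_f alpha_g f g eta0
  alpha_f0 alpha_g0 hf hg K hK piX piY hpiY disint h mh h0 h1 ihl.
eexists; split; [exact: mkk|exact: kk0| |exact: ikl|]; last first.
  by apply: (le_trans kkle); rewrite ler_wpM2l// rho2_ge0.
move=> B mB; rewrite hnu// kkE//.
have mKB : measurable_fun setT (K' ^~ B) by exact: measurable_kernel.
rewrite (ge0_integral_density mu piX h)//; last exact: (le_lt_trans (probability_le1 mu measurableT) (ltry _)).
pose psi (z : d.-tuple R * d.-tuple R) : \bar R := ((h z.1)%:E * (\1_B z.2)%:E)%E.
have mpsi : measurable_fun setT psi.
  apply: emeasurable_funM; first exact: (measurableT_comp mhE measurable_fst).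
  by apply/measurable_EFinP; exact: measurableT_comp.
have psi0 z : (0 <= psi z)%E by rewrite mule_ge0// lee_fin.
transitivity (\int[piX]_x \int[K' x]_y psi (x, y))%E.
  apply: eq_integral => x _; rewrite /psi /= ge0_integralZl//.
  - by rewrite integral_indic// setIT muleC.
  - by apply/measurable_EFinP.
  - by rewrite lee_fin.
rewrite (reversible psi mpsi psi0) [RHS]integral_mkcond; apply: eq_integral => y _.
rewrite /psi /= ge0_integralZr//; last by move=> x _; rewrite lee_fin.
by rewrite patchE indicE; case: ifP => _; rewrite ?mule1 ?mule0.
Qed.

End half_step.

Lemma snd_marginal {d1 d2} {T1 : measurableType d1} {T2 : measurableType d2} {R : realType}
    (P : probability (T1 * T2)%type R) :
  exists2 Q : probability T2 R, (forall B, measurable B -> Q B = P (snd @^-1` B)) &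
    forall psi : T2 -> \bar R, measurable_fun setT psi -> (forall y, 0 <= psi y)%E ->
      (\int[Q]_y psi y = \int[P]_z psi z.2)%E.
Proof.
pose X : {mfun (T1 * T2)%type >-> T2} :=
  HB.pack (@snd T1 T2) (isMeasurableFun.Build _ _ _ _ (@snd T1 T2) measurable_snd).
exists (distribution P X) => // psi mpsi psi0.
by rewrite ge0_integral_distribution.
Qed.

Theorem mainTheorem4 (R : realType) (d : nat)
  (lam : {sigma_finite_measure set (d.-tuple R) -> \bar R})
  (hlam : is_lebesgue lam)
  (eta alpha_f alpha_g : R) (heta : 0 < eta)
  (halpha_f : 0 < alpha_f) (halpha_g : 0 < alpha_g)
  (f g : d.-tuple R -> R)
  (hf : strongly_convex alpha_f f) (hg : strongly_convex alpha_g g)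
  (* the target pi^{XY}(x,y) propto exp(-f x - g y - ||x-y||^2/(2 eta)) *)
  (piXY : probability (d.-tuple R * d.-tuple R)%type R)
  (hpiXY : exists c : R, 0 < c /\
     forall A, measurable A ->
       piXY A = (c%:E * \int[(lam \x lam)%E]_(z in A)
          (expR (- f z.1 - g z.2 - sqdist z.1 z.2 / (2 * eta)))%:E)%E)
  (* its X-marginal pi^X *)
  (piX : probability (d.-tuple R) R)
  (hpiX : forall A, measurable A -> piX A = piXY (A `*` setT))
  (* the conditionals pi^{Y|X=x} and pi^{X|Y=y} *)
  (KY KX : R.-pker (d.-tuple R) ~> (d.-tuple R))
  (hKY : forall x, exists c : R, 0 < c /\
     forall B, measurable B ->
       KY x B = (c%:E * \int[lam]_(y in B)
          (expR (- g y - sqdist x y / (2 * eta)))%:E)%E)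
  (hKX : forall y, exists c : R, 0 < c /\
     forall B, measurable B ->
       KX y B = (c%:E * \int[lam]_(x in B)
          (expR (- f x - sqdist x y / (2 * eta)))%:E)%E)
  (* the Gibbs sampler: x^0 ~ mu0, y^k ~ pi^{Y|X=x^k}, x^{k+1} ~ pi^{X|Y=y^k};
     muX k = law of x^k, muXY k = law of (x^k, y^k) *)
  (mu0 : probability (d.-tuple R) R)
  (muX : nat -> probability (d.-tuple R) R)
  (muXY : nat -> probability (d.-tuple R * d.-tuple R)%type R)
  (hmuX0 : forall A, measurable A -> muX 0%N A = mu0 A)
  (hmuXY : forall k A, measurable A ->
     muXY k A = (\int[muX k]_x KY x [set y | A (x, y)])%E)
  (hmuXS : forall k B, measurable B ->
     muX k.+1 B = (\int[muXY k]_z KX z.2 B)%E) :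
  forall k : nat,
    (KL (muXY k) piXY <=
     KL mu0 piX * ((1 + eta * alpha_f) ^- (2 * k) * (1 + eta * alpha_g) ^- (2 * k))%:E)%E.
Proof.
have [c [c0 hc]] := hpiXY.
have mf := strongly_convex_measurable alpha_f f halpha_f hf.
have mg := strongly_convex_measurable alpha_g g halpha_g hg.
have hKY' x : exists c : R, 0 < c /\ forall B, measurable B ->
    KY x B = (c%:E * \int[lam]_(y in B) (expR (- g y - sqdist y x / (2 * eta)))%:E)%E.
  have [c' [c'0 h]] := hKY x; exists c'; split; first exact: c'0.
  move=> B mB; apply: eq_trans (h B mB) _; apply: (congr1 (mule c'%:E)).
  by apply: eq_integral => y _; rewrite sqdistC.
pose om (z : d.-tuple R * d.-tuple R) := expR (- f z.1 - g z.2 - sqdist z.1 z.2 / (2 * eta)).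
have om0 z : 0 <= om z by exact: expR_ge0.
have mom : measurable_fun setT om.
  apply: measurableT_comp => //; apply: measurable_funB.
    apply: measurable_funB; last exact: (measurableT_comp mg measurable_snd).
    by apply: measurableT_comp => //; exact: (measurableT_comp mf measurable_fst).
  by apply: measurable_funM => //; exact: measurable_sqdist.
have momE : measurable_fun setT (EFin \o om) by exact/measurable_EFinP.
have joint (psi : _ -> \bar R) : measurable_fun setT psi -> (forall z, 0 <= psi z)%E ->
    (\int[piXY]_z psi z = c%:E * \int[lam \x lam]_z (psi z * (om z)%:E))%E.
  move=> mpsi psi0; have [m mE] := product_sigma_finite lam lam.
  have piXYfin := le_lt_trans (probability_le1 piXY measurableT) (ltry _).
  have mcom : measurable_fun setT (fun z => c * om z) by exact: measurable_funM.
  have com0 z : 0 <= c * om z by rewrite mulr_ge0// ltW.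
  have dens A : measurable A -> piXY A = (\int[m]_(z in A) (c * om z)%:E)%E.
    move=> mA; apply: eq_trans (hc A mA) _.
    have momA : measurable_fun A (fun z => (om z)%:E).
      by apply/measurable_EFinP; exact: measurable_funTS.
    rewrite -(ge0_integralZl (lam \x lam)%E mA momA); last 2 first.
    - by move=> z _; rewrite lee_fin.
    - by rewrite lee_fin ltW.
    by apply: eq_measure_integral => B _ _; exact/esym/mE.
  rewrite (ge0_integral_density piXY m (fun z => c * om z) psi piXYfin mcom com0 dens mpsi psi0).
  have mpo : measurable_fun setT (fun z => psi z * (om z)%:E)%E by exact: emeasurable_funM.
  rewrite -(ge0_integralZl (lam \x lam)%E measurableT mpo); last 2 first.
  - by move=> z _; rewrite mule_ge0// lee_fin.
  - by rewrite lee_fin ltW.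
  transitivity (\int[m]_z (c%:E * (psi z * (om z)%:E)))%E.
    by apply: eq_integral => z _; rewrite EFinM muleCA.
  by apply: eq_measure_integral => B _ _; exact: mE.
have joint1 (psi : _ -> \bar R) : measurable_fun setT psi -> (forall z, 0 <= psi z)%E ->
    (\int[piXY]_z psi z = c%:E * \int[lam]_x \int[lam]_y (psi (x, y) * (om (x, y))%:E))%E.
  move=> mpsi psi0; rewrite joint//.
  rewrite (fubini_tonelli1 (fun z => psi z * (om z)%:E)%E)//; first exact: emeasurable_funM.
  by move=> z; rewrite mule_ge0// lee_fin.
have joint2 (psi : _ -> \bar R) : measurable_fun setT psi -> (forall z, 0 <= psi z)%E ->
    (\int[piXY]_z psi z = c%:E * \int[lam]_y \int[lam]_x (psi (x, y) * (om (x, y))%:E))%E.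
  move=> mpsi psi0; rewrite joint//.
  rewrite (fubini_tonelli2 (fun z => psi z * (om z)%:E)%E)//; first exact: emeasurable_funM.
  by move=> z; rewrite mule_ge0// lee_fin.
have omC x y : om (x, y) = expR (- g y - f x - sqdist y x / (2 * eta)).
  by rewrite /om /= sqdistC; congr expR; ring.
have [piY piYE piYI] := snd_marginal piXY.
have mind1 (B : set (d.-tuple R)) : measurable B ->
    measurable_fun setT (fun z : d.-tuple R * d.-tuple R => (\1_B z.1)%:E : \bar R).
  by move=> mB; apply/measurable_EFinP; apply: (measurableT_comp _ measurable_fst).
have mind2 (B : set (d.-tuple R)) : measurable B ->
    measurable_fun setT (fun z : d.-tuple R * d.-tuple R => (\1_B z.2)%:E : \bar R).
  by move=> mB; apply/measurable_EFinP; apply: (measurableT_comp _ measurable_snd).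
have piXd B : measurable B ->
    piX B = (c%:E * \int[lam]_(x in B) (expR (- f x) * partition_fun lam eta g x)%:E)%E.
  move=> mB; rewrite -(integral_marginal lam eta alpha_g f g halpha_g hg KY hKY' B mB).
  rewrite -(joint1 (fun z => (\1_B z.1)%:E) (mind1 B mB)); last by move=> z; rewrite lee_fin.
  rewrite hpiX// -[LHS]mul1e -integral_cst; last exact: measurableX.
  rewrite [LHS]integral_mkcond; apply: eq_integral => z _.
  rewrite patchE indicE; case: ifPn => [/set_mem[zB _]|]; first by rewrite mem_set.
  by move=> /negP zB; rewrite memNset// => hB; apply: zB; rewrite mem_set.
have piYd B : measurable B ->
    piY B = (c%:E * \int[lam]_(y in B) (expR (- g y) * partition_fun lam eta f y)%:E)%E.
  move=> mB; rewrite -(integral_marginal lam eta alpha_f g f halpha_f hf KX hKX B mB).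
  transitivity (\int[piXY]_z (\1_B z.2)%:E)%E.
    rewrite piYE// -[LHS]mul1e -integral_cst; last first.
      by rewrite -[X in measurable X]setTI; exact: measurable_snd.
    rewrite [LHS]integral_mkcond; apply: eq_integral => z _.
    rewrite patchE indicE; case: ifPn => [/set_mem zB|]; first by rewrite mem_set.
    by move=> /negP zB; rewrite memNset// => hB; apply: zB; rewrite mem_set.
  rewrite (joint2 (fun z => (\1_B z.2)%:E) (mind2 B mB)); last by move=> z; rewrite lee_fin.
  apply: (congr1 (mule c%:E)); apply: eq_integral => y _; apply: eq_integral => x _.
  by rewrite omC.
pose sw (z : d.-tuple R * d.-tuple R) := (z.2, z.1).
have msw : measurable_fun setT sw by exact: measurable_fun_pair.
have DX (psi : _ -> \bar R) : measurable_fun setT psi -> (forall z, 0 <= psi z)%E ->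
    (\int[piX]_x \int[KY x]_y psi (x, y) = \int[piXY]_z psi z)%E.
  move=> mpsi psi0; rewrite joint1//.
  exact: (integral_disintegration lam eta alpha_f alpha_g f g halpha_f halpha_g hf hg
    KY hKY' c c0 piX piXd psi mpsi psi0).
have DY (psi : _ -> \bar R) : measurable_fun setT psi -> (forall z, 0 <= psi z)%E ->
    (\int[piY]_y \int[KX y]_x psi (x, y) = \int[piXY]_z psi z)%E.
  move=> mpsi psi0; rewrite joint2//.
  have := integral_disintegration lam eta alpha_g alpha_f g f halpha_g halpha_f hg hf
    KX hKX c c0 piY piYd (psi \o sw) (measurableT_comp mpsi msw) (fun z => psi0 (sw z)).
  move=> ->; apply: (congr1 (mule c%:E)); apply: eq_integral => y _; apply: eq_integral => x _.
  by rewrite omC.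
pose r := rho2 eta alpha_f alpha_g.
have revXY (psi : _ -> \bar R) : measurable_fun setT psi -> (forall z, 0 <= psi z)%E ->
    (\int[piX]_x \int[KY x]_y psi (x, y) = \int[piY]_y \int[KX y]_x psi (x, y))%E.
  by move=> mpsi psi0; apply: eq_trans (DX psi mpsi psi0) (esym (DY psi mpsi psi0)).
have revYX (psi : _ -> \bar R) : measurable_fun setT psi -> (forall z, 0 <= psi z)%E ->
    (\int[piY]_y \int[KX y]_x psi (y, x) = \int[piX]_x \int[KY x]_y psi (y, x))%E.
  move=> mpsi psi0; apply: esym.
  exact: (revXY (psi \o sw) (measurableT_comp mpsi msw) (fun z => psi0 (sw z))).
have stepXY (mu nu : probability (d.-tuple R) R) e :
    (forall B, measurable B -> nu B = \int[mu]_x KY x B)%E ->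
    entropy_le mu piX e -> entropy_le nu piY (r * e).
  exact: (entropy_half_step lam hlam eta alpha_f alpha_g f g heta halpha_f halpha_g hf hg
    KX KY hKX piX piY (ex_intro _ c (conj c0 piYd)) revXY mu nu e).
have rC : rho2 eta alpha_g alpha_f = r by rewrite /r /rho2 mulrC.
have stepYX (mu nu : probability (d.-tuple R) R) e :
    (forall B, measurable B -> nu B = \int[mu]_y KX y B)%E ->
    entropy_le mu piY e -> entropy_le nu piX (r * e).
  move=> H1 H2; rewrite -rC.
  exact: (entropy_half_step lam hlam eta alpha_g alpha_f g f heta halpha_g halpha_f hg hf
    KY KX hKY' piY piX (ex_intro _ c (conj c0 piXd)) revYX mu nu e H1 H2).
have chain e k : entropy_le mu0 piX e -> entropy_le (muX k) piX ((r * r) ^+ k * e).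
  move=> he; elim: k => [|k IH].
    have [h [mh h0 hE ihl hle]] := he; exists h; split => //; last by rewrite expr0 mul1r.
    by move=> A mA; rewrite hmuX0// hE.
  (* The law of [y^k], through which the step from [x^k] to [x^(k+1)] factors. *)
  have [muY muYE muYI] := snd_marginal (muXY k).
  have IHY : entropy_le muY piY (r * ((r * r) ^+ k * e)).
    apply: stepXY IH => B mB; rewrite muYE// hmuXY//.
    by rewrite -[X in measurable X]setTI; exact: measurable_snd.
  rewrite exprS -mulrA -mulrA; apply: stepYX IHY => B mB.
  rewrite hmuXS//; apply: esym.
  exact: (muYI (KX ^~ B) (measurable_kernel KX B mB) (fun y => measure_ge0 _ _)).
have final e k : entropy_le (muX k) piX e -> (KL (muXY k) piXY <= e%:E)%E.
  move=> [h [mh h0 hE ihl hle]].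
  have mh1 : measurable_fun setT (h \o @fst (d.-tuple R) (d.-tuple R)).
    exact: (measurableT_comp mh measurable_fst).
  rewrite (KL_density (muXY k) piXY (h \o fst) mh1 (fun z => h0 z.1)).
    pose phi x : \bar R := (h x * ln (h x))%:E.
    have mphi : measurable_fun setT phi.
      by apply/measurable_EFinP; apply: measurable_funM => //; exact: measurableT_comp.
    have marg (psi : d.-tuple R -> \bar R) : measurable_fun setT psi -> (forall x, 0 <= psi x)%E ->
        (\int[piXY]_z psi z.1 = \int[piX]_x psi x)%E.
      move=> mpsi psi0.
      rewrite -(DX (psi \o fst) (measurableT_comp mpsi measurable_fst) (fun z => psi0 z.1)).
      apply: eq_integral => x _ /=.
      by rewrite (eq_integral (cst (psi x)))// integral_cst// prob_kernel mule1.
    apply: (@le_trans _ _ (\int[piX]_x phi x)%E); last first.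
      by rewrite -(EFin_Rintegral _ _ ihl) lee_fin.
    rewrite le_eqVlt; apply/orP; left; apply/eqP.
    rewrite integralE [RHS]integralE -!marg//.
    - by congr (_ - _)%E; apply: eq_integral => z _; rewrite ?funeposE ?funenegE.
    - exact: measurable_funeneg.
    - exact: measurable_funepos.
  (* It remains to see that [h \o fst] is a density of [muXY k]: disintegrating [piXY] along [KY]
     turns its integral over [A] into the definition of the joint law. *)
  move=> A mA; rewrite hmuXY//.
  have mhE : measurable_fun setT (EFin \o h) by exact/measurable_EFinP.
  pose psi (z : d.-tuple R * d.-tuple R) : \bar R := ((h z.1)%:E * (\1_A z)%:E)%E.
  have mA1 : measurable_fun setT (fun z : d.-tuple R * d.-tuple R => (\1_A z)%:E : \bar R).
    by apply/measurable_EFinP.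
  have mpsi : measurable_fun setT psi.
    by apply: emeasurable_funM => //; exact: (measurableT_comp mhE measurable_fst).
  have psi0 z : (0 <= psi z)%E by rewrite mule_ge0// lee_fin.
  transitivity (\int[piXY]_z psi z)%E; last first.
    rewrite [RHS]integral_mkcond; apply: eq_integral => z _.
    by rewrite /psi patchE indicE; case: ifP => _; rewrite ?mule1 ?mule0.
  rewrite -(DX psi mpsi psi0).
  have mAx x : measurable [set y | A (x, y)].
    by have := pair1_measurable x measurableT mA; rewrite setTI.
  have KA x : (\int[KY x]_y (\1_A (x, y))%:E = KY x [set y | A (x, y)])%E.
    rewrite (eq_integral (fun y => (\1_([set y | A (x, y)]) y)%:E)); last first.
      move=> y _; rewrite !indicE; congr ((_ : bool)%:R%:E); apply/idP/idP; rewrite !inE//.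
    by rewrite integral_indic// setIT.
  have mKA : measurable_fun setT (fun x => KY x [set y | A (x, y)]).
    rewrite (_ : (fun x => _) = (fun x => \int[KY x]_y (\1_A (x, y))%:E)%E); last first.
      by apply/funext => x; rewrite KA.
    apply: (measurable_fun_integral_finite_kernel (fun z => (\1_A z)%:E) KY) => //.
  have mufin := le_lt_trans (probability_le1 (muX k) measurableT) (ltry _).
  rewrite (ge0_integral_density (muX k) piX h _ mufin mh h0 hE mKA (fun x => measure_ge0 _ _)).
  apply: eq_integral => x _; rewrite -KA muleC /psi /=.
  rewrite ge0_integralZl//.
  - exact: (measurableT_comp mA1 (pair1_measurable x)).
  - by rewrite lee_fin.
move=> k.
have a0 : 0 < 1 + eta * alpha_f by rewrite addr_gt0// mulr_gt0.
have b0 : 0 < 1 + eta * alpha_g by rewrite addr_gt0// mulr_gt0.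
have fac0 : 0 < (1 + eta * alpha_f) ^- (2 * k) * (1 + eta * alpha_g) ^- (2 * k).
  by rewrite mulr_gt0// invr_gt0 exprn_gt0.
(* With infinite initial entropy the right side is [+oo], the factor being positive. *)
have [->|[e -> he]] := KL_entropy_le mu0 piX.
  by rewrite gt0_mulye ?leey.
apply: le_trans (final _ k (chain e k he)) _.
rewrite -EFinM lee_fin mulrC le_eqVlt; apply/orP; left; apply/eqP; congr (_ * _).
rewrite /r /rho2 -expr2 -exprM exprVn exprMn invfM.
by rewrite -!exprVn.
Qed.
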